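(* Let $n\geq2$ and $n/2+1<\beta\leq n+1$, let $\omega(x)=1+|x|^2$ on $\mathbb{R}^n$, let $\mu_\beta$ be the generalised Cauchy probability measure with density proportional to $\omega^{-\beta}$, and let $Lf=\omega\Delta f-2(\beta-1)\langle x,df\rangle$, with associated semigroup $(\mathbf{P}_t)_{t\geq0}$. Then $\lambda_1(-L)\geq4(\beta-n/2-1)$, and for all $f\in\mathcal{C}_c^\infty(\mathbb{R}^n)$, $$4\Big(\beta-\frac n2-1\Big)\mathrm{Var}_{\mu_\beta}(f)-\int_{\mathbb{R}^n}|df|^2(1+|x|^2)\,d\mu_\beta=-2\int_0^{+\infty}\!\int_{\mathbb{R}^n}\Big\{\frac{n}{n-1}\Big[\|\omega\,\mathrm{Hess}(\mathbf{P}_tf)\|^2_{HS}-\frac1n(\omega\Delta\mathbf{P}_tf)^2\Big]+4(\beta-1)\frac{n+1-\beta}{n-1}\Big[|d\mathbf{P}_tf|^2|x|^2-\langle d\mathbf{P}_tf,x\rangle^2\Big]\Big\}\,d\mu_\beta\,dt.$$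
   Context: $d\mu_\beta=\frac{1}{Z_{n,\beta}}(1+|x|^2)^{-\beta}dx$, with $Z_{n,\beta}$ the normalising constant. The operator $L$, defined on $\mathcal{C}_c^\infty(\mathbb{R}^n)$, is symmetric and essentially self-adjoint in $L^2(\mu_\beta)$; its self-adjoint extension, still denoted $L$, has domain $\mathcal{D}(L)\subset L^2(\mu_\beta)$, and $\mathbf{P}_t=e^{tL}$ is the $L^2(\mu_\beta)$-semigroup it generates. $\|\cdot\|_{HS}$ is the Hilbert-Schmidt norm. The spectral gap is $$\lambda_1(-L)=\inf\left\{\frac{\int_{\mathbb{R}^n}-f\,Lf\,d\mu_\beta}{\mathrm{Var}_{\mu_\beta}(f)}\ :\ f\in\mathcal{D}(L),\ \mathrm{Var}_{\mu_\beta}(f)\neq0\right\}.$$ *)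

(* Defs.v *)
From HB Require Import structures.
From mathcomp Require Import all_boot all_order all_algebra.
From mathcomp Require Import all_classical all_reals all_analysis.
From mathcomp Require Import measurable_realfun.

Set Implicit Arguments.
Unset Strict Implicit.
Unset Printing Implicit Defensive.
Import Order.TTheory GRing.Theory Num.Theory.
Import numFieldNormedType.Exports.

Local Open Scope classical_set_scope.
Local Open Scope ring_scope.

Definition measure_rV_display : measure_display -> measure_display.
Proof. exact. Qed.

(* The sigma-algebra on R^n = 'rV[R]_n is generated by the coordinates, as for
   the library's sigma-algebra on n.-tuple R. *)
Section measurable_rV.
Context {R : realType} {n : nat}.

Definition rV_coord (i : 'I_n) (x : 'rV[R]_n) : measurableTypeR R := x ord0 i.

Let rV_set0 : g_sigma_preimage rV_coord set0.
Proof. exact: sigma_algebra0. Qed.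

Let rV_setC A : g_sigma_preimage rV_coord A -> g_sigma_preimage rV_coord (~` A).
Proof. exact: sigma_algebraC. Qed.

Let rV_bigcup (F : (set 'rV[R]_n)^nat) :
  (forall i, g_sigma_preimage rV_coord (F i)) ->
  g_sigma_preimage rV_coord (\bigcup_i (F i)).
Proof. exact: sigma_algebra_bigcup. Qed.

HB.instance Definition _ :=
  @isMeasurable.Build (measure_rV_display default_measure_display)
  'rV[R]_n (g_sigma_preimage rV_coord) rV_set0 rV_setC rV_bigcup.

Lemma measurable_rV_coord (i : 'I_n) : measurable_fun [set: 'rV[R]_n] (rV_coord i).
Proof.
move=> _ Y mY; rewrite setTI; apply: sub_sigma_algebra => /=.
rewrite -bigcup_seq/=; exists i => /=; first by rewrite mem_index_enum.
by exists Y => //; rewrite setTI.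
Qed.

Lemma measurable_fun_rVP d (T : measurableType d) (f : T -> 'rV[R]_n) :
  (forall i, measurable_fun [set: T] (rV_coord i \o f)) ->
  measurable_fun [set: T] f.
Proof.
move=> mf.
have prefS : preimage_set_system [set: T] f (g_sigma_preimage rV_coord)
    `<=` measurable.
  rewrite -g_sigma_preimage_comp.
  apply: smallest_sub; first exact: sigma_algebra_measurable.
  rewrite -bigcup_seq; apply: bigcup_sub => i _.
  by move=> A [B mB <-]; exact: mf.
by move=> _ A mA; apply: prefS; exists A.
Qed.

End measurable_rV.

Section lebesgue_rV.
Context {R : realType}.

Definition rV_cons n (p : 'rV[R]_n * measurableTypeR R) : 'rV[R]_n.+1 :=
  row_mx (p.2)%:M p.1.

Lemma measurable_rV_cons n : measurable_fun setT (@rV_cons n).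
Proof.
apply: measurable_fun_rVP => i.
rewrite -(@splitK 1 n i); case: (fintype.split _) => j /=.
  rewrite (_ : _ \o _ = snd) //.
  by apply/funext => p; rewrite [LHS](@row_mxEl R 1 1 n) mxE (ord1 j).
rewrite (_ : _ \o _ = rV_coord j \o fst).
  by apply: measurableT_comp => //; exact: measurable_rV_coord.
by apply/funext => p; rewrite [LHS](@row_mxEr R 1 1 n).
Qed.

Section step.
Variables (n : nat) (m : {measure set 'rV[R]_n -> \bar R}).

Definition lebesgue_step : set 'rV[R]_n.+1 -> \bar R :=
  pushforward (m \x (@lebesgue_measure R))%E (@rV_cons n).

HB.instance Definition _ := Measure.copy lebesgue_step
  (measure_function_pushforward__canonical__measure_function_Measure
     (m \x (@lebesgue_measure R))%E (@measurable_rV_cons n)).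
End step.

Fixpoint lebesgue_rV (n : nat) : {measure set 'rV[R]_n -> \bar R} :=
  match n with
  | 0 => dirac (0 : 'rV[R]_0)
  | n'.+1 => lebesgue_step (lebesgue_rV n')
  end.

End lebesgue_rV.

Lemma lebesgue_rV_box {R : realType} (n : nat) (a b : 'I_n -> R) :
  (forall i, a i <= b i) ->
  lebesgue_rV n [set x : 'rV[R]_n | forall i, a i <= x ord0 i <= b i] =
  (\prod_i (b i - a i))%:E.
Proof.
elim: n a b => [|n IHn] a b ab.
  rewrite big_ord0 /= diracE mem_set//= => -[].
  by [].
rewrite big_ord_recl mulrC EFinM.
pose A := [set x : 'rV[R]_n |
  forall i, a (lift ord0 i) <= x ord0 i <= b (lift ord0 i)].
rewrite -(IHn (a \o lift ord0) (b \o lift ord0)) => [|i]; last exact: ab.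
have mA : measurable A.
  rewrite (_ : A = \bigcap_(i in [set: 'I_n])
      (rV_coord i @^-1` `[a (lift ord0 i), b (lift ord0 i)]%classic)).
    apply: fin_bigcap_measurable => // i _.
    rewrite -[X in measurable X]setTI; exact: measurable_rV_coord.
  apply/seteqP; split => x /= Ax i; first by move=> _; rewrite /= in_itv/=; exact: Ax.
  by have := Ax i I; rewrite /= in_itv.
have -> : ((b ord0 - a ord0)%:E : \bar R) =
    (@lebesgue_measure R) `[a ord0, b ord0]%classic.
  rewrite lebesgue_measure_itv/= lte_fin EFinB.
  case: ltgtP (ab ord0) => // ->; by rewrite subee.
rewrite -product_measure1E//=.
rewrite /lebesgue_step /pushforward; congr product_measure1.
apply/seteqP; split => -[x t]; rewrite /= /rV_cons => H.
- split.
    move=> i; have := H (lift ord0 i).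
    have -> : lift ord0 i = rshift 1 i by exact/val_inj.
    by rewrite (@row_mxEr R 1 1 n).
  rewrite in_itv/=; have := H ord0.
  have -> : ord0 = lshift n ord0 :> 'I_(1 + n) by exact/val_inj.
  by rewrite (@row_mxEl R 1 1 n) mxE eqxx mulr1n.
- case: H => Hx; rewrite in_itv/= => Ht i.
  case: (unliftP ord0 i) => [j|] ->.
    have := Hx j.
    have -> : lift ord0 j = rshift 1 j by exact/val_inj.
    by rewrite (@row_mxEr R 1 1 n).
  move: Ht.
  have -> : ord0 = lshift n ord0 :> 'I_(1 + n) by exact/val_inj.
  by rewrite (@row_mxEl R 1 1 n) mxE eqxx mulr1n.
Qed.

Section euclidean.
Context {R : realType} {n : nat}.
Implicit Types x y : 'rV[R]_n.

(* The library norm on 'rV[R]_n is the sup norm, hence these definitions. *)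
Definition dotv x y : R := \sum_i x ord0 i * y ord0 i.
Definition sqnorm x : R := dotv x x.

Definition HSnorm (M : 'M[R]_n) : R := Num.sqrt (\sum_i \sum_j M i j ^+ 2).

Definition omega x : R := 1 + sqnorm x.

Lemma measurable_omega : measurable_fun [set: 'rV[R]_n] omega.
Proof.
apply: measurable_funD => //.
apply: measurable_sum => i; apply: measurable_funM; exact: measurable_rV_coord.
Qed.

End euclidean.

Section cauchy_measure.
Context {R : realType} (n : nat) (beta : R).
Local Open Scope ereal_scope.

Definition cauchy_density (x : 'rV[R]_n) : \bar R := (omega x `^ (- beta))%:E.

Lemma measurable_cauchy_density : measurable_fun setT cauchy_density.
Proof.
apply/measurable_EFinP.
exact: (measurableT_comp (measurable_powR (- beta)%R) measurable_omega).
Qed.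

Definition cauchy_weight (A : set 'rV[R]_n) : \bar R :=
  \int[lebesgue_rV n]_(x in A) cauchy_density x.

Let weight0 : cauchy_weight set0 = 0.
Proof. exact: integral_set0. Qed.

Let weight_ge0 A : 0 <= cauchy_weight A.
Proof. by apply: integral_ge0 => x _; rewrite lee_fin powR_ge0. Qed.

Let weight_sigma_additive : semi_sigma_additive cauchy_weight.
Proof.
apply: semi_sigma_additive_nng_induced; first exact: measurable_cauchy_density.
by move=> x; rewrite lee_fin powR_ge0.
Qed.

HB.instance Definition _ := isMeasure.Build _ _ _ cauchy_weight
  weight0 weight_ge0 weight_sigma_additive.

(* [mnormalize] needs a default probability for weights of mass 0 or +oo; it is
   not used when n / 2 < beta, where 0 < Z_(n, beta) < +oo. *)
Definition cauchy_prob : probability 'rV[R]_n R :=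
  mnormalize cauchy_weight (dirac (0 : 'rV[R]_n)%R).

End cauchy_measure.

(* First and second order differential expressions, relative to a choice [D] of
   the partial derivatives: classical or in the sense of distributions. *)
Section differential_expressions.
Context {R : realType} {n : nat}.
Variable D : 'I_n -> ('rV[R]_n -> R) -> 'rV[R]_n -> R.
Implicit Types (f : 'rV[R]_n -> R) (x : 'rV[R]_n).

Definition gradient f x : 'rV[R]_n := \row_i D i f x.
Definition hessian f x : 'M[R]_n := \matrix_(i, j) D i (D j f) x.
Definition laplacian f x : R := \sum_i D i (D i f) x.

End differential_expressions.

Section smooth.
Context {R : realType} {n : nat}.
Implicit Types f : 'rV[R]_n -> R.

Definition partial (i : 'I_n) f : 'rV[R]_n -> R := 'D_(delta_mx ord0 i) f.

Definition smooth f := forall s : seq 'I_n,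
  continuous (foldr partial f s) /\
  forall i x, derivable (foldr partial f s) x (delta_mx ord0 i).

Definition test_function f :=
  smooth f /\ compact (closure [set x | f x != 0]).

End smooth.

Section weak_derivative.
Context {R : realType} {n : nat}.
Local Notation leb := (lebesgue_rV n).
Implicit Types u v : 'rV[R]_n -> R.

Definition locally_integrable_rV u := forall K : set 'rV[R]_n, compact K ->
  leb.-integrable K (EFin \o u).

Definition is_weak_partial (i : 'I_n) u v :=
  [/\ locally_integrable_rV u, locally_integrable_rV v &
  forall phi, test_function phi ->
    (\int[leb]_x (u x * partial i phi x)%:E =
     - \int[leb]_x (v x * phi x)%:E)%E].

(* A representative of the i-th distributional derivative, which is unique
   almost everywhere when it is a function (and then equal to the classical one
   wherever u is C^1); the value is 0 when it is not a function. *)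
Definition weak_partial (i : 'I_n) u : 'rV[R]_n -> R :=
  xget (fun=> 0) [set v | is_weak_partial i u v].

End weak_derivative.

Section operator.
Context {R : realType} {n : nat} (beta : R).
Local Notation mu := (cauchy_prob n beta).
Implicit Types f g : 'rV[R]_n -> R.

Definition cauchy_op f (x : 'rV[R]_n) : R :=
  omega x * laplacian partial f x
  - 2 * (beta - 1) * dotv x (gradient partial f x).

(* The graph of the closure in L^2(mu) of the operator on C_c^oo: since the
   latter is essentially self-adjoint, this closure is its (unique) self-adjoint
   extension. Elements of L^2(mu) are given by representatives, and
   [cauchy_generator f g] means that f is in D(L) and that L f = g mu-a.e. *)
Definition cauchy_generator f g :=
  [/\ f \in Lfun mu 2%:E, g \in Lfun mu 2%:E &
  exists u : ('rV[R]_n -> R)^nat,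
  [/\ forall k, test_function (u k),
      'N[mu]_2%:E[EFin \o (u k - f)%R]%E @[k --> \oo] --> 0%E &
      'N[mu]_2%:E[EFin \o (cauchy_op (u k) - g)%R]%E @[k --> \oo] --> 0%E]].

End operator.

(* [A f g] means that f is in the domain of the operator and A f = g. *)
Definition spectral_gap {d} {T : measurableType d} {R : realType}
    (mu : probability T R) (A : (T -> R) -> (T -> R) -> Prop) : \bar R :=
  ereal_inf [set r | exists f g, [/\ A f g, 'V_mu[f]%E != 0%E &
    r = (\int[mu]_x (- f x * g x)%:E / 'V_mu[f])%E]].

(* The strongly continuous semigroup of bounded operators on L^2(mu) with
   infinitesimal generator A, i.e. e^(tA); it acts on representatives. *)
Record is_semigroup_of {d} {T : measurableType d} {R : realType}
    (mu : probability T R) (A : (T -> R) -> (T -> R) -> Prop)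
    (P : R -> (T -> R) -> T -> R) : Prop := IsSemigroupOf {
  semigroup_Lfun : forall t f, 0 <= t ->
    f \in Lfun mu 2%:E -> P t f \in Lfun mu 2%:E;
  semigroup_linear : forall t a f g, 0 <= t ->
    f \in Lfun mu 2%:E -> g \in Lfun mu 2%:E ->
    P t (a *: f + g) = a *: P t f + P t g %[ae mu];
  semigroup_bounded : forall t, 0 <= t -> exists C : R,
    forall f, f \in Lfun mu 2%:E ->
    ('N[mu]_2%:E[EFin \o P t f] <= C%:E * 'N[mu]_2%:E[EFin \o f])%E;
  semigroup0 : forall f, f \in Lfun mu 2%:E -> P 0 f = f %[ae mu];
  semigroupD : forall s t f, 0 <= s -> 0 <= t -> f \in Lfun mu 2%:E ->
    P (s + t) f = P s (P t f) %[ae mu];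
  semigroup_continuous : forall f, f \in Lfun mu 2%:E ->
    'N[mu]_2%:E[EFin \o (P t f - f)%R]%E @[t --> 0^'+] --> 0%E;
  semigroup_generator : forall f g,
    f \in Lfun mu 2%:E -> g \in Lfun mu 2%:E ->
    (A f g <->
     'N[mu]_2%:E[EFin \o (t^-1 *: (P t f - f) - g)%R]%E @[t --> 0^'+] --> 0%E)
}.

(* Main.v *)
From HB Require Import structures.
Require Import Defs.
From mathcomp Require Import all_boot all_order all_algebra.
From mathcomp Require Import all_classical all_reals all_analysis.
From mathcomp Require Import measurable_realfun.
From mathcomp Require Import ring lra.

Set Implicit Arguments.
Unset Strict Implicit.
Unset Printing Implicit Defensive.
Import Order.TTheory GRing.Theory Num.Theory.
Import numFieldNormedType.Exports.
Local Open Scope classical_set_scope.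
Local Open Scope ring_scope.

(* The integrated Bochner identity.  For a test function u put
   E(u) = int omega |du|^2 dmu = - <u, L u>.  Three integrations by parts, against
   the fields omega^2 (Hess u du - (Lap u) du), omega |du|^2 x and
   omega <x, du> du weighted by omega^-beta, give
     |L u|^2 - lam E(u) = int Q(u) dmu,   lam = 4 (beta - n/2 - 1),
   where Q(u) is the integrand of the theorem, which is pointwise nonnegative
   because beta <= n + 1.  Hence lam E(u) <= |L u|^2, and sqrt(omega) du and
   omega Hess u are controlled in L^2 by L u.  Therefore, when u_k -> g and
   L u_k -> A g, the weighted derivatives converge in L^2, their limits are the
   weak derivatives of g, and the identity passes to the domain of A.

   Along the semigroup, with a(t) = |P_t f|^2 one has a' = - 2 E(P_t f) and
   E(P_t f)' = - 2 |P_t L f|^2 <= - 2 lam E(P_t f), so that E(P_t f) decays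
   exponentially.  By self-adjointness |P_t f - P_s f|^2 =
   a(t) + a(s) - 2 a((t + s)/2), so P_t f converges; the limit has zero weak
   gradient, hence is the mean of f.  Integrating over t the equality
   - (E(P_t f) - lam a(t))' / 2 = int Q(P_t f) dmu gives the identity, and
   its sign gives the spectral gap on the core, then on the domain. *)

(** * Lebesgue measure on R^n *)

(** The shape of the proof comes from what is known of [P]: the axioms of a strongly continuous
    semigroup whose generator is the closure of the operator on test functions, with neither
    contractivity nor self-adjointness. Self-adjointness is recovered along one orbit from the
    symmetry of the generator, by differentiating <P_(c+q) f, P_(c-q) f> in q. This needs two-sided
    derivatives of orbits, and the left one rests on a bound of the operators uniform over compact
    time intervals.

    Test functions are convenient starting points because f, L f and L L f are all test functions,
    so that E(P_t f) can be differentiated as well. That the limit has zero weak gradient is read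
    off from a bound of <P_t f, d_i phi>^2 by a multiple of E(P_t f).

    P_t f has derivatives only as weighted L^2 limits: omega^(1/2) du and omega Hess u converge, and
    the integral of Q is a continuous quadratic form in these two, because the coordinates enter
    through the bounded factors x_i / omega^(1/2). Elements of L^2 are functions rather than
    classes, so the Hilbert space arguments are run in a semi-inner product space, with identities
    up to null vectors. *)

Lemma norm_coord_le {R : realType} n (x : 'rV[R]_n) i : `|x ord0 i| <= `|x|.
Proof.
rewrite [leRHS]/Num.norm /= mx_normrE; apply/bigmax_geP; right => /=.
by exists (ord0, i).
Qed.

Section sigma_finite_rV.
Context {R : realType}.
Definition box n (M : R) : set 'rV[R]_n := [set x | forall i, - M <= x ord0 i <= M].

Lemma measurable_box n M : measurable (@box n M).
Proof.
rewrite (_ : box M = \bigcap_(i in [set: 'I_n]) (rV_coord i @^-1` `[- M, M]%classic)).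
  apply: fin_bigcap_measurable => // i _.
  by rewrite -[X in measurable X]setTI; exact: measurable_rV_coord.
apply/seteqP; split => x /= Ax i; first by move=> _; rewrite /= in_itv/=; exact: Ax.
by have := Ax i I; rewrite /= in_itv.
Qed.

Lemma box_cover n : [set: 'rV[R]_n] = \bigcup_(k : nat) box k%:R.
Proof.
apply/seteqP; split => // x _.
exists (Num.truncn `|x|).+1 => // i; rewrite -ler_norml.
apply: le_trans (ltW (truncnS_gt _)).
exact: norm_coord_le.
Qed.

Lemma lebesgue_rV_box_lty n (M : R) : (lebesgue_rV n (box M) < +oo)%E.
Proof.
have [M0|M0] := leP 0 M; last first.
  apply: (@le_lt_trans _ _ (lebesgue_rV n (box 0))).
    apply: le_measure; rewrite ?inE; try exact: measurable_box.
    move=> x bx i; have := bx i; lra.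
  by rewrite /box (lebesgue_rV_box (a:=fun=> - 0) (b:=fun=>0)) ?ltry// => i; rewrite oppr0.
by rewrite /box (lebesgue_rV_box (a:=fun=> - M) (b:=fun=>M)) ?ltry// => i; lra.
Qed.

Lemma sigma_finite_rV n : sigma_finite [set: 'rV[R]_n] (lebesgue_rV n).
Proof.
exists (fun k => box k%:R); first exact: box_cover.
by move=> k; split; [exact: measurable_box|exact: lebesgue_rV_box_lty].
Qed.

(* A copy of [lebesgue_rV n] to carry the sigma-finite structure. *)
Definition sigma_finite_lebesgue_rV n : set 'rV[R]_n -> \bar R := lebesgue_rV n.

HB.instance Definition _ n := Measure.copy (@sigma_finite_lebesgue_rV n) (lebesgue_rV n).

HB.instance Definition _ n :=
  Measure_isSigmaFinite.Build _ _ _ (@sigma_finite_lebesgue_rV n) (@sigma_finite_rV n).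

End sigma_finite_rV.
Section open_rV.
Context {R : realType} {n : nat}.
Implicit Types x : 'rV[R]_n.

Lemma measurable_rV_ball x (e : R) : measurable (ball x e).
Proof.
have [e0|e0] := ltP 0 e; last first.
  rewrite (_ : ball x e = set0)//; apply/seteqP; split => // y [] /=.
  by rewrite ltNge e0.
rewrite (_ : ball x e = \bigcap_(i in [set: 'I_n]) (rV_coord i @^-1` ball (x ord0 i) e)).
  apply: fin_bigcap_measurable => // i _.
  by rewrite -[X in measurable X]setTI; apply: measurable_rV_coord => //; exact: measurable_ball.
apply/seteqP; split => y.
  by move=> [_ h] i _; exact: h.
by move=> h; split => // i j; rewrite (ord1 i); exact: h.
Qed.

(** Balls of the sup norm with rational centre and radius 1/(k+1) form a countable base. The radius
    is taken below e/2 because the rational ball only contains x, so that its points are at distance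
    up to twice the radius from x. *)
Lemma open_measurable_rV (U : set 'rV[R]_n) : open U -> measurable U.
Proof.
move=> oU.
pose F (p : 'rV[rat]_n * nat) : set 'rV[R]_n :=
  if `[< ball (map_mx ratr p.1 : 'rV[R]_n) p.2.+1%:R^-1 `<=` U >]
  then ball (map_mx ratr p.1 : 'rV[R]_n) p.2.+1%:R^-1 else set0.
rewrite (_ : U = \bigcup_p F p).
  apply: countable_bigcupT_measurable.
    by apply: countableP.
  by move=> p; rewrite /F; case: ifP => // _; exact: measurable_rV_ball.
apply/seteqP; split => [x Ux|x [p _]]; last first.
  by rewrite /F; case: ifPn => // /asboolP; exact.
have /nbhs_ballP[e /= e0 xeU] : nbhs x U by exact: open_nbhs_nbhs.
have [k ke] : exists k, k.+1%:R^-1 < e / 2.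
  exists (Num.truncn (e / 2)^-1).
  rewrite invf_plt ?posrE ?divr_gt0// .
  by rewrite truncnS_gt.
have k0 : 0 < k.+1%:R^-1 :> R by rewrite invr_gt0.
have qi i : exists q : rat, ball (ratr q : R) k.+1%:R^-1 (x ord0 i).
  have : x ord0 i - k.+1%:R^-1 < x ord0 i + k.+1%:R^-1.
    by rewrite ltrBlDr -addrA ltrDl addr_gt0.
  move=> /rat_in_itvoo[q]; rewrite in_itv/= => /andP[h1 h2]; exists q.
  by rewrite /ball/= ltr_distl h1 h2.
have /(_ _)/cid-/all_sig[q hq] := qi.
exists (\row_i q i, k) => //; rewrite /F /=.
have xq : ball (map_mx ratr (\row_i q i) : 'rV[R]_n) k.+1%:R^-1 x.
  by split => // i j; rewrite (ord1 i) !mxE.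
case: ifPn => // /asboolP[] y yq; apply: xeU.
apply: (@le_ball _ _ _ (k.+1%:R^-1 + k.+1%:R^-1)).
  by rewrite (splitr e) lerD// ltW.
exact: ball_triangle (ball_sym xq) yq.
Qed.

Lemma closed_measurable_rV (U : set 'rV[R]_n) : closed U -> measurable U.
Proof.
by move=> cU; rewrite -(setCK U); apply: measurableC; apply: open_measurable_rV; exact: closed_openC.
Qed.

Lemma continuous_measurable_rV (f : 'rV[R]_n -> R) :
  continuous f -> measurable_fun setT f.
Proof.
move=> cf; apply: (measurability _ (RGenOpens.measurableE R)) => _ [_ [a [b ->]] <-].
rewrite setTI; apply: open_measurable_rV.
by apply: open_comp => // x _; exact: cf.
Qed.

End open_rV.

Section fubini_rV.
Context {R : realType}.
Local Notation leb1 := (@lebesgue_measure R).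

Lemma integral_sigma_finite_lebesgue_rV n (f : 'rV[R]_n -> \bar R) :
  (\int[sigma_finite_lebesgue_rV (n:=n)]_x f x = \int[lebesgue_rV n]_x f x)%E.
Proof. exact: eq_measure_integral. Qed.

Lemma lebesgue_rVSE n (A : set 'rV[R]_n.+1) :
  lebesgue_rV n.+1 A = (@sigma_finite_lebesgue_rV R n \x leb1)%E (@rV_cons R n @^-1` A).
Proof. by rewrite /= /lebesgue_step /pushforward; exact: eq_measure_integral. Qed.

Let push n : {measure set 'rV[R]_n.+1 -> \bar R} :=
  measure_function_pushforward__canonical__measure_function_Measure
     (@sigma_finite_lebesgue_rV R n \x leb1)%E (@measurable_rV_cons R n).

Lemma ge0_integral_rV_cons n (f : 'rV[R]_n.+1 -> \bar R) :
  measurable_fun setT f -> (forall x, 0 <= f x)%E ->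
  (\int[lebesgue_rV n.+1]_x f x =
   \int[@sigma_finite_lebesgue_rV R n \x leb1]_p f (rV_cons p))%E.
Proof.
move=> mf f0; rewrite (eq_measure_integral (@push n)); last first.
  by move=> A _ _; exact: lebesgue_rVSE.
by rewrite ge0_integral_pushforward// ?preimage_setT//; exact: measurable_rV_cons.
Qed.

Lemma tonelli_rV n (f : 'rV[R]_n.+1 -> \bar R) :
  measurable_fun setT f -> (forall x, 0 <= f x)%E ->
  (\int[lebesgue_rV n.+1]_x f x =
   \int[lebesgue_rV n]_x \int[leb1]_t f (rV_cons (x, t)))%E.
Proof.
move=> mf f0; rewrite ge0_integral_rV_cons//.
rewrite (fubini_tonelli1 (fun p => f (rV_cons p)))//.
by apply: measurableT_comp mf _; exact: measurable_rV_cons.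
Qed.

Lemma integrable_rV_cons n (f : 'rV[R]_n.+1 -> \bar R) :
  (lebesgue_rV n.+1).-integrable setT f ->
  (@sigma_finite_lebesgue_rV R n \x leb1)%E.-integrable setT (f \o @rV_cons R n).
Proof.
move=> /integrableP[mf fi]; apply/integrableP; split.
  by apply: measurableT_comp mf _; exact: measurable_rV_cons.
by rewrite ge0_integral_rV_cons// in fi; exact: measurableT_comp.
Qed.

Lemma integral_rV_cons n (f : 'rV[R]_n.+1 -> \bar R) :
  (lebesgue_rV n.+1).-integrable setT f ->
  (\int[lebesgue_rV n.+1]_x f x =
   \int[@sigma_finite_lebesgue_rV R n \x leb1]_p f (rV_cons p))%E.
Proof.
move=> fi; rewrite (eq_measure_integral (@push n)); last first.
  by move=> A _ _; exact: lebesgue_rVSE.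
rewrite integral_pushforward ?preimage_setT//; first exact: measurable_rV_cons.
  by have /integrableP[] := fi.
by apply: integrable_rV_cons.
Qed.

Lemma fubini_rV1 n (f : 'rV[R]_n.+1 -> \bar R) :
  (lebesgue_rV n.+1).-integrable setT f ->
  (\int[lebesgue_rV n.+1]_x f x =
   \int[lebesgue_rV n]_x \int[leb1]_t f (rV_cons (x, t)))%E.
Proof.
move=> fi; rewrite integral_rV_cons//.
rewrite -(@integral12_prod_meas1 _ _ _ _ _ _ _ (f \o @rV_cons R n)); last exact: integrable_rV_cons.
exact: integral_sigma_finite_lebesgue_rV.
Qed.

Lemma fubini_rV2 n (f : 'rV[R]_n.+1 -> \bar R) :
  (lebesgue_rV n.+1).-integrable setT f ->
  (\int[lebesgue_rV n.+1]_x f x =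
   \int[leb1]_t \int[lebesgue_rV n]_x f (rV_cons (x, t)))%E.
Proof.
move=> fi; rewrite integral_rV_cons//.
rewrite -(@integral21_prod_meas1 _ _ _ _ _ _ _ (f \o @rV_cons R n)); last exact: integrable_rV_cons.
by apply: eq_integral => t _; exact: integral_sigma_finite_lebesgue_rV.
Qed.

End fubini_rV.

Section supp.
Context {R : realType}.

Lemma compact_box n (M : R) : compact (@box R n M).
Proof.
rewrite (_ : box M = [set v : 'rV[R]_n | forall i, v ord0 i \in `[- M, M]]); last first.
  by apply/seteqP; split => x bx i; have := bx i; rewrite in_itv.
apply: (@rV_compact _  _ (fun=> `[- M, M]%classic)).
by move=> _; apply: segment_compact.
Qed.

Lemma continuous_bounded_box n (M : R) (f : 'rV[R]_n -> R) : continuous f ->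
  exists C, forall x, box M x -> `|f x| <= C.
Proof.
move=> cf.
have : compact (f @` box M).
  apply: continuous_compact; last exact: compact_box.
  exact: continuous_subspaceT.
move=> /compact_bounded[C [_ hC]]; exists (C + 1) => x bx.
by apply: hC; [rewrite ltrDl|exists x].
Qed.

Lemma integrable_bounded_supp n (M C : R) (f : 'rV[R]_n -> R) :
  measurable_fun setT f -> (forall x, box M x -> `|f x| <= C) -> (forall x, ~ box M x -> f x = 0) ->
  (lebesgue_rV n).-integrable setT (EFin \o f).
Proof.
move=> mf fC f0.
rewrite (_ : EFin \o f = (EFin \o f) \_ (box M)); last first.
  apply/funext => x; rewrite patchE; case: ifPn => //.
  by rewrite notin_setE => /f0 /= ->.
rewrite -integrable_mkcond; last exact: measurable_box.
apply: measurable_bounded_integrable.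
- exact: measurable_box.
- exact: lebesgue_rV_box_lty.
- exact: measurable_funTS.
- exists C; split; first by rewrite num_real.
  by move=> y Cy x bx; exact: le_trans (fC _ bx) (ltW Cy).
Qed.

Lemma integrable_continuous_supp n (M : R) (f : 'rV[R]_n -> R) :
  continuous f -> (forall x, ~ box M x -> f x = 0) ->
  (lebesgue_rV n).-integrable setT (EFin \o f).
Proof.
move=> cf; have [C fC] := continuous_bounded_box M cf.
by apply: integrable_bounded_supp fC; exact: continuous_measurable_rV.
Qed.

Lemma closed_box n (M : R) : closed (@box R n M).
Proof.
apply: compact_closed; last exact: compact_box.
exact: norm_hausdorff.
Qed.

(** The complement of a closed box is open, so the function is locally zero there. *)
Lemma partial_supp n (M : R) (f : 'rV[R]_n -> R) i :
  (forall x, ~ box M x -> f x = 0) -> (forall x, ~ box M x -> partial i f x = 0).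
Proof.
move=> f0 x bx; rewrite /partial (near_eq_derive (g := cst 0)) ?derive_cst//.
have : nbhs x (~` box M) by apply: open_nbhs_nbhs; split => //; exact/closed_openC/closed_box.
by apply: filterS => y; exact: f0.
Qed.

End supp.

(** * Partial derivatives along lines and the vanishing of their integrals *)

Section line.
Context {R : realType}.

(** The two difference quotients are the same function of h, so derivability and the value of a
    directional derivative both pass to the restriction to a line, where one-variable calculus
    applies. *)
Lemma line_diffquot (V : normedModType R) (f : V -> R) (x v : V) (s : R) :
  (fun h : R => h^-1 *: ((f \o shift (s *: v + x)) (h *: v) - f (s *: v + x))) =
  (fun h : R => h^-1 *: (((fun r : R => f (r *: v + x)) \o shift s) (h *: (1 : R)) - f (s *: v + x))).
Proof.
by apply/funext => h /=; rewrite -[h *: 1]/(h * 1) mulr1 scalerDl addrA.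
Qed.

Lemma derivable_line (V : normedModType R) (f : V -> R) (x v : V) (s : R) :
  derivable f (s *: v + x) v -> derivable (fun r : R => f (r *: v + x)) s 1.
Proof. by rewrite /derivable line_diffquot. Qed.

Lemma derive_line (V : normedModType R) (f : V -> R) (x v : V) (s : R) :
  'D_1 (fun r : R => f (r *: v + x)) s = 'D_v f (s *: v + x).
Proof. by rewrite /derive line_diffquot. Qed.

Lemma rV_cons_lift n (x : 'rV[R]_n) (t : R) k : rV_cons (x, t) ord0 (lift ord0 k) = x ord0 k.
Proof.
rewrite (_ : lift ord0 k = rshift 1 k); last exact/val_inj.
by rewrite /rV_cons (@row_mxEr R 1 1 n).
Qed.

Lemma rV_cons_ord0 n (x : 'rV[R]_n) (t : R) : rV_cons (x, t) ord0 ord0 = t.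
Proof.
have -> : ord0 = lshift n ord0 :> 'I_(1 + n) by exact/val_inj.
by rewrite /rV_cons (@row_mxEl R 1 1 n) mxE.
Qed.

Lemma rV_lineE n (s : R) (x : 'rV[R]_n) (i j : 'I_n) :
  (s *: delta_mx ord0 i + x) ord0 j = s * (j == i)%:R + x ord0 j.
Proof. by rewrite !mxE eqxx. Qed.

Lemma rV_consD n (x : 'rV[R]_n) (s t : R) :
  rV_cons (x, s + t) = s *: delta_mx ord0 ord0 + rV_cons (x, t).
Proof.
apply/rowP => i; rewrite rV_lineE.
case: (unliftP ord0 i) => [j|] ->; first by rewrite !rV_cons_lift mulr0 add0r.
by rewrite !rV_cons_ord0 mulr1.
Qed.

Lemma rV_consDl n (x : 'rV[R]_n) (t : R) (s : R) (j : 'I_n) :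
  rV_cons (s *: delta_mx ord0 j + x, t) = s *: delta_mx ord0 (lift ord0 j) + rV_cons (x, t).
Proof.
apply/rowP => i; rewrite rV_lineE.
case: (unliftP ord0 i) => [k|] ->.
  by rewrite !rV_cons_lift (inj_eq (@lift_inj _ _)) rV_lineE.
by rewrite !rV_cons_ord0 mulr0 add0r.
Qed.

Lemma partial_line n (f : 'rV[R]_n -> R) i x :
  partial i f x = 'D_(1 : R) (fun s : R => f (s *: delta_mx ord0 i + x)) 0.
Proof. by rewrite derive_line scale0r add0r. Qed.

Lemma partial_rV_cons n (h : 'rV[R]_n.+1 -> R) (j : 'I_n) (x : 'rV[R]_n) (t : R) :
  partial (lift ord0 j) h (rV_cons (x, t)) = partial j (fun x => h (rV_cons (x, t))) x.
Proof.
rewrite !partial_line; congr ('D_(1 : R) _ 0).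
by apply/funext => s; rewrite rV_consDl.
Qed.

Lemma ball_rV_cons n (x y : 'rV[R]_n) (s t e : R) :
  ball x e y -> ball s e t -> ball (rV_cons (x, s)) e (rV_cons (y, t)).
Proof.
move=> [e0 xy] st; split => // i j; rewrite (ord1 i){i}.
by case: (unliftP ord0 j) => [k|] ->; rewrite ?rV_cons_lift ?rV_cons_ord0.
Qed.

Lemma continuous_rV_consl n (t : R) : continuous (fun x : 'rV[R]_n => rV_cons (x, t)).
Proof.
move=> x A /nbhs_ballP[e /= e0 eA]; apply/nbhs_ballP; exists e => //= y xy.
by apply: eA; apply: ball_rV_cons => //; exact: ballxx.
Qed.

Lemma continuous_rV_consr n (x : 'rV[R]_n) : continuous (fun t : R => rV_cons (x, t)).
Proof.
move=> t A /nbhs_ballP[e /= e0 eA]; apply/nbhs_ballP; exists e => //= y xy.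
by apply: eA; apply: ball_rV_cons => //; exact: ballxx.
Qed.

Lemma box_rV_cons n (x : 'rV[R]_n) (t M : R) :
  box M (rV_cons (x, t)) -> box M x /\ - M <= t <= M.
Proof.
move=> b; split => [k|].
  by have := b (lift ord0 k); rewrite rV_cons_lift.
by have := b ord0; rewrite rV_cons_ord0.
Qed.

Lemma integral_derivative_supp (F f : R -> R) (M : R) :
  (forall t : R, is_derive t (1 : R) F (f t)) -> continuous f ->
  (forall t, M < `|t| -> F t = 0) ->
  (\int[@lebesgue_measure R]_t (f t)%:E = 0)%E.
Proof.
move=> dF cf F0.
have f0 (t : R) : M < `|t| -> f t = 0.
  move=> Mt; have [_ <-] := dF t.
  rewrite (near_eq_derive (g := cst 0)) ?derive_cst//.
  have : open [set s : R | M < `|s|].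
    apply: (@open_comp _ _ (Num.norm : R -> R) [set s : R | M < s]); last exact: open_gt.
    by move=> s _; exact: norm_continuous.
  move=> oM; have : nbhs t [set s : R | M < `|s|] by exact: open_nbhs_nbhs.
  by apply: filterS => s; exact: F0.
(* The endpoints must lie strictly beyond M, where [F] vanishes, and N must be positive even when M
   is negative. *)
pose N := `|M| + 1.
have MN : M < N by rewrite (le_lt_trans (ler_norm M))// ltrDl.
have N0 : 0 < N by rewrite ltr_wpDl.
rewrite (_ : (fun t => (f t)%:E) = (fun t => (f t)%:E) \_ `[- N, N]%classic); last first.
  apply/funext => t; rewrite patchE; case: ifPn => //.
  rewrite notin_setE/= in_itv/= -ler_norml => /negP; rewrite -ltNge => Nt.
  by rewrite f0// (lt_trans MN).
rewrite -integral_mkcond.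
rewrite (continuous_FTC2 (F := F)).
- by rewrite !F0 ?subee// ?normrN gtr0_norm.
- by rewrite gtrN.
- exact: continuous_subspaceT.
- have cF : continuous F.
    move=> t; apply: differentiable_continuous; apply/derivable1_diffP.
    by have [] := dF t.
  split.
  + by move=> t _; have [] := dF t.
  + exact: cvg_at_right_filter (cF _).
  + exact: cvg_at_left_filter (cF _).
- by move=> t _; rewrite derive1E; have [_ ->] := dF t.
Qed.

(** Induction on the dimension, with the order of integration chosen by the coordinate: the first
    coordinate is integrated innermost when it is the one differentiated, and the fundamental
    theorem of calculus gives 0; otherwise it is integrated outermost and the induction hypothesis
    applies to each slice. *)
Theorem integral_partial_eq0 n (h : 'rV[R]_n -> R) (i : 'I_n) (M : R) :
  (forall x, derivable h x (delta_mx ord0 i)) -> continuous (partial i h) ->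
  (forall x, ~ box M x -> h x = 0) ->
  (\int[lebesgue_rV n]_x (partial i h x)%:E = 0)%E.
Proof.
elim: n h i => [|n IHn] h i dh ch h0; first by case: i dh ch.
have ip : (lebesgue_rV n.+1).-integrable setT (EFin \o partial i h).
  by apply: (@integrable_continuous_supp _ _ M) => //; exact: partial_supp.
case: (unliftP ord0 i) => [j|] ei; subst i.
  rewrite fubini_rV2//.
  under eq_integral => t _.
    rewrite (_ : (fun x => (partial (lift ord0 j) h (rV_cons (x, t)))%:E) =
      (fun x => (partial j (fun x => h (rV_cons (x, t))) x)%:E)); last first.
      apply/funext => x; congr EFin.
      exact: partial_rV_cons.
    rewrite IHn; first by over.
    - move=> x; apply/derivable1P.
      rewrite (_ : (fun _ => _) = (fun s : R => h (s *: delta_mx ord0 (lift ord0 j) + rV_cons (x, t)))); last first.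
        by apply/funext => s; rewrite rV_consDl.
      by apply: derivable_line; exact: dh.
    - rewrite (_ : partial _ _ = partial (lift ord0 j) h \o (fun x => rV_cons (x, t))); last first.
        by apply/funext => x; rewrite -partial_rV_cons.
      by move=> x; apply: continuous_comp; [exact: continuous_rV_consl|exact: ch].
    - by move=> x bx; apply: h0 => /box_rV_cons[].
  by rewrite integral0.
rewrite fubini_rV1//.
rewrite integral0_eq// => x _.
apply: (@integral_derivative_supp (fun t => h (rV_cons (x, t))) _ M).
- move=> t; have e : (fun t => h (rV_cons (x, t))) = (fun s : R => h (s *: delta_mx ord0 ord0 + rV_cons (x, 0))).
    by apply/funext => s; rewrite -rV_consD addr0.
  rewrite e; apply: DeriveDef.
    by apply: derivable_line; exact: dh.
  by rewrite derive_line -rV_consD addr0.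
- by move=> t; apply: continuous_comp; [exact: continuous_rV_consr|exact: ch].
- by move=> t Mt; apply: h0 => /box_rV_cons[_]; rewrite -ler_norml leNgt Mt.
Qed.
End line.

(** * The Cauchy probability *)

Section powR_integral.
Context {R : realType}.
Local Notation leb1 := (@lebesgue_measure R).

Lemma continuous_powR_comp (T : topologicalType) (f : T -> R) (p : R) :
  (forall x, 0 < f x) -> continuous f -> continuous (fun x => f x `^ p).
Proof.
move=> f0 cf x.
suff h : {for f x, continuous (@powR R ^~ p)} by exact: continuous_comp (cf x) h.
apply: differentiable_continuous; apply/derivable1_diffP.
by apply: derivable_powR; rewrite in_itv/= f0.
Qed.

Lemma powR_cvgy0 (b : R) : 1 < b -> (1 + t) `^ (1 - b) @[t --> +oo] --> (0 : R).
Proof.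
move=> b1.
rewrite (_ : (fun t : R => (1 + t) `^ (1 - b)) = (fun t : R => ((1 + t) `^ (b - 1))^-1)); last first.
  by apply/funext => t; rewrite /= -powRN opprB.
apply: (gtr0_cvgV0 (f := fun t : R => (1 + t) `^ (b - 1)) _).2.
  by near=> t; rewrite powR_gt0// ltr_wpDr//; near: t; exact: nbhs_pinfty_ge.
apply/cvgryPge => A; near=> t.
pose A' := Num.max 1 A.
have A0 : 0 <= A' by rewrite le_max ler01.
have b0 : b - 1 != 0 by rewrite gt_eqF// subr_gt0.
apply: (@le_trans _ _ A'); first by rewrite le_max lexx orbT.
have tA : A' `^ (b - 1)^-1 <= 1 + t.
  apply: (@le_trans _ _ t); last by rewrite lerDr.
  by near: t; exact: nbhs_pinfty_ge.
have := @ge0_ler_powR _ (b - 1) _ _ _ _ _ tA.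
rewrite -powRrM mulVf// powRr1//; apply; rewrite ?nnegrE ?powR_ge0//; first lra.
exact: (le_trans (powR_ge0 _ _) tA).
Unshelve. all: by end_near. Qed.

Lemma integral_powR1D (b : R) : 1 < b ->
  (\int[leb1]_(t in [set t : R | (0 <= t)%R]) ((1 + `|t|) `^ (- b))%:E < +oo)%E.
Proof.
move=> b1; rewrite -set_itvcy.
have cf : continuous (fun t : R => (1 + `|t|) `^ (- b)).
  apply: continuous_powR_comp; first by move=> t; rewrite ltr_wpDr.
  by move=> t; apply: cvgD; [exact: cvg_cst|exact: norm_continuous].
pose F (t : R) := - (b - 1)^-1 * (1 + t) `^ (1 - b).
have dF t : 0 <= t -> is_derive (t : R) (1 : R) F ((1 + t) `^ (- b)).
  move=> t0.
  have t1 : 0 < 1 + t by rewrite ltr_wpDr.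
  have h1 : is_derive (t : R) (1 : R) (fun t => 1 + t) (0 + 1) by exact: (is_deriveD (is_derive_cst _ _ _) (is_derive_id _ _)).
  have h2 := is_derive1_powR (1 - b) t1.
  have h3 := is_derive1_comp h2 h1.
  have h4 := is_deriveZ (- (b - 1)^-1) h3.
  apply: is_derive_eq h4 _; rewrite /GRing.scale/=.
  rewrite add0r mulr1 mulrA (_ : 1 - b - 1 = - b); last ring.
  rewrite (_ : - (b - 1)^-1 * (1 - b) = 1) ?mul1r//.
  by field; lra.
have Fl : F t @[t --> +oo] --> (0 : R).
  rewrite -[X in _ --> X](mulr0 (- (b - 1)^-1)).
  by apply: cvgM; [exact: cvg_cst|exact: powR_cvgy0].
rewrite (_ : (\int[_]_(x in _) _ = \int[leb1]_(t in `[0%R, +oo[) ((1 + `|t|) `^ (- b))%:E)%E)//.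
rewrite (@ge0_continuous_FTC2y _ _ F 0 0)//.
- by rewrite -EFinB ltry.
- exact: continuous_subspaceT.
- by move=> x x0; have [] := dF _ (ltW x0).
- apply: cvg_at_right_filter; apply: differentiable_continuous; apply/derivable1_diffP.
  by have [] := dF _ (lexx 0).
- by move=> x; rewrite in_itv/= andbT => x0; rewrite derive1E; have [_ ->] := dF _ (ltW x0); rewrite gtr0_norm.
Qed.

(** By evenness it suffices to treat t >= 0. There (1 - t)^2 >= 0 gives (1 + t)^2 <= 2 (1 + t^2), so
    the integrand is at most 2^a (1 + t)^(-2a), and 2a > 1. *)
Lemma integral_powR_sqr (a : R) : 2^-1 < a ->
  (\int[leb1]_t ((1 + t ^+ 2) `^ (- a))%:E < +oo)%E.
Proof.
move=> a1.
have p0 (t : R) : 0 < 1 + t ^+ 2 by rewrite ltr_wpDr// sqr_ge0.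
have cw : continuous (fun t : R => (1 + t ^+ 2) `^ (- a)).
  apply: continuous_powR_comp => // t.
  by apply: cvgD; [exact: cvg_cst|exact: exprn_continuous].
rewrite ge0_symfun_integralT//; last 2 first.
- by move=> t; exact: powR_ge0.
- by move=> t /=; rewrite sqrrN.
rewrite lte_mul_pinfty//.
have m0 : measurable [set t : R | (0 <= t)%R] by rewrite -set_itvcy.
have cg : continuous (fun t : R => (1 + `|t|) `^ (- (2 * a))).
  apply: continuous_powR_comp; first by move=> t; rewrite ltr_wpDr.
  by move=> t; apply: cvgD; [exact: cvg_cst|exact: norm_continuous].
apply: (@le_lt_trans _ _ (\int[leb1]_(t in [set t : R | (0 <= t)%R]) ((2 `^ a)%:E * ((1 + `|t|) `^ (- (2 * a)))%:E))%E).
  apply: ge0_le_integral => //.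
  - by move=> t _; rewrite lee_fin powR_ge0.
  - apply/measurable_EFinP; apply: measurable_funTS; exact: continuous_measurable_fun.
  - apply: measurable_funeM; apply/measurable_EFinP; apply: measurable_funTS; exact: continuous_measurable_fun.
  move=> t /= t0; rewrite -EFinM lee_fin.
  rewrite powRN [X in _ <= _ * X]powRN powRrM.
  rewrite ler_pdivlMr ?powR_gt0 ?ltr_wpDr//.
  rewrite ler_pdivrMl ?powR_gt0//.
  rewrite mulrC -powRM//; last exact: ltW.
  rewrite ge0_ler_powR ?nnegrE ?powR_ge0//; first lra.
  - by rewrite mulr_ge0// ltW.
  - rewrite powR_mulrn ?addr_ge0// ger0_norm//.
    rewrite -subr_ge0 (_ : _ - _ = (1 - t) ^+ 2) ?sqr_ge0//; ring.
rewrite ge0_integralZl//.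
- by rewrite lte_mul_pinfty ?lee_fin ?powR_ge0// integral_powR1D//; lra.
- apply/measurable_EFinP; apply: measurable_funTS; exact: continuous_measurable_fun.
Qed.

Lemma integral_prod_lty n (w : R -> R) : (forall t, 0 <= w t) -> continuous w ->
  (\int[leb1]_t (w t)%:E < +oo)%E ->
  (\int[lebesgue_rV n]_x (\prod_i w (x ord0 i))%:E < +oo)%E.
Proof.
move=> w0 cw wi.
have mw : measurable_fun setT w by exact: continuous_measurable_fun.
have mp m : measurable_fun setT (fun x : 'rV[R]_m => (\prod_i w (x ord0 i))%:E).
  apply/measurable_EFinP; apply: measurable_prod => i _.
  apply: (measurableT_comp mw); exact: measurable_rV_coord.
have p0 m (x : 'rV[R]_m) : 0 <= \prod_i w (x ord0 i) by apply: prodr_ge0.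
elim: n => [|n IHn].
  rewrite integral_dirac//; last exact: mp.
  by rewrite diracE mem_set//= mul1e ltry.
rewrite tonelli_rV//; last by move=> x; rewrite lee_fin.
have e x : (\int[leb1]_t (\prod_i w (rV_cons (x, t) ord0 i))%:E =
    (\prod_i w (x ord0 i))%:E * \int[leb1]_t (w t)%:E)%E.
  rewrite -ge0_integralZl//; last 3 first.
  - exact/measurable_EFinP.
  - by move=> t _; rewrite lee_fin.
  - by rewrite lee_fin.
  apply: eq_integral => t _; rewrite big_ord_recl rV_cons_ord0 mulrC EFinM.
  by congr (_%:E * _)%E; apply: eq_bigr => i _; rewrite rV_cons_lift.
under eq_integral => x _ do rewrite e.
rewrite ge0_integralZr//.
- have h0 : (0 <= \int[lebesgue_rV n]_x (\prod_i w (x ord0 i))%:E)%E.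
    by apply: integral_ge0 => x _; rewrite lee_fin.
  by apply: lte_mul_pinfty => //; rewrite ge0_fin_numE.
- exact: mp.
- by move=> x _; rewrite lee_fin.
- by apply: integral_ge0 => t _; rewrite lee_fin.
Qed.

End powR_integral.

Section density.
Context d (T : measurableType d) (R : realType) (m P : {measure set T -> \bar R}) (w : T -> R).
Hypotheses (w0 : forall x, 0 <= w x) (mw : measurable_fun setT w).
Hypothesis PE : forall A, measurable A -> P A = (\int[m]_(x in A) (w x)%:E)%E.
Local Open Scope ereal_scope.
Import HBNNSimple.

(** On simple functions this is [PE] applied to the level sets; monotone convergence on both sides
    gives the general case. *)
Lemma ge0_integral_density (f : T -> \bar R) :
  measurable_fun setT f -> (forall x, 0 <= f x) ->
  \int[P]_x f x = \int[m]_x (f x * (w x)%:E).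
Proof.
move=> mf f0.
have mwe : measurable_fun setT (EFin \o w) by exact/measurable_EFinP.
pose h := nnsfun_approx measurableT mf.
have -> : \int[P]_x f x = lim (\int[P]_x (EFin \o h n) x @[n --> \oo]).
  have fE x : f x = lim ((EFin \o h n) x @[n --> \oo]).
    by apply/esym/cvg_lim => //; exact: cvg_nnsfun_approx.
  under eq_integral => x _ do rewrite fE.
  apply: monotone_convergence => //.
  - move=> n; apply/measurable_EFinP; exact/measurable_funP.
  - by move=> n x _ //=; rewrite lee_fin.
  - by move=> x _ a b ab; rewrite lee_fin; exact/lefP/nd_nnsfun_approx.
have -> : \int[m]_x (f x * (w x)%:E) =
    lim (\int[m]_x ((EFin \o h n) x * (w x)%:E) @[n --> \oo]).
  have fg x : f x * (w x)%:E = lim (((EFin \o h n) x * (w x)%:E) @[n --> \oo]).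
    by apply/esym/cvg_lim => //; apply: cvgeZr => //; exact: cvg_nnsfun_approx.
  under eq_integral => x _ do rewrite fg.
  apply: monotone_convergence => //.
  - move=> n; apply/emeasurable_funM => //; exact/measurable_EFinP.
  - by move=> n x _ /=; rewrite mule_ge0 ?lee_fin.
  - by move=> x _ a b ab/=; rewrite lee_wpmul2r ?lee_fin//; exact/lefP/nd_nnsfun_approx.
suff suf n : \int[m]_x ((EFin \o h n) x * (w x)%:E) = \int[P]_x (EFin \o h n) x.
  rewrite (_ : (fun n => \int[m]_x _) = (fun n => \int[P]_x (EFin \o h n) x))//.
  by apply/funext => n; rewrite suf.
have indich r : measurable_fun setT (fun x => (r * \1_(h n @^-1` [set r]) x)%:E).
  by apply/measurable_EFinP; exact: measurable_funM.
transitivity (\int[P]_x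
   (\sum_(y \in range (h n)) (y * \1_(h n @^-1` [set y]) x)%:E)); last first.
  by apply: eq_integral => t tE; rewrite /= fimfunE -fsumEFin.
rewrite ge0_integral_fsum//; last by move=> k y _; exact: nnfun_muleindic_ge0.
transitivity (\int[m]_x (\sum_(y \in range (h n))
    (y * \1_(h n @^-1` [set y]) x)%:E * (w x)%:E)).
  apply: eq_integral => x _.
  rewrite -ge0_mule_fsuml => [|y]; last exact: nnfun_muleindic_ge0.
  by rewrite /= fimfunE -fsumEFin.
rewrite ge0_integral_fsum//; last 2 first.
  - by move=> y; apply: emeasurable_funM.
  - by move=> k y _; apply: mule_ge0; rewrite ?lee_fin//; rewrite -lee_fin; exact: nnfun_muleindic_ge0.
apply: eq_fsbigr => r rhn.
have mh : measurable (h n @^-1` [set r]) by [].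
have r0 : (0 <= r)%R.
  by move: rhn; rewrite inE => -[x _ <-].
transitivity (r%:E * P (h n @^-1` [set r])).
  rewrite PE// [in RHS]integral_mkcond -ge0_integralZl//; last 2 first.
    by apply/(measurable_restrictT _ _).1 => //; exact: measurable_funTS.
    by move=> x _; rewrite patchE; case: ifPn => // _; rewrite lee_fin.
  apply: eq_integral => x _; rewrite patchE indicE.
  by case: ifPn; rewrite ?mulr1 ?mulr0 ?mul0e ?mule0.
under [RHS]eq_integral do rewrite EFinM.
by rewrite ge0_integralZl//= ?integral_indic ?setIT//; exact/measurable_EFinP.
Qed.

Lemma density_funepos (f : T -> R) x :
  (EFin \o (fun x => f x * w x)%R)^\+ x = (EFin \o f)^\+ x * (w x)%:E.
Proof. by rewrite !funeposE /= -!EFin_max -EFinM maxr_pMl// mul0r. Qed.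

Lemma density_funeneg (f : T -> R) x :
  (EFin \o (fun x => f x * w x)%R)^\- x = (EFin \o f)^\- x * (w x)%:E.
Proof. by rewrite !funenegE /= -!EFin_max -EFinM maxr_pMl// mul0r mulNr. Qed.

Lemma integral_density (f : T -> R) : measurable_fun setT f ->
  \int[P]_x (f x)%:E = \int[m]_x (f x * w x)%:E.
Proof.
move=> mf; rewrite [LHS]integralE [RHS]integralE.
congr (_ - _); (rewrite ge0_integral_density//;
  last by first [apply: measurable_funepos|apply: measurable_funeneg]; exact/measurable_EFinP).
  by apply: eq_integral => x _; rewrite -density_funepos.
by apply: eq_integral => x _; rewrite -density_funeneg.
Qed.

Lemma integrable_density (f : T -> R) : measurable_fun setT f ->
  P.-integrable setT (EFin \o f) <-> m.-integrable setT (EFin \o (fun x => f x * w x)%R).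
Proof.
move=> mf.
have e : \int[P]_x `|(f x)%:E| = \int[m]_x `|(f x * w x)%:E|.
  rewrite ge0_integral_density//; last first.
    by apply: measurableT_comp => //; exact/measurable_EFinP.
  by apply: eq_integral => x _; rewrite EFinM abseM (@gee0_abs _ (w x)%:E) ?lee_fin.
split => /integrableP[_ fi]; apply/integrableP; split.
- by apply/measurable_EFinP; exact: (measurable_funM mf mw).
- by rewrite -e.
- exact/measurable_EFinP.
- by rewrite e.
Qed.

End density.

Section continuous_arith.
Context {R : realType} {T : topologicalType}.
Implicit Types f g : T -> R.

Lemma ctsD f g : continuous f -> continuous g -> continuous (fun x => f x + g x).
Proof. by move=> cf cg x; apply: cvgD; [exact: cf|exact: cg]. Qed.

Lemma ctsM f g : continuous f -> continuous g -> continuous (fun x => f x * g x).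
Proof. by move=> cf cg x; apply: cvgM; [exact: cf|exact: cg]. Qed.

Lemma cts_cst (c : R) : continuous (fun _ : T => c).
Proof. by move=> x; exact: cvg_cst. Qed.

Lemma cts_sum (I : Type) (r : seq I) (F : I -> T -> R) :
  (forall i, continuous (F i)) -> continuous (fun x => \sum_(i <- r) F i x).
Proof.
move=> cF; elim: r => [|i r IH].
  rewrite (_ : (fun _ => _) = cst 0); first exact: cts_cst.
  by apply/funext => t; rewrite big_nil.
rewrite (_ : (fun _ => _) = (fun t => F i t + \sum_(i <- r) F i t)); first exact: ctsD.
by apply/funext => t; rewrite big_cons.
Qed.

End continuous_arith.

Section omega.
Context {R : realType} {n : nat}.
Implicit Types x y : 'rV[R]_n.

Lemma sqnorm_ge0 x : 0 <= sqnorm x.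
Proof. by apply: sumr_ge0 => i _; rewrite -expr2 sqr_ge0. Qed.

Lemma omega_ge1 x : 1 <= omega x.
Proof. by rewrite lerDl sqnorm_ge0. Qed.

Lemma omega_gt0 x : 0 < omega x.
Proof. exact: lt_le_trans ltr01 (omega_ge1 x). Qed.

Lemma coord_sqr_le_omega x i : 1 + x ord0 i ^+ 2 <= omega x.
Proof.
rewrite lerD2l /sqnorm /dotv (bigD1 i)//= -expr2 lerDl.
by apply: sumr_ge0 => j _; rewrite -expr2 sqr_ge0.
Qed.

Lemma continuous_rV_coord i : continuous (fun x : 'rV[R]_n => x ord0 i).
Proof. by move=> x; exact: coord_continuous. Qed.

Lemma continuous_sqnorm : continuous (@sqnorm R n).
Proof. by apply: cts_sum => i; apply: ctsM; exact: continuous_rV_coord. Qed.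

Lemma continuous_omega : continuous (@omega R n).
Proof. by apply: ctsD; [exact: cts_cst|exact: continuous_sqnorm]. Qed.

Lemma continuous_powR_omega p : continuous (fun x => omega x `^ p).
Proof. by apply: continuous_powR_comp; [exact: omega_gt0|exact: continuous_omega]. Qed.

End omega.

Section cauchy.
Context {R : realType} (n : nat) (beta : R).
Hypothesis n_gt0 : (0 < n)%N.
Hypothesis beta_gt : n%:R / 2 < beta.
Local Notation leb := (@lebesgue_rV R n).
Local Notation mu := (cauchy_prob n beta).

Let nR_gt0 : 0 < n%:R :> R. Proof. by rewrite ltr0n. Qed.
Let beta_gt0 : 0 < beta. Proof. by apply: lt_trans beta_gt; rewrite divr_gt0. Qed.

(** Write omega^(-beta) as a product of n equal factors omega^(-beta/n) and bound omega from below
    by 1 + x_i^2 in the i-th one. The one-dimensional factors are integrable exactly when beta/n >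
    1/2, so the sharp threshold is reached without polar coordinates. *)
Lemma omega_powR_le_prod (x : 'rV[R]_n) :
  omega x `^ (- beta) <= \prod_i (1 + x ord0 i ^+ 2) `^ (- (beta / n%:R)).
Proof.
have -> : omega x `^ (- beta) = \prod_(i < n) omega x `^ (- (beta / n%:R)).
  rewrite prodr_const card_ord -powR_mulrn ?powR_ge0// -powRrM mulNr divfK//.
  by rewrite gt_eqF.
apply: ler_prod => i _; rewrite powR_ge0/= !powRN lef_pV2 ?posrE ?powR_gt0 ?omega_gt0//; last first.
  by rewrite ltr_wpDr ?sqr_ge0.
apply: ge0_ler_powR; rewrite ?nnegrE.
- by rewrite divr_ge0// ltW.
- by rewrite addr_ge0 ?sqr_ge0.
- by rewrite ltW// omega_gt0.
- exact: coord_sqr_le_omega.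
Qed.

Lemma cauchy_weightT_lty : (cauchy_weight beta [set: 'rV[R]_n] < +oo)%E.
Proof.
rewrite /cauchy_weight /cauchy_density.
apply: (@le_lt_trans _ _ (\int[leb]_x (\prod_i (1 + x ord0 i ^+ 2) `^ (- (beta / n%:R)))%:E)%E).
  apply: ge0_le_integral => //.
  - by move=> x _; rewrite lee_fin powR_ge0.
  - exact: measurable_cauchy_density.
  - apply/measurable_EFinP; apply: measurable_prod => i _.
    apply: (measurableT_comp (measurable_powR _)); apply: measurable_funD => //.
    by apply: measurable_funX; exact: measurable_rV_coord.
  - by move=> x _; rewrite lee_fin; exact: omega_powR_le_prod.
apply: (@integral_prod_lty _ _ (fun t => (1 + t ^+ 2) `^ (- (beta / n%:R)))).
- by move=> t; rewrite powR_ge0.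
- apply: continuous_powR_comp => t; first by rewrite ltr_wpDr ?sqr_ge0.
  by apply: cvgD; [exact: cvg_cst|exact: exprn_continuous].
- apply: integral_powR_sqr; rewrite ltr_pdivlMr//; by rewrite mulrC.
Qed.

Lemma cauchy_weightT_gt0 : (0 < cauchy_weight beta [set: 'rV[R]_n])%E.
Proof.
have e : leb (box 1) = (2 ^+ n)%:E.
  rewrite (_ : 2 ^+ n = \prod_(i < n) (1 - (- 1))); last by rewrite prodr_const card_ord opprK.
  by apply: (@lebesgue_rV_box R n (fun=> - 1) (fun=> 1)) => i; lra.
apply: (@lt_le_trans _ _ (\int[leb]_(x in box 1) ((1 + n%:R) `^ (- beta))%:E)%E).
  rewrite integral_cst; last exact: measurable_box.
  by rewrite e -EFinM lte_fin mulr_gt0 ?powR_gt0 ?exprn_gt0 ?addr_gt0.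
apply: (@le_trans _ _ (\int[leb]_(x in box 1) cauchy_density beta x)%E).
  apply: ge0_le_integral.
  - exact: measurable_box.
  - by move=> x _; rewrite lee_fin powR_ge0.
  - exact: measurable_cst.
  - by apply: measurable_funTS; exact: measurable_cauchy_density.
  move=> x bx; rewrite lee_fin !powRN lef_pV2 ?posrE ?powR_gt0 ?omega_gt0 ?addr_gt0//.
  apply: ge0_ler_powR; rewrite ?nnegrE.
  - exact: ltW.
  - by rewrite ltW// omega_gt0.
  - by rewrite addr_ge0.
  - rewrite lerD2l /sqnorm /dotv (le_trans (y := \sum_(i < n) 1))//.
      apply: ler_sum => i _; rewrite -expr2 -(ger0_norm (sqr_ge0 _)) normrX expr_le1//.
      by rewrite ler_norml; exact: bx.
    by rewrite sumr_const card_ord.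
apply: ge0_subset_integral => //; first exact: measurable_box.
- exact: measurable_cauchy_density.
- by move=> x _; rewrite lee_fin powR_ge0.
Qed.

Definition cauchy_Z : R := fine (cauchy_weight beta [set: 'rV[R]_n]).

Lemma cauchy_Z_gt0 : 0 < cauchy_Z.
Proof. by rewrite /cauchy_Z fine_gt0// cauchy_weightT_gt0 cauchy_weightT_lty. Qed.

Definition cauchy_pdf (x : 'rV[R]_n) : R := cauchy_Z^-1 * omega x `^ (- beta).

Lemma cauchy_pdf_gt0 x : 0 < cauchy_pdf x.
Proof. by rewrite mulr_gt0 ?invr_gt0 ?cauchy_Z_gt0 ?powR_gt0 ?omega_gt0. Qed.

Lemma cauchy_pdf_ge0 x : 0 <= cauchy_pdf x.
Proof. exact/ltW/cauchy_pdf_gt0. Qed.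

Lemma continuous_cauchy_pdf : continuous cauchy_pdf.
Proof. by apply: ctsM; [exact: cts_cst|exact: continuous_powR_omega]. Qed.

Lemma measurable_cauchy_pdf : measurable_fun setT cauchy_pdf.
Proof. by apply: continuous_measurable_rV; exact: continuous_cauchy_pdf. Qed.

Lemma cauchy_probE A : measurable A -> mu A = (\int[leb]_(x in A) (cauchy_pdf x)%:E)%E.
Proof.
move=> mA; rewrite /cauchy_prob/= /mnormalize ifF; last first.
  by rewrite gt_eqF ?cauchy_weightT_gt0// lt_eqF// cauchy_weightT_lty.
rewrite muleC -ge0_integralZl//.
- apply: measurable_funTS; exact: measurable_cauchy_density.
- by move=> x _; rewrite lee_fin powR_ge0.
Qed.

Lemma integral_cauchy f : measurable_fun setT f ->
  (\int[mu]_x (f x)%:E = \int[leb]_x (f x * cauchy_pdf x)%:E)%E.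
Proof.
apply: integral_density.
- exact: cauchy_pdf_ge0.
- exact: measurable_cauchy_pdf.
- exact: cauchy_probE.
Qed.

Lemma integrable_cauchy f : measurable_fun setT f ->
  mu.-integrable setT (EFin \o f) <->
  leb.-integrable setT (EFin \o (fun x => f x * cauchy_pdf x)).
Proof.
apply: integrable_density.
- exact: cauchy_pdf_ge0.
- exact: measurable_cauchy_pdf.
- exact: cauchy_probE.
Qed.

Lemma ae_cauchy (Q : 'rV[R]_n -> Prop) :
  {ae leb, forall x, Q x} -> {ae mu, forall x, Q x}.
Proof.
move=> [N [mN N0 QN]]; exists N; split => //.
rewrite cauchy_probE// null_set_integral//.
by apply/measurable_EFinP; apply: measurable_funTS; exact: measurable_cauchy_pdf.
Qed.

End cauchy.

(** * Smooth functions *)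

Section partial_calculus.
Context {R : realType} {n : nat}.
Implicit Types (f g : 'rV[R]_n -> R) (i j : 'I_n).
Local Notation e_ i := (delta_mx ord0 i : 'rV[R]_n).

(** Derivability is bundled with an explicit derivative, so that the calculus rules compose without
    side conditions; [has_partialE] then computes [partial]. *)
Definition has_partial i f f' := forall x, is_derive x (e_ i) f (f' x).

Lemma has_partialE i f f' : has_partial i f f' -> partial i f = f'.
Proof. by move=> h; apply/funext => x; have [_] := h x. Qed.

Lemma has_partial_derivable i f f' x : has_partial i f f' -> derivable f x (e_ i).
Proof. by move=> h; have [] := h x. Qed.

Lemma has_partial_cst i (c : R) : has_partial i (fun=> c) (fun=> 0).
Proof. by move=> x; exact: is_derive_cst. Qed.

Lemma has_partialD i f g f' g' : has_partial i f f' -> has_partial i g g' ->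
  has_partial i (fun x => f x + g x) (fun x => f' x + g' x).
Proof. by move=> hf hg x; exact: (is_deriveD (hf x) (hg x)). Qed.

Lemma has_partialN i f f' : has_partial i f f' ->
  has_partial i (fun x => - f x) (fun x => - f' x).
Proof. by move=> hf x; exact: (is_deriveN (hf x)). Qed.

Lemma has_partialM i f g f' g' : has_partial i f f' -> has_partial i g g' ->
  has_partial i (fun x => f x * g x) (fun x => f' x * g x + f x * g' x).
Proof.
move=> hf hg x; apply: is_derive_eq (is_deriveM (hf x) (hg x)) _.
by rewrite addrC [g x *: _]mulrC.
Qed.

Lemma has_partial_sum i (I : Type) (r : seq I) (F F' : I -> 'rV[R]_n -> R) :
  (forall k, has_partial i (F k) (F' k)) ->
  has_partial i (fun x => \sum_(k <- r) F k x) (fun x => \sum_(k <- r) F' k x).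
Proof.
move=> h; elim: r => [|k r IH].
  rewrite (_ : (fun _ => _) = fun=> 0); last by apply/funext => x; rewrite big_nil.
  rewrite [X in has_partial _ _ X](_ : _ = fun=> 0); last by apply/funext => x; rewrite big_nil.
  exact: has_partial_cst.
rewrite (_ : (fun _ => _) = fun x => F k x + \sum_(k <- r) F k x); last first.
  by apply/funext => x; rewrite big_cons.
rewrite [X in has_partial _ _ X](_ : _ = fun x => F' k x + \sum_(k <- r) F' k x); last first.
  by apply/funext => x; rewrite big_cons.
exact: has_partialD.
Qed.

(** Restriction to the line through x in the direction e_i turns the claim into the one-variable
    chain rule. *)
Lemma has_partial_comp i (phi phi' : R -> R) f f' :
  (forall x, is_derive (f x) (1 : R) phi (phi' (f x))) -> has_partial i f f' ->
  has_partial i (fun x => phi (f x)) (fun x => phi' (f x) * f' x).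
Proof.
move=> dphi hf x.
have fl : is_derive (0 : R) (1 : R) (fun s : R => f (s *: e_ i + x)) (f' x).
  apply: DeriveDef; first by apply: derivable_line; rewrite scale0r add0r; have [] := hf x.
  by rewrite derive_line scale0r add0r; have [_] := hf x.
have fl0 : f (0 *: e_ i + x) = f x by rewrite scale0r add0r.
have pl : is_derive ((fun s : R => f (s *: e_ i + x)) 0) (1 : R) phi (phi' (f x)).
  by rewrite fl0; exact: dphi.
have [dc ec] := is_derive1_comp pl fl.
split; first exact/derivable1P.
by rewrite -[RHS]ec -[in LHS](add0r x) -[in LHS](scale0r (e_ i)) -derive_line.
Qed.

Lemma has_partial_coord i j : has_partial i (fun x => x ord0 j) (fun=> (j == i)%:R).
Proof.
move=> x.
have h : is_derive (0 : R) (1 : R) (fun s : R => (s *: e_ i + x) ord0 j) (j == i)%:R.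
  rewrite (_ : (fun _ => _) = (fun s : R => s * (j == i)%:R + x ord0 j)); last first.
    by apply/funext => s; rewrite rV_lineE.
  apply: is_derive_eq (is_deriveD (is_deriveM (is_derive_id (0:R) (1:R))
    (is_derive_cst ((j == i)%:R : R) (0:R) (1:R))) (is_derive_cst (x ord0 j) (0:R) (1:R))) _.
  by rewrite scaler0 add0r addr0 [LHS]mulr1.
have [dh eh] := h.
split; first exact/derivable1P.
by rewrite -[RHS]eh -[in LHS](add0r x) -[in LHS](scale0r (e_ i)) -derive_line.
Qed.

Lemma has_partial_sqnorm i : has_partial i (@sqnorm R n) (fun x => 2 * x ord0 i).
Proof.
have h := @has_partial_sum i _ (index_enum 'I_n) _ _
  (fun k => has_partialM (has_partial_coord i k) (has_partial_coord i k)).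
move=> x; apply: is_derive_eq (h x) _.
rewrite (bigD1 i)//= eqxx big1 => [|k /negbTE ki]; last by rewrite ki mul0r mulr0 addr0.
by rewrite /= mulr1 mul1r addr0 -mulr2n mulr_natl.
Qed.

Lemma has_partial_omega i : has_partial i (@omega R n) (fun x => 2 * x ord0 i).
Proof.
move=> x; apply: is_derive_eq (has_partialD (has_partial_cst i 1) (has_partial_sqnorm i) x) _.
by rewrite add0r.
Qed.

Lemma has_partial_powR_omega i p :
  has_partial i (fun x => omega x `^ p) (fun x => p * omega x `^ (p - 1) * (2 * x ord0 i)).
Proof.
apply: (@has_partial_comp i (@powR R ^~ p) (fun y => p * y `^ (p - 1)) _ _ _ (has_partial_omega i)).
by move=> x; apply: is_derive1_powR; exact: omega_gt0.
Qed.

(** [smooth] speaks of iterated [partial] along a word of indices, a form on which the Leibniz rule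
    is awkward. Regularity of finite order, with the derivative existentially quantified, is stable
    under sums and products by induction on the order; [smoothP] returns to [smooth]. *)
Fixpoint smoothN k f : Prop := match k with
  | 0 => continuous f
  | k'.+1 => continuous f /\ forall i, exists2 f', has_partial i f f' & smoothN k' f'
  end.

Lemma smoothNW k f : smoothN k.+1 f -> smoothN k f.
Proof.
elim: k f => [f []//|k IH f [cf hf]]; split => // i.
by have [f' h1 h2] := hf i; exists f' => //; exact: IH.
Qed.

Lemma smooth_partial f i : smooth f -> smooth (partial i f).
Proof. by move=> sf s; have := sf (rcons s i); rewrite foldr_rcons. Qed.

Lemma smooth_has_partial f i : smooth f -> has_partial i f (partial i f).
Proof. by move=> sf x; have [_ h] := sf [::]; apply: DeriveDef => //; exact: h. Qed.

Lemma smooth_continuous f : smooth f -> continuous f.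
Proof. by move=> /(_ [::])[]. Qed.

Lemma smoothP f : smooth f <-> forall k, smoothN k f.
Proof.
split=> [sf k|].
  elim: k f sf => [|k IH] f sf; first exact: smooth_continuous.
  split; first exact: smooth_continuous.
  move=> i; exists (partial i f); first exact: smooth_has_partial.
  by apply: IH; exact: smooth_partial.
move=> h s; move: (h (size s).+1) => {h}.
elim/last_ind: s f => [|s i IH] f.
  by move=> [cf hf]; split => // i x; have [f' h _] := hf i; exact: has_partial_derivable h.
rewrite size_rcons => -[_ /(_ i)[f' /has_partialE <-]] /IH.
by rewrite foldr_rcons.
Qed.

Lemma smoothN_cst k (c : R) : smoothN k (fun=> c).
Proof.
elim: k c => [|k IH] c; first exact: cts_cst.
by split; [exact: cts_cst|move=> i; exists (fun=> 0); [exact: has_partial_cst|exact: IH]].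
Qed.

Lemma smoothND k f g : smoothN k f -> smoothN k g -> smoothN k (fun x => f x + g x).
Proof.
elim: k f g => [|k IH] f g; first exact: ctsD.
move=> [cf hf] [cg hg]; split; first exact: ctsD.
move=> i; have [f' f1 f2] := hf i; have [g' g1 g2] := hg i.
by exists (fun x => f' x + g' x); [exact: has_partialD|exact: IH].
Qed.

Lemma smoothNM k f g : smoothN k f -> smoothN k g -> smoothN k (fun x => f x * g x).
Proof.
elim: k f g => [|k IH] f g; first exact: ctsM.
move=> sf sg; have := smoothNW sf; have := smoothNW sg.
move: sf sg => [cf hf] [cg hg] sg sf; split; first exact: ctsM.
move=> i; have [f' f1 f2] := hf i; have [g' g1 g2] := hg i.
exists (fun x => f' x * g x + f x * g' x); first exact: has_partialM.
by apply: smoothND; exact: IH.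
Qed.

Lemma smoothN_coord k i : smoothN k (fun x => x ord0 i).
Proof.
case: k => [|k]; first exact: continuous_rV_coord.
split; first exact: continuous_rV_coord.
by move=> j; exists (fun=> (i == j)%:R); [exact: has_partial_coord|exact: smoothN_cst].
Qed.

Lemma smoothN_powR_omega k p : smoothN k (fun x => omega x `^ p).
Proof.
elim: k p => [|k IH] p; first exact: continuous_powR_omega.
split; first exact: continuous_powR_omega.
move=> i; exists (fun x => p * omega x `^ (p - 1) * (2 * x ord0 i)).
  exact: has_partial_powR_omega.
apply: smoothNM; apply: smoothNM; [exact: smoothN_cst|exact: IH|exact: smoothN_cst|exact: smoothN_coord].
Qed.

Lemma smooth_cst (c : R) : smooth (fun _ : 'rV[R]_n => c).
Proof. by apply/smoothP => k; exact: smoothN_cst. Qed.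

Lemma smoothD f g : smooth f -> smooth g -> smooth (fun x => f x + g x).
Proof. by move=> /smoothP sf /smoothP sg; apply/smoothP => k; exact: smoothND. Qed.

Lemma smoothM f g : smooth f -> smooth g -> smooth (fun x => f x * g x).
Proof. by move=> /smoothP sf /smoothP sg; apply/smoothP => k; exact: smoothNM. Qed.

Lemma smooth_coord i : smooth (fun x : 'rV[R]_n => x ord0 i).
Proof. by apply/smoothP => k; exact: smoothN_coord. Qed.

Lemma smooth_powR_omega p : smooth (fun x : 'rV[R]_n => omega x `^ p).
Proof. by apply/smoothP => k; exact: smoothN_powR_omega. Qed.

Lemma smooth_sum (I : Type) (r : seq I) (F : I -> 'rV[R]_n -> R) :
  (forall k, smooth (F k)) -> smooth (fun x => \sum_(k <- r) F k x).
Proof.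
move=> h; elim: r => [|k r IH].
  rewrite (_ : (fun _ => _) = fun=> 0); last by apply/funext => x; rewrite big_nil.
  exact: smooth_cst.
rewrite (_ : (fun _ => _) = fun x => F k x + \sum_(k <- r) F k x); first exact: smoothD.
by apply/funext => x; rewrite big_cons.
Qed.

Lemma smooth_prod (I : Type) (r : seq I) (F : I -> 'rV[R]_n -> R) :
  (forall k, smooth (F k)) -> smooth (fun x => \prod_(k <- r) F k x).
Proof.
move=> h; elim: r => [|k r IH].
  rewrite (_ : (fun _ => _) = fun=> 1); last by apply/funext => x; rewrite big_nil.
  exact: smooth_cst.
rewrite (_ : (fun _ => _) = fun x => F k x * \prod_(k <- r) F k x); first exact: smoothM.
by apply/funext => x; rewrite big_cons.
Qed.

Lemma smooth_omega : smooth (@omega R n).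
Proof.
apply: smoothD; first exact: smooth_cst.
by apply: smooth_sum => i; apply: smoothM; exact: smooth_coord.
Qed.

End partial_calculus.

Section test_functions.
Context {R : realType} {n : nat}.
Implicit Types (f g : 'rV[R]_n -> R) (i j : 'I_n).

Lemma test_functionP f :
  test_function f <-> smooth f /\ exists M, forall x, ~ box M x -> f x = 0.
Proof.
split => -[sf].
  move=> /compact_bounded[C [_ hC]]; split => //; exists (C + 1) => x bx.
  apply/eqP/negPn/negP => fx; apply: bx => i; rewrite -ler_norml.
  have : `|x| <= C + 1 by apply: hC; [rewrite ltrDl|exact: subset_closure].
  apply: le_trans; exact: norm_coord_le.
move=> [M fM]; split => //; apply: (subclosed_compact _ (@compact_box R n M)).
  exact: closed_closure.
rewrite [X in _ `<=` X]((closure_id _).1 (@closed_box R n M)).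
by apply: closure_subset => x /= /eqP fx; apply: contrapT => /fM.
Qed.

Lemma test_smooth f : test_function f -> smooth f. Proof. by case. Qed.

Lemma test_supp f : test_function f -> exists M, forall x, ~ box M x -> f x = 0.
Proof. by move=> /test_functionP[]. Qed.

Lemma test_partial i f : test_function f -> test_function (partial i f).
Proof.
move=> /test_functionP[sf [M fM]]; apply/test_functionP; split; first exact: smooth_partial.
by exists M; exact: partial_supp.
Qed.

Lemma testMl f g : smooth g -> test_function f -> test_function (fun x => g x * f x).
Proof.
move=> sg /test_functionP[sf [M fM]]; apply/test_functionP; split; first exact: smoothM.
by exists M => x /fM ->; rewrite mulr0.
Qed.

Lemma testZ c f : test_function f -> test_function (fun x => c * f x).
Proof. by apply: testMl; exact: smooth_cst. Qed.

Lemma testD f g : test_function f -> test_function g -> test_function (fun x => f x + g x).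
Proof.
move=> /test_functionP[sf [M fM]] /test_functionP[sg [N gN]]; apply/test_functionP.
split; first exact: smoothD.
exists (Num.max M N) => x bx; rewrite fM ?gN ?addr0//; apply: contra_not bx => bx i; have := bx i.
  have : N <= Num.max M N by rewrite le_max lexx orbT.
  lra.
have : M <= Num.max M N by rewrite le_max lexx.
lra.
Qed.

Lemma test_sum (I : Type) (r : seq I) (F : I -> 'rV[R]_n -> R) :
  (forall k, test_function (F k)) -> test_function (fun x => \sum_(k <- r) F k x).
Proof.
move=> h; elim: r => [|k r IH].
  rewrite (_ : (fun _ => _) = fun=> 0); last by apply/funext => x; rewrite big_nil.
  by apply/test_functionP; split; [exact: smooth_cst|exists 0].
rewrite (_ : (fun _ => _) = fun x => F k x + \sum_(k <- r) F k x); first exact: testD.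
by apply/funext => x; rewrite big_cons.
Qed.

Lemma test_cauchy_op beta f : test_function f -> test_function (cauchy_op beta f).
Proof.
move=> tf; rewrite (_ : cauchy_op beta f = fun x =>
   omega x * (\sum_i partial i (partial i f) x) +
   - (2 * (beta - 1)) * (\sum_i x ord0 i * partial i f x)); last first.
  apply/funext => x; rewrite /cauchy_op mulNr; congr (_ - _ * _).
  by apply: eq_bigr => i _; rewrite mxE.
apply: testD.
  apply: testMl; first exact: smooth_omega.
  by apply: test_sum => i; do 2 apply: test_partial.
apply: testZ; apply: test_sum => i; apply: testMl; first exact: smooth_coord.
exact: test_partial.
Qed.

Lemma integrable_test f : test_function f -> (lebesgue_rV n).-integrable setT (EFin \o f).
Proof.
move=> /test_functionP[/smooth_continuous cf [M fM]].
exact: integrable_continuous_supp fM.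
Qed.

Lemma integral_partial_test i f : test_function f ->
  (\int[lebesgue_rV n]_x (partial i f x)%:E = 0)%E.
Proof.
move=> /test_functionP[sf [M fM]]; apply: (integral_partial_eq0 (M := M)) => //.
- by move=> x; have [] := smooth_has_partial i sf x.
- by apply: smooth_continuous; exact: smooth_partial.
Qed.

End test_functions.

(** * Symmetry of second partial derivatives *)

Section clairaut.
Context {R : realType} {n : nat}.
Implicit Types (f g : 'rV[R]_n -> R) (i j : 'I_n).
Local Notation e_ i := (delta_mx ord0 i : 'rV[R]_n).

Lemma line_MVT f i (x : 'rV[R]_n) h : smooth f -> 0 < h ->
  exists2 s, 0 < s < h & f (h *: e_ i + x) - f x = h * partial i f (s *: e_ i + x).
Proof.
move=> sf h0.
have d s : is_derive (s : R) (1 : R) (fun s : R => f (s *: e_ i + x)) (partial i f (s *: e_ i + x)).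
  apply: DeriveDef; last by rewrite derive_line.
  by apply: derivable_line; have [] := smooth_has_partial i sf (s *: e_ i + x).
have [|s] := @MVT R _ _ _ _ h0 (fun s _ => d s).
  apply: continuous_subspaceT => s; apply: differentiable_continuous; apply/derivable1_diffP.
  by have [] := d s.
rewrite in_itv/= => sh; rewrite scale0r add0r subr0 => ->.
by exists s => //; rewrite mulrC.
Qed.

(** The mean value theorem is applied twice: in the direction e_i to the difference of the
    restrictions of f to two parallel segments, then in the direction e_j to [partial i f]. *)
Lemma second_difference f i j (x : 'rV[R]_n) h : smooth f -> 0 < h ->
  exists s t, [/\ 0 < s < h, 0 < t < h &
   f (h *: e_ i + (h *: e_ j + x)) - f (h *: e_ j + x) - (f (h *: e_ i + x) - f x) =
   h ^+ 2 * partial j (partial i f) (t *: e_ j + (s *: e_ i + x))].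
Proof.
move=> sf h0.
have sg : smooth (fun y => f y).
  exact: sf.
have d s : is_derive (s : R) (1 : R)
    (fun s : R => f (s *: e_ i + (h *: e_ j + x)) - f (s *: e_ i + x))
    (partial i f (s *: e_ i + (h *: e_ j + x)) - partial i f (s *: e_ i + x)).
  have l y : is_derive (s : R) (1 : R) (fun s : R => f (s *: e_ i + y)) (partial i f (s *: e_ i + y)).
    apply: DeriveDef; last by rewrite derive_line.
    by apply: derivable_line; have [] := smooth_has_partial i sf (s *: e_ i + y).
  exact: (is_deriveB (l _) (l _)).
have [|s] := @MVT R _ _ _ _ h0 (fun s _ => d s).
  apply: continuous_subspaceT => s; apply: differentiable_continuous; apply/derivable1_diffP.
  by have [] := d s.
rewrite in_itv/= => sh; rewrite !scale0r !add0r subr0.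
have -> : s *: e_ i + (h *: e_ j + x) = h *: e_ j + (s *: e_ i + x) by rewrite addrCA.
have [t th ->] := line_MVT j (s *: e_ i + x) (smooth_partial i sf) h0.
move=> e; exists s, t; split => //.
rewrite (_ : _ - _ = f (h *: e_ i + (h *: e_ j + x)) - f (h *: e_ i + x) - (f (h *: e_ j + x) - f x)); last by ring.
by rewrite e; ring.
Qed.

Lemma dist_le (p q u e : R) : `|p - u| < e / 2 -> `|q - u| < e / 2 -> `|p - q| <= e.
Proof. by rewrite !ltr_norml ler_norml => /andP[? ?] /andP[? ?]; apply/andP; split; lra. Qed.

(** The second difference is symmetric in i and j, so at every scale the two mixed derivatives take
    a common value at two points close to x; continuity concludes. *)
Theorem partialC f i j x : smooth f -> partial i (partial j f) x = partial j (partial i f) x.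
Proof.
move=> sf.
pose F := partial i (partial j f); pose G := partial j (partial i f).
have cF : continuous F by apply: smooth_continuous; do 2 apply: smooth_partial.
have cG : continuous G by apply: smooth_continuous; do 2 apply: smooth_partial.
apply/eqP; rewrite -subr_eq0; apply/eqP/normr0_eq0/eqP.
rewrite eq_le normr_ge0 andbT; apply/ler_addgt0Pl => e e0; rewrite addr0.
have /nbhs_ballP[d1 /= d10 h1] : nbhs x (F @^-1` ball (F x) (e / 2)).
  by apply: cF; apply: nbhsx_ballx; rewrite divr_gt0.
have /nbhs_ballP[d2 /= d20 h2] : nbhs x (G @^-1` ball (G x) (e / 2)).
  by apply: cG; apply: nbhsx_ballx; rewrite divr_gt0.
pose d := Num.min d1 d2; have d0 : 0 < d by rewrite lt_min d10.
have h0 : 0 < d / 2 by rewrite divr_gt0.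
have near_x k l s t : 0 < s < d / 2 -> 0 < t < d / 2 -> ball x d (t *: e_ k + (s *: e_ l + x)).
  move=> /andP[s0 sd] /andP[t0 td]; split => // a b; rewrite (ord1 a) !rV_lineE.
  rewrite /ball/= distrC addrA addrK.
  rewrite (le_lt_trans (ler_normD _ _))// (splitr d) ltrD//.
    apply: le_lt_trans td; rewrite normrM gtr0_norm// normr_nat; case: (_ == _); rewrite ?mulr1 ?mulr0//; exact: ltW.
  apply: le_lt_trans sd; rewrite normrM gtr0_norm// normr_nat; case: (_ == _); rewrite ?mulr1 ?mulr0//; exact: ltW.
have [s [t [sh th e1]]] := second_difference i j x sf h0.
have [s' [t' [sh' th' e2]]] := second_difference j i x sf h0.
have eFG : G (t *: e_ j + (s *: e_ i + x)) = F (t' *: e_ i + (s' *: e_ j + x)).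
  have sw (p q r u : R) : p - q - (r - u) = p - r - (q - u) by ring.
  have dd : (d / 2) ^+ 2 != 0 := lt0r_neq0 (exprn_gt0 2 h0).
  apply: (mulfI dd); rewrite /G /F.
  refine (etrans (esym e1) (etrans _ e2)).
  by rewrite addrCA sw.
have dd1 : d <= d1 by rewrite ge_min lexx.
have dd2 : d <= d2 by rewrite ge_min lexx orbT.
have b1 := h1 _ (le_ball dd1 (near_x i j s' t' sh' th')).
have b2 := h2 _ (le_ball dd2 (near_x j i s t sh th)).
clear h1 h2 near_x e1 e2 cF cG.
rewrite /ball/= in b1 b2.
rewrite -eFG in b1.
exact: dist_le b1 b2.
Qed.

End clairaut.

(** * Smooth bumps *)

Section bump1.
Context {R : realType}.
Implicit Types (f g : R -> R) (p : {poly R}).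

Fixpoint smooth1N k f : Prop := match k with
  | 0 => continuous f
  | k'.+1 => continuous f /\
      exists2 f', (forall t : R, is_derive t (1 : R) f (f' t)) & smooth1N k' f'
  end.

Lemma smooth1N_continuous k f : smooth1N k f -> continuous f.
Proof. by case: k => // k []. Qed.

Lemma is_derive_continuous f f' : (forall t : R, is_derive t (1 : R) f (f' t)) -> continuous f.
Proof.
by move=> df t; apply: differentiable_continuous; apply/derivable1_diffP; have [] := df t.
Qed.

Lemma smooth1NW k f : smooth1N k.+1 f -> smooth1N k f.
Proof.
elim: k f => [f []//|k IH f [cf [f' df sf]]]; split => //.
by exists f' => //; exact: IH.
Qed.

Lemma smooth1ND k f g : smooth1N k f -> smooth1N k g -> smooth1N k (fun t => f t + g t).
Proof.
elim: k f g => [|k IH] f g; first exact: ctsD.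
move=> [cf [f' f1 f2]] [cg [g' g1 g2]]; split; first exact: ctsD.
exists (fun t => f' t + g' t); last exact: IH.
by move=> t; exact: (is_deriveD (f1 t) (g1 t)).
Qed.

Lemma smooth1N_cst k (c : R) : smooth1N k (fun=> c).
Proof.
elim: k c => [|k IH] c; first exact: cts_cst.
split; first exact: cts_cst.
by exists (fun=> 0) => // t; exact: is_derive_cst.
Qed.

Lemma smooth1NM k f g : smooth1N k f -> smooth1N k g -> smooth1N k (fun t => f t * g t).
Proof.
elim: k f g => [|k IH] f g; first exact: ctsM.
move=> sf sg; have := smooth1NW sf; have := smooth1NW sg.
move: sf sg => [cf [f' f1 f2]] [cg [g' g1 g2]] sg sf; split; first exact: ctsM.
exists (fun t => f' t * g t + f t * g' t); last by apply: smooth1ND; exact: IH.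
move=> t; apply: is_derive_eq (is_deriveM (f1 t) (g1 t)) _.
by rewrite addrC [g t *: _]mulrC.
Qed.

Lemma is_derive_affine (c d t : R) : is_derive (t : R) (1 : R) (fun t => c * t + d) c.
Proof.
apply: is_derive_eq (is_deriveD (is_deriveM (is_derive_cst (c : R) (t : R) (1 : R)) (is_derive_id _ _))
  (is_derive_cst (d : R) (t : R) (1 : R))) _.
by rewrite scaler0 addr0 addr0 [LHS]mulr1.
Qed.

Lemma smooth1N_affine k f (c d : R) : smooth1N k f -> smooth1N k (fun t => f (c * t + d)).
Proof.
have ca : continuous (fun t : R => c * t + d).
  by apply: is_derive_continuous => t; exact: is_derive_affine.
have comp h : continuous h -> continuous (fun t : R => h (c * t + d)).
  by move=> ch t; exact: (cvg_comp _ _ (ca t) (ch _)).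
elim: k f => [|k IH] f; first exact: comp.
move=> [cf [f' f1 f2]]; split; first exact: comp.
exists (fun t => f' (c * t + d) * c).
  by move=> t; exact: (is_derive1_comp (f1 _) (is_derive_affine c d t)).
by apply: smooth1NM; [exact: IH|exact: smooth1N_cst].
Qed.

(* Derivatives of exp(-1/t) are again of the form p(1/t) exp(-1/t). *)
Definition expinv p (t : R) : R := if 0 < t then p.[t^-1] * expR (- t^-1) else 0.

(** From exp(s) = exp(s/(k+1))^(k+1) >= (s/(k+1))^(k+1). The spare factor 1/s becomes a factor t
    when s = 1/t. *)
Lemma exprn_expRN_le k (s : R) : 0 < s -> s ^+ k * expR (- s) <= k.+1%:R ^+ k.+1 * s^-1.
Proof.
move=> s0; rewrite ler_pdivlMr// mulrAC -exprSr expRN ler_pdivrMr ?expR_gt0//.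
have -> : expR s = expR (s / k.+1%:R) ^+ k.+1.
  by rewrite -expRM_natl mulrC divfK// pnatr_eq0.
rewrite -exprMn; apply: lerXn2r; rewrite ?nnegrE.
- exact: ltW.
- by rewrite mulr_ge0// expR_ge0.
- rewrite mulrC -ler_pdivrMr ?ltr0n//.
  by apply: le_trans (expR_ge1Dx _); rewrite lerDr.
Qed.

(** A bound that is linear in t, not merely a constant, is what yields a zero derivative at the
    origin. *)
Lemma expinv_bound p : exists2 C : R, 0 <= C & forall t : R, `|expinv p t| <= C * `|t|.
Proof.
exists (\sum_(k < size p) `|p`_k| * k.+1%:R ^+ k.+1).
  by apply: sumr_ge0 => k _; rewrite mulr_ge0// exprn_ge0.
move=> t; rewrite /expinv; case: ifPn => [t0|_]; last first.
  by rewrite normr0 mulr_ge0// sumr_ge0// => k _; rewrite mulr_ge0// exprn_ge0.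
rewrite horner_coef (gtr0_norm t0) normrM (ger0_norm (expR_ge0 _)).
apply: (@le_trans _ _ ((\sum_(k < size p) `|p`_k * t^-1 ^+ k|) * expR (- t^-1))).
  by rewrite ler_wpM2r ?expR_ge0// ler_norm_sum.
rewrite !mulr_suml; apply: ler_sum => k _.
rewrite normrM -!mulrA ler_wpM2l// ger0_norm ?exprn_ge0 ?invr_ge0 ?(ltW t0)//.
apply: le_trans (exprn_expRN_le _ _) _; first by rewrite invr_gt0.
by rewrite invrK.
Qed.

(** In the variable s = 1/t the derivative of s is -s^2, which gives s^2 (p(s) - p'(s)) exp(-s) for
    the derivative of p(s) exp(-s). *)
Definition expinv' p : {poly R} := 'X^2 * (p - p^`()).

Lemma is_derive_expinv p (t : R) : is_derive t (1 : R) (expinv p) (expinv (expinv' p) t).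
Proof.
have [t0|t0|t0] := ltgtP t 0.
- have -> : expinv (expinv' p) t = 0 by rewrite /expinv ifF// ltNge ltW.
  apply: (@near_eq_is_derive _ _ _ (cst 0)).
    near=> s; rewrite /expinv ifF//; apply/negbTE; rewrite -leNgt ltW//.
    by near: s; exact: lt_nbhsl.
- have -> : expinv (expinv' p) t = (expinv' p).[t^-1] * expR (- t^-1) by rewrite /expinv t0.
  have tn0 : t != 0 by rewrite gt_eqF.
  have dv : is_derive t (1 : R) (fun s : R => s^-1) (- t^-1 ^+ 2).
    apply: DeriveDef; first by apply: derivableV.
    have -> : 'D_(1 : R) (fun s : R => s^-1) t = - t ^- 2 *: 'D_(1 : R) (@id R) t.
      by apply: deriveV.
    by rewrite derive_id [LHS]mulr1 exprVn.
  have dp := is_derive1_comp (is_derive_poly p t^-1) dv.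
  have dn : is_derive t (1 : R) (fun s : R => - s^-1) (- - t^-1 ^+ 2) by exact: is_deriveN.
  have de := @is_derive1_comp _ (@expR R) (fun s : R => - s^-1) t _ _ (is_derive_expR (- t^-1)) dn.
  have D : is_derive t (1 : R) (fun s : R => p.[s^-1] * expR (- s^-1))
      ((expinv' p).[t^-1] * expR (- t^-1)).
    apply: is_derive_eq (is_deriveM dp de) _.
    rewrite /expinv' hornerM hornerXn hornerD hornerN /GRing.scale/=.
    ring.
  apply: near_eq_is_derive D.
  by near=> s; rewrite /expinv ifT//; near: s; exact: lt_nbhsr.
- have -> : expinv (expinv' p) t = 0 by rewrite /expinv t0 ltxx.
  rewrite t0.
  (* The difference quotient at 0 absorbs 1/h into the polynomial: it equals [expinv ('X * p)] at h,
     which the linear bound sends to 0. *)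
  have [C C0 hC] := expinv_bound ('X * p).
  have L : (h^-1 *: ((expinv p \o shift 0) (h *: (1 : R)) - expinv p 0)) @[h --> (0 : R)^'] --> (0 : R).
    apply/cvgr0Pnorm_lt => e e0; near=> h.
    rewrite /= -[h *: 1]/(h * 1) mulr1 addr0 {2}/expinv ltxx subr0 -[_ *: _]/(_ * _).
    have -> : h^-1 * expinv p h = expinv ('X * p) h.
      by rewrite /expinv; case: ifPn => _; rewrite ?mulr0// hornerM hornerX mulrA.
    apply: le_lt_trans (hC h) _.
    apply: (@le_lt_trans _ _ ((C + 1) * `|h|)); first by rewrite ler_wpM2r// lerDl.
    rewrite -ltr_pdivlMl ?ltr_wpDl//.
    by near: h; apply: dnbhs0_lt; rewrite mulr_gt0 ?invr_gt0 ?ltr_wpDl.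
  apply: DeriveDef; first by apply/cvg_ex; exists 0.
  exact: cvg_lim L.
Unshelve. all: by end_near. Qed.

Lemma smooth1N_expinv k p : smooth1N k (expinv p).
Proof.
have cE q : continuous (expinv q) by apply: is_derive_continuous => t; exact: is_derive_expinv.
elim: k p => [|k IH] p; first exact: cE.
by split => //; exists (expinv (expinv' p)) => // t; exact: is_derive_expinv.
Qed.

Lemma expinv1E (t : R) : expinv 1 t = if 0 < t then expR (- t^-1) else 0.
Proof. by rewrite /expinv hornerC mul1r. Qed.

Lemma expinv1_ge0 (t : R) : 0 <= expinv 1 t.
Proof. by rewrite expinv1E; case: ifP => // _; exact: expR_ge0. Qed.

Lemma expinv1_le1 (t : R) : expinv 1 t <= 1.
Proof.
rewrite expinv1E; case: ifPn => // t0.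
by rewrite -expR0 ler_expR oppr_le0 invr_ge0 ltW.
Qed.

Lemma expinv1_cvg1 (s : R) : 0 < s -> expinv 1 (k.+1%:R * s) @[k --> \oo] --> (1 : R).
Proof.
move=> s0; rewrite (_ : (fun k => _) = fun k => expR (- (s^-1 * k.+1%:R^-1))); last first.
  by apply/funext => k; rewrite expinv1E mulr_gt0// invfM mulrC.
rewrite -[X in _ --> X]expR0.
have c : {for 0, continuous (@expR R)} by exact: continuous_expR.
have h : (fun k : nat => - (s^-1 * k.+1%:R^-1)) @ \oo --> (0 : R).
  rewrite -[X in _ --> X]oppr0; apply: cvgN.
  rewrite -[X in _ --> X](mulr0 s^-1); apply: cvgM; first exact: cvg_cst.
  exact: cvg_harmonic.
exact: (cvg_comp _ _ h c).
Qed.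

(** Smooth, with values in [0, 1], and pointwise convergent to the indicator of ]a, b[ as k grows.
    There is no plateau: each factor is a dilated exp(-1/t), and only the limit in k is used to
    reach the indicator. *)
Definition bump1 (a b : R) (k : nat) (t : R) : R :=
  expinv 1 (k.+1%:R * (t - a)) * expinv 1 (k.+1%:R * (b - t)).

Lemma smooth1N_bump1 m a b k : smooth1N m (bump1 a b k).
Proof.
rewrite (_ : bump1 a b k = fun t => expinv 1 (k.+1%:R * t + (- k.+1%:R * a)) *
   expinv 1 (- k.+1%:R * t + k.+1%:R * b)); last first.
  by apply/funext => t; rewrite /bump1; congr (expinv _ _ * expinv _ _); ring.
by apply: smooth1NM; apply: smooth1N_affine; exact: smooth1N_expinv.
Qed.

Lemma bump1_ge0 a b k t : 0 <= bump1 a b k t.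
Proof. by rewrite mulr_ge0// expinv1_ge0. Qed.

Lemma bump1_le1 a b k t : bump1 a b k t <= 1.
Proof.
by rewrite -[leRHS]mulr1; apply: ler_pM; rewrite ?expinv1_ge0 ?expinv1_le1.
Qed.

Lemma bump1_out a b k t : ~ (a < t < b) -> bump1 a b k t = 0.
Proof.
move=> h; rewrite /bump1 !expinv1E.
case: ifPn => [ta|]; last by rewrite mul0r.
case: ifPn => [tb|]; last by rewrite mulr0.
exfalso; apply: h; move: ta tb; rewrite !pmulr_rgt0// !subr_gt0 => -> ->.
by [].
Qed.

Lemma bump1_gt0 a b k t : a < t < b -> 0 < bump1 a b k t.
Proof.
move=> /andP[h1 h2]; rewrite /bump1 !expinv1E.
have p1 : 0 < k.+1%:R * (t - a) by rewrite mulr_gt0// subr_gt0.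
have p2 : 0 < k.+1%:R * (b - t) by rewrite mulr_gt0// subr_gt0.
by rewrite p1 p2 mulr_gt0 ?expR_gt0.
Qed.

Lemma bump1_cvg a b t : a < t < b -> bump1 a b k t @[k --> \oo] --> (1 : R).
Proof.
move=> /andP[h1 h2]; rewrite -[X in _ --> X]mulr1.
by apply: cvgM; apply: expinv1_cvg1; rewrite subr_gt0.
Qed.

End bump1.

Section bumpn.
Context {R : realType} {n : nat}.

Lemma smoothN_coord_comp k (f : R -> R) (j : 'I_n) :
  smooth1N k f -> smoothN k (fun x : 'rV[R]_n => f (x ord0 j)).
Proof.
have cc (h : R -> R) : continuous h -> continuous (fun x : 'rV[R]_n => h (x ord0 j)).
  by move=> ch x; exact: (continuous_comp (@continuous_rV_coord R n j x) (ch _)).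
elim: k f => [|k IH] f; first exact: cc.
move=> [cf [f' f1 f2]]; split; first exact: cc.
move=> i; exists (fun x => f' (x ord0 j) * (j == i)%:R).
  exact: (has_partial_comp (fun x => f1 (x ord0 j)) (has_partial_coord i j)).
by apply: smoothNM; [exact: IH|exact: smoothN_cst].
Qed.

Lemma smooth_coord_comp (f : R -> R) (j : 'I_n) :
  (forall k, smooth1N k f) -> smooth (fun x : 'rV[R]_n => f (x ord0 j)).
Proof. by move=> sf; apply/smoothP => k; exact: smoothN_coord_comp. Qed.

Lemma test_prod (F : 'I_n -> R -> R) (M : R) :
  (forall i k, smooth1N k (F i)) -> (forall i t, ~ (- M <= t <= M) -> F i t = 0) ->
  test_function (fun x : 'rV[R]_n => \prod_i F i (x ord0 i)).
Proof.
move=> sF F0; apply/test_functionP; split.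
  by apply: smooth_prod => i; exact: smooth_coord_comp.
exists M => x /existsNP[i hi]; rewrite (bigD1 i)//= F0 ?mul0r//.
Qed.

Definition bump (a b : 'I_n -> R) (k : nat) (x : 'rV[R]_n) : R :=
  \prod_i bump1 (a i) (b i) k (x ord0 i).

Lemma bump_ge0 a b k x : 0 <= bump a b k x.
Proof. by apply: prodr_ge0 => i _; exact: bump1_ge0. Qed.

Lemma bump_le1 a b k x : bump a b k x <= 1.
Proof. by apply: prodr_ile1 => i; rewrite bump1_ge0 bump1_le1. Qed.

Definition bump_radius (a b : 'I_n -> R) : R := \sum_i (`|a i| + `|b i|).

Lemma bump1_radius a b i k t : ~ (- bump_radius a b <= t <= bump_radius a b) ->
  bump1 (a i) (b i) k t = 0.
Proof.
move=> h; apply: bump1_out; apply: contra_not h => /andP[h1 h2].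
have hr : `|a i| + `|b i| <= bump_radius a b.
  rewrite /bump_radius (bigD1 i)//= lerDl; apply: sumr_ge0 => j _; exact: addr_ge0.
have := ler_norm (b i); have := ler_norm (- a i); rewrite normrN; have := normr_ge0 (a i); have := normr_ge0 (b i).
lra.
Qed.

Lemma test_bump a b k : test_function (bump a b k).
Proof.
apply: (@test_prod (fun i => bump1 (a i) (b i) k) (bump_radius a b)).
  by move=> i m; exact: smooth1N_bump1.
by move=> i t; exact: bump1_radius.
Qed.

Definition obox (a b : 'I_n -> R) : set 'rV[R]_n := [set x | forall i, a i < x ord0 i < b i].

Lemma bump_cvg_in a b x : obox a b x -> bump a b k x @[k --> \oo] --> (1 : R).
Proof.
move=> h; rewrite /bump; elim: (index_enum _) => [|i r IH].
  rewrite (_ : (fun k => _) = fun=> 1); first exact: cvg_cst.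
  by apply/funext => k; rewrite big_nil.
rewrite (_ : (fun k => _) = fun k => bump1 (a i) (b i) k (x ord0 i) * \prod_(i <- r) bump1 (a i) (b i) k (x ord0 i)); last first.
  by apply/funext => k; rewrite big_cons.
by rewrite -[X in _ --> X]mulr1; apply: cvgM IH; exact: bump1_cvg.
Qed.

Lemma bump_out a b k x : ~ obox a b x -> bump a b k x = 0.
Proof. by move=> /existsNP[i hi]; rewrite /bump (bigD1 i)//= bump1_out// mul0r. Qed.

End bumpn.

(** * Weak derivatives *)

Section dens_measure.
Context d (T : measurableType d) (R : realType) (m : {measure set T -> \bar R}).
Local Open Scope ereal_scope.

(** The proofs of measurability and positivity are arguments so that the measure structure declared
    below can be inferred from the term itself. *)
Definition density_measure (f : T -> \bar R) (mf : measurable_fun setT f) (f0 : forall x, 0 <= f x) (A : set T) : \bar R :=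
  \int[m]_(x in A) f x.

Section inst.
Variables (f : T -> \bar R) (mf : measurable_fun setT f) (f0 : forall x, 0 <= f x).
Let dmeas0 : density_measure mf f0 set0 = 0. Proof. exact: integral_set0. Qed.
Let dmeas_ge0 A : 0 <= density_measure mf f0 A. Proof. exact: integral_ge0. Qed.
Let dmeas_sigma_additive : semi_sigma_additive (density_measure mf f0).
Proof. exact: semi_sigma_additive_nng_induced. Qed.
HB.instance Definition _ := isMeasure.Build _ _ _ (density_measure mf f0) dmeas0 dmeas_ge0 dmeas_sigma_additive.
End inst.

End dens_measure.

Section boxes.
Context {R : realType} {n : nat}.
Local Notation leb := (@lebesgue_rV R n).

Definition oboxes : set (set 'rV[R]_n) := [set A | exists a b, A = obox a b].

Lemma measurable_obox (a b : 'I_n -> R) : measurable (obox a b).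
Proof.
rewrite (_ : obox a b = \bigcap_(i in [set: 'I_n]) (rV_coord i @^-1` `]a i, b i[%classic)).
  apply: fin_bigcap_measurable => // i _.
  by rewrite -[X in measurable X]setTI; exact: measurable_rV_coord.
apply/seteqP; split => x /= Ax i; first by move=> _; rewrite /= in_itv/=; exact: Ax.
by have := Ax i I; rewrite /= in_itv.
Qed.

(** The preimage of an open interval under one coordinate is the increasing union of the boxes whose
    other sides are ]-k, k[. *)
Lemma measurable_oboxesE : @measurable _ 'rV[R]_n = <<s oboxes>>.
Proof.
apply/seteqP; split; last first.
  apply: smallest_sub; first exact: sigma_algebra_measurable.
  by move=> _ [a [b ->]]; exact: measurable_obox.
apply: smallest_sub; first exact: smallest_sigma_algebra.
rewrite -bigcup_seq; apply: bigcup_sub => i _ _ [B mB <-].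
have : measurable_fun [set: g_sigma_algebraType oboxes]
    (fun x : g_sigma_algebraType oboxes => rV_coord i (x : 'rV[R]_n)).
  apply: (measurability _ (RGenOpens.measurableE R)) => _ [_ [a [b ->]] <-].
  rewrite setTI.
  rewrite (_ : _ @^-1` _ = \bigcup_(k : nat)
    (obox (fun j => if j == i then a else - k%:R) (fun j => if j == i then b else k%:R))).
    apply: bigcupT_measurable => k; apply: sub_sigma_algebra.
    by eexists; eexists.
  apply/seteqP; split => x /=.
    rewrite in_itv/= => xab; exists (Num.truncn `|(x : 'rV[R]_n)|).+1 => // j.
    case: eqP => [->//|_]; rewrite -ltr_norml.
    apply: le_lt_trans (truncnS_gt _).
    exact: norm_coord_le.
  move=> [k _ /(_ i)]; rewrite eqxx in_itv/=.
  by [].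
by move=> /(_ measurableT B mB).
Qed.

Lemma setI_closed_oboxes : setI_closed oboxes.
Proof.
move=> _ _ [a [b ->]] [a' [b' ->]].
exists (fun i => Num.max (a i) (a' i)), (fun i => Num.min (b i) (b' i)).
apply/seteqP; split => x.
  by move=> [h1 h2] i; rewrite gt_max lt_min; move: (h1 i) (h2 i) => /andP[-> ->] /andP[-> ->].
by move=> h; split => i; have := h i; rewrite gt_max lt_min => /andP[/andP[h1 h2] /andP[h3 h4]];
  apply/andP; split.
Qed.

Let oc (k : nat) : set 'rV[R]_n := obox (fun=> - k%:R) (fun=> k%:R).

Lemma obox_cover : \bigcup_k oc k = [set: 'rV[R]_n].
Proof.
apply/seteqP; split => // x _.
exists (Num.truncn `|x|).+1 => // j; rewrite -ltr_norml.
apply: le_lt_trans (truncnS_gt _).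
exact: norm_coord_le.
Qed.

(** The positive and negative parts of w are densities of two measures that agree on open boxes.
    Boxes are stable under intersection and generate the sigma-algebra, and finitely many units of
    mass lie in each, so the measures coincide and w integrates to 0 over every measurable set. *)
Lemma integral_obox_eq0 (w : 'rV[R]_n -> R) : leb.-integrable setT (EFin \o w) ->
  (forall a b, \int[leb]_(x in obox a b) (w x)%:E = 0)%E ->
  {ae leb, forall x, w x = 0}.
Proof.
move=> iw w0.
have mw : measurable_fun setT (EFin \o w) by have /integrableP[] := iw.
have mwp : measurable_fun setT (EFin \o w)^\+%E by exact: measurable_funepos.
have mwn : measurable_fun setT (EFin \o w)^\-%E by exact: measurable_funeneg.
pose m1 := density_measure leb mwp (funepos_ge0 _).
pose m2 := density_measure leb mwn (funeneg_ge0 _).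
have fin1 A : measurable A -> (\int[leb]_(x in A) (EFin \o w)^\+ x)%E \is a fin_num.
  move=> mA; apply: integrable_fin_num => //.
  exact: (integrableS measurableT mA (@subsetT _ A) (integrable_funepos measurableT iw)).
have fin2 A : measurable A -> (\int[leb]_(x in A) (EFin \o w)^\- x)%E \is a fin_num.
  move=> mA; apply: integrable_fin_num => //.
  exact: (integrableS measurableT mA (@subsetT _ A) (integrable_funeneg measurableT iw)).
have m12 A : measurable A -> m1 A = m2 A.
  apply: (measure_unique oboxes oc) => //.
  - exact: measurable_oboxesE.
  - exact: setI_closed_oboxes.
  - by move=> k; eexists; eexists.
  - exact: obox_cover.
  - move=> _ [a [b ->]].
    have f1 := fin1 _ (measurable_obox a b); have f2 := fin2 _ (measurable_obox a b).
    have := w0 a b; rewrite integralE -(fineK f1) -(fineK f2) -EFinB => -[/subr0_eq e].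
    by rewrite /m1 /m2 /= /density_measure -(fineK f1) -(fineK f2) e.
  - by move=> k; rewrite ltey_eq fin1//; exact: measurable_obox.
have : ae_eq leb setT (EFin \o w) (cst 0%E).
  apply: integral_ae_eq => // E _ mE.
  rewrite integral0 integralE.
  have := m12 E mE; rewrite /m1 /m2 /density_measure => ->.
  by rewrite subee// fin2.
by apply: filterS => x /(_ I)/= [].
Qed.

End boxes.

Section locally_integrable.
Context {R : realType} {n : nat}.
Local Notation leb := (@lebesgue_rV R n).
Implicit Types v : 'rV[R]_n -> R.

Lemma locally_integrable_measurable v : locally_integrable_rV v -> measurable_fun setT v.
Proof.
move=> lv; rewrite box_cover; apply/measurable_fun_bigcup.
  by move=> k; exact: measurable_box.
move=> k; have /integrableP[/measurable_EFinP h _] := lv _ (@compact_box R n k%:R).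
exact: h.
Qed.

Lemma locally_integrableM_supp v (f : 'rV[R]_n -> R) M C : locally_integrable_rV v ->
  measurable_fun setT f -> (forall x, `|f x| <= C) -> (forall x, ~ box M x -> f x = 0) ->
  leb.-integrable setT (EFin \o (fun x => v x * f x)).
Proof.
move=> lv mf fC f0.
rewrite (_ : EFin \o _ = (EFin \o (fun x => v x * f x)) \_ (box M)); last first.
  apply/funext => x; rewrite patchE; case: ifPn => //.
  by rewrite notin_setE => /f0 /= ->; rewrite mulr0.
rewrite -integrable_mkcond; last exact: measurable_box.
apply: (@le_integrable _ _ _ leb _ (measurable_box M) _ (fun x => (C%:E * (v x)%:E)%E)).
- apply/measurable_EFinP; apply: measurable_funM; last exact: measurable_funTS.
  by apply: measurable_funTS; exact: locally_integrable_measurable.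
- move=> x _; rewrite -EFinM /= !lee_fin !normrM mulrC ler_wpM2r//.
  exact: le_trans (fC x) (ler_norm _).
- apply: integrableZl; first exact: measurable_box.
  by apply: lv; exact: compact_box.
Qed.

Lemma locally_integrableM_test v f : locally_integrable_rV v -> test_function f ->
  leb.-integrable setT (EFin \o (fun x => v x * f x)).
Proof.
move=> lv /test_functionP[/smooth_continuous cf [M fM]].
have [C hC] := continuous_bounded_box M cf.
apply: (locally_integrableM_supp (C := Num.max 0 C) lv _ _ fM).
  exact: continuous_measurable_rV.
move=> x; have [bx|bx] := pselect (box M x).
  by rewrite le_max hC ?orbT.
by rewrite fM// normr0 le_max lexx.
Qed.

Lemma locally_integrableB v w : locally_integrable_rV v -> locally_integrable_rV w ->
  locally_integrable_rV (fun x => v x - w x).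
Proof.
move=> lv lw K cK.
have mK : measurable K.
  by apply: closed_measurable_rV; apply: compact_closed => //; exact: norm_hausdorff.
rewrite (_ : EFin \o _ = ((EFin \o v) \- (EFin \o w))%E)//.
by apply: integrableB => //; [exact: lv|exact: lw].
Qed.

(** Dominated convergence replaces the bumps by indicators of boxes; the dominating function is v on
    a cube containing the support of every bump of the sequence. *)
Lemma bump_eq0_ae v : locally_integrable_rV v ->
  (forall a b k, \int[leb]_x (v x * bump a b k x)%:E = 0)%E ->
  {ae leb, forall x, v x = 0}.
Proof.
move=> lv v0.
have mv := locally_integrable_measurable lv.
have box0 a b : (\int[leb]_(x in obox a b) (v x)%:E = 0)%E.
  rewrite integral_mkcond.
  have cv x : (v x * bump a b k x)%:E @[k --> \oo] --> (((fun x => (v x)%:E) \_ (obox a b)) x : \bar R).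
    rewrite patchE; case: ifPn; rewrite ?inE ?notin_setE => xab.
      apply/fine_cvgP; split; first exact: nearW.
      rewrite /= -[X in _ --> X]mulr1; apply: cvgM; first exact: cvg_cst.
      exact: bump_cvg_in.
    under eq_fun do rewrite bump_out// mulr0.
    exact: cvg_cst.
  pose M := bump_radius a b.
  have h1 k : measurable_fun setT (fun x => (v x * bump a b k x)%:E).
    apply/measurable_EFinP; apply: measurable_funM => //.
    by apply: continuous_measurable_rV; apply: smooth_continuous; apply: test_smooth; exact: test_bump.
  have h2 : measurable_fun setT ((fun x => (v x)%:E) \_ (obox a b)).
    apply/(measurable_restrictT _ _).1; first exact: measurable_obox.
    by apply: measurable_funTS; exact/measurable_EFinP.
  have h3 : {ae leb, forall x, setT x -> (v x * bump a b k x)%:E @[k --> \oo] --> ((fun x => (v x)%:E) \_ (obox a b)) x}.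
    by apply/nearW => x _; exact: cv.
  have h4 : leb.-integrable setT (fun x => `|(v x * \1_(box M) x)%:E|)%E.
    apply: integrable_abse; apply: (locally_integrableM_supp (f := \1_(box M)) (C := 1) (M := M) lv).
    + by apply: measurable_indic; exact: measurable_box.
    + by move=> x; rewrite indicE; case: (_ \in _); rewrite ?normr1 ?normr0.
    + by move=> x bx; rewrite indicE memNset.
  have h5 : {ae leb, forall x k, setT x -> (`|(v x * bump a b k x)%:E| <= `|(v x * \1_(box M) x)%:E|)%E}.
    apply/nearW => x k _; rewrite /= lee_fin !normrM ler_wpM2l//.
    rewrite ger0_norm ?bump_ge0// indicE; case: (boolP (x \in box M)).
      by rewrite normr1 bump_le1.
    by rewrite notin_setE => /existsNP[i hi]; rewrite normr0 /bump (bigD1 i)//= bump1_radius ?mul0r//.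
  have [_ _ L] := dominated_convergence measurableT h1 h2 h3 h4 h5.
  have L0 : (\int[leb]_x (v x * bump a b k x)%:E)%E @[k --> \oo] --> (0 : \bar R)%E.
    by under eq_fun do rewrite v0; exact: cvg_cst.
  exact: (cvg_unique _ L L0).
(* v is only locally integrable, while [integral_obox_eq0] requires integrability: v is cut to the
   cube ]-N, N[^n, and an intersection of boxes is again a box. *)
have aeN (N : nat) : {ae leb, forall x, v x * \1_(obox (fun=> - N%:R) (fun=> N%:R)) x = 0}.
  apply: integral_obox_eq0.
    apply: (locally_integrableM_supp (f := \1_(obox (fun=> - N%:R) (fun=> N%:R))) (C := 1) (M := N%:R) lv).
    + by apply: measurable_indic; exact: measurable_obox.
    + by move=> x; rewrite indicE; case: (_ \in _); rewrite ?normr1 ?normr0.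
    + move=> x bx; rewrite indicE memNset//; apply: contra_not bx => h i.
      by have /andP[/ltW -> /ltW ->] := h i.
  move=> a b.
  have [a' [b' e]] := @setI_closed_oboxes R n _ _ (ex_intro _ a (ex_intro _ b erefl))
    (ex_intro _ (fun=> - N%:R) (ex_intro _ (fun=> N%:R) erefl)).
  rewrite -(box0 a' b') -e integral_mkcondr; apply: eq_integral => x _.
  by rewrite patchE indicE; case: (_ \in _); rewrite ?mulr1 ?mulr0.
have : {ae leb, forall x, forall N : nat, v x * \1_(obox (fun=> - N%:R) (fun=> N%:R)) x = 0}.
  exact/ae_foralln.
apply: filterS => x h.
have : (\bigcup_(k : nat) obox (fun=> - k%:R) (fun=> k%:R)) x by rewrite obox_cover.
move=> [k _ xk]; have := h k; by rewrite indicE mem_set// mulr1.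
Qed.

Lemma du_bois_reymond v w : locally_integrable_rV v -> locally_integrable_rV w ->
  (forall phi, test_function phi ->
    \int[leb]_x (v x * phi x)%:E = \int[leb]_x (w x * phi x)%:E)%E ->
  {ae leb, forall x, v x = w x}.
Proof.
move=> lv lw vw.
have : {ae leb, forall x, v x - w x = 0}.
  apply: bump_eq0_ae; first exact: locally_integrableB.
  move=> a b k; have tb := test_bump a b k.
  under eq_integral do rewrite mulrBl EFinB.
  rewrite integralB//; [|exact: locally_integrableM_test..].
  rewrite vw// subee//; apply: integrable_fin_num => //.
  exact: locally_integrableM_test.
by apply: filterS => x /eqP; rewrite subr_eq0 => /eqP.
Qed.

Lemma weak_partial_unique i u v w :
  is_weak_partial i u v -> is_weak_partial i u w -> {ae leb, forall x, v x = w x}.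
Proof.
move=> [_ lv hv] [_ lw hw]; apply: du_bois_reymond => // phi tphi.
by apply: oppe_inj; rewrite -hv// -hw.
Qed.

(** As soon as one weak derivative exists, [xget] selects one, and uniqueness makes it agree almost
    everywhere with any explicit candidate. *)
Lemma weak_partialP i u v : is_weak_partial i u v ->
  is_weak_partial i u (weak_partial i u) /\ {ae leb, forall x, weak_partial i u x = v x}.
Proof.
move=> h; have h' : is_weak_partial i u (weak_partial i u) by rewrite /weak_partial; apply: xgetPex; exists v.
by split => //; exact: weak_partial_unique h' h.
Qed.

End locally_integrable.

(** * Functions with vanishing weak gradient *)

Section antiderivative.
Context {R : realType}.
Local Notation leb1 := (@lebesgue_measure R).

Definition supp1 (M : R) (rho : R -> R) := forall t, ~ (- M <= t <= M) -> rho t = 0.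

Lemma integrable_supp1 (rho : R -> R) M : continuous rho -> supp1 M rho ->
  leb1.-integrable setT (EFin \o rho).
Proof.
move=> cr sr.
rewrite (_ : EFin \o rho = (EFin \o rho) \_ `[- M, M]%classic); last first.
  apply/funext => t; rewrite patchE; case: ifPn => //.
  by rewrite notin_setE/= in_itv/= => /sr ->.
rewrite -integrable_mkcond//.
apply: continuous_compact_integrable; first exact: segment_compact.
exact: continuous_subspaceT.
Qed.

(** The primitive from -oo vanishes to the left of the support, and to the right it equals the total
    integral, which is 0. *)
Lemma antiderivative_supp1 (rho : R -> R) M :
  (forall k, smooth1N k rho) -> supp1 M rho -> (\int[leb1]_t rho t)%R = 0 ->
  exists eta, [/\ forall t : R, is_derive t (1 : R) eta (rho t),
    forall k, smooth1N k eta & supp1 M eta].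
Proof.
move=> sm sr r0.
have cr : continuous rho := smooth1N_continuous (sm 0).
have ir := integrable_supp1 cr sr.
pose eta (x : R) := (\int[leb1]_(t in [set` `]-oo, x]]) rho t)%R.
have de (t : R) : is_derive t (1 : R) eta (rho t).
  have iu : leb1.-integrable [set` `]-oo, (t + 1)]] (EFin \o rho).
    exact: integrableS ir.
  have tt : t < t + 1 by rewrite ltrDl.
  have [d e] : derivable eta t 1 /\ eta^`()%classic t = rho t.
    apply: (@continuous_FTC1 _ rho (BInfty _ true) t (t + 1) tt iu); [exact: ltNyr|exact: cr].
  by apply: DeriveDef; rewrite -?derive1E.
exists eta; split => //.
  move=> [|k]; first exact: is_derive_continuous de.
  by split; [exact: is_derive_continuous de|exists rho].
move=> t ht; have [tM|Mt] := ltP t (- M).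
  rewrite /eta /Rintegral (eq_integral (fun=> 0%E)) ?integral0// => s.
  rewrite inE/= in_itv/= => st; rewrite sr// => /andP[Ms _].
  by have := lt_le_trans tM Ms; rewrite ltNge st.
have {ht} : M < t by rewrite ltNge; apply: contra_notN ht => ->; rewrite Mt.
move=> Mt'; rewrite -r0 /eta /Rintegral [in LHS]integral_mkcond; congr fine.
apply: eq_integral => s _; rewrite patchE; case: ifPn => //.
rewrite notin_setE/= in_itv/= => /negP; rewrite -ltNge => ts.
by rewrite sr// => /andP[_ sM]; have := lt_trans Mt' ts; rewrite ltNge sM.
Qed.

Lemma integral_bump1_gt0 : 0 < (\int[leb1]_t bump1 (0 : R) 1 0 t)%R.
Proof.
have cb : continuous (@bump1 R 0 1 0) := smooth1N_continuous (smooth1N_bump1 0 _ _ _).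
have sb : supp1 1 (@bump1 R 0 1 0).
  move=> t ht; apply: bump1_out; apply: contra_not ht => /andP[h1 h2]; apply/andP; split; lra.
have ib := integrable_supp1 cb sb.
rewrite lt_def; apply/andP; split; last by apply: Rintegral_ge0 => t _; exact: bump1_ge0.
apply/eqP => b0.
have : ae_eq leb1 setT (fun t => (bump1 (0 : R) 1 0 t)%:E) (cst 0%E).
  apply/ae_eq_integral_abs => //; first by apply/measurable_EFinP; exact: continuous_measurable_fun.
  under eq_integral do rewrite gee0_abs ?lee_fin ?bump1_ge0//.
  by rewrite -[LHS]fineK ?integrable_fin_num//; move: b0; rewrite /Rintegral => ->.
move=> [N [mN N0 hN]].
have : (leb1 `]0%R, 1%R[%classic <= leb1 N)%E.
  apply: le_measure; rewrite ?inE//.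
  move=> t /=; rewrite in_itv/= => t01; apply: hN => /= /(_ I) [] /eqP.
  by rewrite gt_eqF// bump1_gt0.
rewrite N0 lebesgue_measure_itv/= lte_fin ltr01 oppr0 adde0 lee_fin.
by rewrite ler10.
Qed.

End antiderivative.

Section weak_gradient_zero.
Context {R : realType} {n : nat}.
Local Notation leb := (@lebesgue_rV R n).
Local Notation leb1 := (@lebesgue_measure R).
Local Notation e_ i := (delta_mx ord0 i : 'rV[R]_n).
Implicit Types rho : 'I_n -> R -> R.

Lemma has_partial_indep i (F : 'rV[R]_n -> R) :
  (forall s x, F (s *: e_ i + x) = F x) -> has_partial i F (fun=> 0).
Proof.
move=> h x.
have d : is_derive (0 : R) (1 : R) (fun s : R => F (s *: e_ i + x)) 0.
  rewrite (_ : (fun _ => _) = cst (F x)); last by apply/funext => s; rewrite h.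
  exact: is_derive_cst.
have [dh eh] := d.
split; first exact/derivable1P.
by rewrite -[RHS]eh -[in LHS](add0r x) -[in LHS](scale0r (e_ i)) -derive_line.
Qed.

Definition prodf rho (x : 'rV[R]_n) : R := \prod_i rho i (x ord0 i).

Definition smooth_supp_factors M rho := forall i, (forall k, smooth1N k (rho i)) /\ supp1 M (rho i).

Definition replace_factor rho i (sigma : R -> R) j := if j == i then sigma else rho j.

Lemma test_prodf M rho : smooth_supp_factors M rho -> test_function (prodf rho).
Proof.
move=> h; apply: (@test_prod _ _ rho M).
  by move=> i; have [] := h i.
by move=> i; have [] := h i.
Qed.

Lemma prodf_replace rho i sigma x :
  prodf (replace_factor rho i sigma) x = sigma (x ord0 i) * \prod_(j | j != i) rho j (x ord0 j).
Proof.
rewrite /prodf (bigD1 i)//= /replace_factor eqxx; congr (_ * _).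
by apply: eq_bigr => j /negbTE ->.
Qed.

Lemma prodfE i rho x :
  prodf rho x = rho i (x ord0 i) * \prod_(j | j != i) rho j (x ord0 j).
Proof. by rewrite /prodf (bigD1 i). Qed.

Lemma partial_prodf_replace rho i (eta eta' : R -> R) x :
  (forall t : R, is_derive t (1 : R) eta (eta' t)) ->
  partial i (prodf (replace_factor rho i eta)) x = prodf (replace_factor rho i eta') x.
Proof.
move=> de; rewrite (_ : prodf _ = fun x => eta (x ord0 i) * \prod_(j | j != i) rho j (x ord0 j)); last first.
  by apply/funext => y; rewrite prodf_replace.
have h1 : has_partial i (fun x => eta (x ord0 i)) (fun x => eta' (x ord0 i) * (i == i)%:R).
  exact: (has_partial_comp (fun x => de (x ord0 i)) (has_partial_coord i i)).
have h2 : has_partial i (fun x : 'rV[R]_n => \prod_(j | j != i) rho j (x ord0 j)) (fun=> 0).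
  apply: has_partial_indep => s y; apply: eq_bigr => j /negbTE ji.
  by rewrite rV_lineE ji mulr0 add0r.
by rewrite (has_partialE (has_partialM h1 h2)) prodf_replace eqxx mulr1 mulr0 addr0.
Qed.

Lemma smooth_supp_replace M rho i sigma : smooth_supp_factors M rho -> (forall k, smooth1N k sigma) -> supp1 M sigma ->
  smooth_supp_factors M (replace_factor rho i sigma).
Proof. by move=> gr h1 h2 j; rewrite /replace_factor; case: eqP. Qed.

Section pairing.
Variable g : 'rV[R]_n -> R.
Hypotheses (lg : locally_integrable_rV g)
  (g0 : forall i phi, test_function phi -> (\int[leb]_x (g x * partial i phi x)%:E = 0)%E).

Let T rho := (\int[leb]_x (g x * prodf rho x))%R.

Let integ M rho : smooth_supp_factors M rho -> leb.-integrable setT (EFin \o (fun x => g x * prodf rho x)).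
Proof. by move=> /test_prodf; exact: locally_integrableM_test. Qed.

(** The function rho_i - c sigma has zero integral, hence is the derivative of a compactly supported
    smooth eta. Placing eta in the i-th slot gives a test function whose i-th derivative is
    annihilated by g. *)
Lemma pairing_replace M rho i sigma (c : R) : smooth_supp_factors M rho ->
  (forall k, smooth1N k sigma) -> supp1 M sigma ->
  (\int[leb1]_t rho i t)%R = c * (\int[leb1]_t sigma t)%R ->
  T rho = c * T (replace_factor rho i sigma).
Proof.
move=> gr s1 s2 hc; have [r1 r2] := gr i.
pose tau t := rho i t + - c * sigma t.
have t1 k : smooth1N k tau.
  by apply: smooth1ND => //; apply: smooth1NM => //; exact: smooth1N_cst.
have t2 : supp1 M tau by move=> t ht; rewrite /tau r2// s2// mulr0 addr0.
have ir := integrable_supp1 (smooth1N_continuous (r1 0)) r2.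
have is_ := integrable_supp1 (smooth1N_continuous (s1 0)) s2.
have t0 : (\int[leb1]_t tau t)%R = 0.
  rewrite RintegralD//; last first.
    rewrite (_ : EFin \o _ = (fun t => (- c)%:E * (EFin \o sigma) t)%E)//.
    exact: integrableZl.
  by rewrite RintegralZl// hc mulNr subrr.
have [eta [e1 e2 e3]] := antiderivative_supp1 t1 t2 t0.
have ge := smooth_supp_replace i gr e2 e3; have gt := smooth_supp_replace i gr t1 t2; have gs := smooth_supp_replace i gr s1 s2.
have : T (replace_factor rho i tau) = 0.
  rewrite /T /Rintegral -[RHS]/(fine 0%E) -(g0 i (test_prodf ge)); congr fine.
  by apply: eq_integral => x _; rewrite (partial_prodf_replace _ _ _ e1).
have -> : T (replace_factor rho i tau) = T rho - c * T (replace_factor rho i sigma).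
  rewrite /T -RintegralZl//; last exact: integ gs.
  rewrite -RintegralB//; [|exact: integ gr|]; last first.
    rewrite (_ : EFin \o _ = (fun x => c%:E * (EFin \o (fun x => g x * prodf (replace_factor rho i sigma) x)%R) x)%E)//.
    by apply: integrableZl => //; exact: integ gs.
  apply: eq_Rintegral => x _; rewrite !prodf_replace (prodfE i) /tau.
  by move: (\prod_(j | _) _) => q; ring.
by move=> /eqP; rewrite subr_eq0 => /eqP.
Qed.

Let rho0 := @bump1 R 0 1 0.
Let I0 := (\int[leb1]_t rho0 t)%R.

(** Replacing the factors one at a time by a fixed bump shows that the pairing with a product
    depends only on the integrals of its factors, up to one constant attached to g. *)
Lemma pairing_prod M rho : 1 <= M -> smooth_supp_factors M rho ->
  T rho = (\prod_i ((\int[leb1]_t rho i t)%R / I0)) * T (fun=> rho0).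
Proof.
move=> M1 gr.
have s1 k : smooth1N k rho0 by exact: smooth1N_bump1.
have s2 : supp1 M rho0.
  move=> t ht; apply: bump1_out; apply: contra_not ht => /andP[h1 h2]; apply/andP; split; lra.
(* The induction runs over the list s of coordinates already replaced; uniqueness of its entries
   ensures that the next factor is still the original one. *)
pose mix (s : seq 'I_n) j := if j \in s then rho0 else rho j.
have gm s : smooth_supp_factors M (mix s) by move=> j; rewrite /mix; case: ifP.
suff h s : uniq s -> T rho = (\prod_(i <- s) ((\int[leb1]_t rho i t)%R / I0)) * T (mix s).
  rewrite (h _ (index_enum_uniq _)); congr (_ * T _).
  by apply/funext => j; rewrite /mix mem_index_enum.
elim: s => [_|i s IH /= /andP[is_ us]].
  by rewrite big_nil mul1r; congr T; apply/funext.
rewrite (IH us) big_cons mulrAC mulrC; congr (_ * _).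
rewrite [LHS](@pairing_replace M _ i rho0 ((\int[leb1]_t rho i t)%R / I0)) => //.
  congr (_ * T _); apply/funext => j; rewrite /replace_factor /mix in_cons.
  by case: eqP.
rewrite /mix (negbTE is_) divfK// gt_eqF//; exact: integral_bump1_gt0.
Qed.

End pairing.

Lemma locally_integrable_cst (c : R) : @locally_integrable_rV R n (fun=> c).
Proof.
move=> K cK; have mK : measurable K.
  by apply: closed_measurable_rV; apply: compact_closed => //; exact: norm_hausdorff.
have /compact_bounded[M [_ hM]] := cK.
apply: measurable_bounded_integrable => //.
- apply: le_lt_trans (lebesgue_rV_box_lty n (M + 1)); apply: le_measure; rewrite ?inE//.
    exact: measurable_box.
  move=> x Kx i; rewrite -ler_norml; apply: (@le_trans _ _ `|x|).
    exact: norm_coord_le.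
  by apply: hM => //; rewrite ltrDl.
- exists `|c|; split; first by rewrite num_real.
  by move=> y hy x _; exact: ltW.
Qed.

(** By [pairing_prod], g and the constant 1 have proportional pairings with all products of
    one-variable bumps. The ratio c is the quotient of the two pairings with the reference bump, and
    such products suffice to identify g with c almost everywhere. *)
Theorem weak_gradient_eq0 (g : 'rV[R]_n -> R) : locally_integrable_rV g ->
  (forall i phi, test_function phi -> (\int[leb]_x (g x * partial i phi x)%:E = 0)%E) ->
  exists c, {ae leb, forall x, g x = c}.
Proof.
move=> lg g0; pose rho0 : 'I_n -> R -> R := fun=> @bump1 R 0 1 0.
pose T (h : 'rV[R]_n -> R) rho := (\int[leb]_x (h x * prodf rho x))%R.
have l1 := locally_integrable_cst 1.
have g1 i phi : test_function phi -> (\int[leb]_x ((fun=> 1%R) x * partial i phi x)%:E = 0)%E.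
  by move=> tp; under eq_integral do rewrite mul1r; exact: integral_partial_test.
have gb (a b : 'I_n -> R) k : smooth_supp_factors (Num.max 1 (bump_radius a b)) (fun i => bump1 (a i) (b i) k).
  move=> i; split; first by move=> m; exact: smooth1N_bump1.
  move=> t ht; apply: bump1_radius; apply: contra_not ht => /andP[h1 h2].
  have : bump_radius a b <= Num.max 1 (bump_radius a b) by rewrite le_max lexx orbT.
  by move=> h3; apply/andP; split; lra.
have M1 (a b : 'I_n -> R) : 1 <= Num.max 1 (bump_radius a b) by rewrite le_max lexx.
have ib h a b k : locally_integrable_rV h ->
    leb.-integrable setT (EFin \o (fun x => h x * prodf (fun i => bump1 (a i) (b i) k) x)).
  by move=> lh; apply: locally_integrableM_test lh (test_prodf (gb a b k)).
(* If this pairing were 0, the constant 1 would be orthogonal to every bump, hence zero almost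
   everywhere, although the unit cube has measure 1. *)
have T1 : T (fun=> 1) rho0 != 0.
  apply/eqP => T0.
  have : {ae leb, forall x, (1 : R) = 0}.
    apply: (bump_eq0_ae l1) => a b k.
    rewrite -[LHS]fineK; last first.
      by apply: integrable_fin_num => //; exact: (ib (fun=> 1) a b k l1).
    congr EFin; have := pairing_prod l1 g1 (M1 a b) (gb a b k).
    by rewrite -/(T _ rho0) T0 mulr0.
  move=> [N [mN N0 hN]].
  have : (leb (box (2^-1 : R)) <= leb N)%E.
    apply: le_measure; rewrite ?inE//; first exact: measurable_box.
    by move=> x _; apply: hN => /= /eqP; rewrite oner_eq0.
  have -> : leb (box (2^-1 : R)) = (1%:E : \bar R).
    rewrite [X in _ = X%:E](_ : _ = \prod_(i < n) (2^-1 - - 2^-1)).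
      by apply: (@lebesgue_rV_box R n (fun=> - 2^-1) (fun=> 2^-1)) => i; lra.
    rewrite big1// => i _; lra.
  by rewrite N0 lee_fin ler10.
pose c := T g rho0 / T (fun=> 1) rho0; exists c.
have lc := locally_integrable_cst c.
suff : {ae leb, forall x, g x - c = 0}.
  by apply: filterS => x /eqP; rewrite subr_eq0 => /eqP.
apply: bump_eq0_ae; first exact: locally_integrableB.
move=> a b k.
under eq_integral do rewrite mulrBl EFinB.
rewrite integralB//; [|exact: ib|exact: (ib (fun=> c))].
rewrite -[X in (X - _)%E]fineK; last by apply: integrable_fin_num => //; exact: ib.
rewrite -[X in (_ - X)%E]fineK; last by apply: integrable_fin_num => //; exact: (ib (fun=> c)).
rewrite -EFinB; congr EFin.
have e1 := pairing_prod lg g0 (M1 a b) (gb a b k).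
have e2 := pairing_prod l1 g1 (M1 a b) (gb a b k).
have -> : fine (\int[leb]_x (c * bump a b k x)%:E) =
    c * (\int[leb]_x ((fun=> 1%R) x * prodf (fun i => bump1 (a i) (b i) k) x))%R.
  rewrite -RintegralZl//; last exact: ib.
  by congr fine; apply: eq_integral => x _; rewrite mul1r.
rewrite e2 -[fine _]/(\int[leb]_x (g x * prodf (fun i => bump1 (a i) (b i) k) x))%R e1.
rewrite -/(T _ rho0) -/(T _ rho0) mulrCA /c divfK// subrr//.
Qed.

End weak_gradient_zero.

(** * Semigroups in a complete semi-inner product space *)

Section psd_form.
Context {R : realType} {V : lmodType R} (ip : V -> V -> R).
Hypotheses (ipC : forall x y, ip x y = ip y x)
  (ipDl : forall x y z, ip (x + y) z = ip x z + ip y z)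
  (ipZl : forall a x y, ip (a *: x) y = a * ip x y)
  (ip_ge0 : forall x, 0 <= ip x x).
Implicit Types (x y z : V) (a : R).

Lemma ipDr x y z : ip z (x + y) = ip z x + ip z y.
Proof. by rewrite ipC ipDl !(ipC z). Qed.
Lemma ipZr a x y : ip y (a *: x) = a * ip y x.
Proof. by rewrite ipC ipZl (ipC y). Qed.
Lemma ipNl x y : ip (- x) y = - ip x y.
Proof. by rewrite -scaleN1r ipZl mulN1r. Qed.
Lemma ipNr x y : ip y (- x) = - ip y x.
Proof. by rewrite ipC ipNl ipC. Qed.
Lemma ip0l y : ip 0 y = 0.
Proof. by rewrite -(scale0r 0) ipZl mul0r. Qed.

Definition nrm x := Num.sqrt (ip x x).

Lemma nrm_ge0 x : 0 <= nrm x. Proof. exact: sqrtr_ge0. Qed.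
Lemma nrm_sqr x : nrm x ^+ 2 = ip x x. Proof. exact: sqr_sqrtr. Qed.
Lemma nrm0 : nrm 0 = 0. Proof. by rewrite /nrm ip0l sqrtr0. Qed.
Lemma nrmZ a x : nrm (a *: x) = `|a| * nrm x.
Proof. by rewrite /nrm ipZl ipZr mulrA -expr2 sqrtrM ?sqr_ge0// sqrtr_sqr. Qed.
Lemma nrmN x : nrm (- x) = nrm x.
Proof. by rewrite /nrm ipNl ipNr opprK. Qed.
Lemma nrmB x y : nrm (x - y) = nrm (y - x).
Proof. by rewrite -nrmN opprB. Qed.

(** The form is only semi-definite, so the case of a null y is separate: if <x, y> were nonzero, the
    chosen t would make the square of x + t y equal to -1. Otherwise expand the square of <y, y> x -
    <x, y> y. *)
Lemma ip_sqr_le x y : ip x y ^+ 2 <= ip x x * ip y y.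
Proof.
have [y0|y0] := eqVneq (ip y y) 0.
  rewrite y0 mulr0 -[leRHS](expr0n _ 2) /=.
  have [->|xy0] := eqVneq (ip x y) 0; first by rewrite expr0n.
  exfalso; pose t := - (ip x x + 1) / (2 * ip x y).
  have := ip_ge0 (x + t *: y).
  rewrite ipDl !ipDr !ipZl !ipZr y0 !mulr0 addr0 (ipC y x).
  have -> : ip x x + t * ip x y + t * ip x y = -1 by rewrite /t; field.
  by rewrite oppr_ge0 ler10.
have yp : 0 < ip y y by rewrite lt_def y0 ip_ge0.
have := ip_ge0 (ip y y *: x - ip x y *: y).
rewrite ipDl !ipDr !ipNl !ipNr !ipZl !ipZr (ipC y x).
have -> : ip y y * (ip y y * ip x x) - ip y y * (ip x y * ip x y) +
   (- (ip x y * (ip y y * ip x y)) - - (ip x y * (ip x y * ip y y))) =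
   ip y y * (ip x x * ip y y - ip x y ^+ 2) by ring.
by rewrite pmulr_rge0// subr_ge0.
Qed.

Lemma cauchy_schwarz x y : `|ip x y| <= nrm x * nrm y.
Proof.
rewrite -(@ler_pXn2r _ 2) ?nnegrE ?mulr_ge0 ?nrm_ge0//.
by rewrite exprMn !nrm_sqr real_normK ?num_real// ip_sqr_le.
Qed.

Lemma nrmD x y : nrm (x + y) <= nrm x + nrm y.
Proof.
rewrite -(@ler_pXn2r _ 2) ?nnegrE ?addr_ge0 ?nrm_ge0//.
rewrite sqrrD !nrm_sqr ipDl !ipDr (ipC y x).
have := cauchy_schwarz x y; have := ler_norm (ip x y).
rewrite -mulr_natl; lra.
Qed.

Lemma nrm_triangle x y z : nrm (x - z) <= nrm (x - y) + nrm (y - z).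
Proof. by apply: le_trans (nrmD _ _); rewrite addrA subrK. Qed.

Lemma nrm_le_dist x y : nrm x <= nrm y + nrm (x - y).
Proof. by apply: le_trans (nrmD _ _); rewrite addrC subrK. Qed.

Lemma nrm_eq0_ip x y : nrm x = 0 -> ip x y = 0.
Proof.
move=> x0; apply/eqP; rewrite -normr_eq0 eq_le normr_ge0 andbT.
by apply: le_trans (cauchy_schwarz _ _) _; rewrite x0 mul0r.
Qed.

Lemma nrm_dist0 x y : nrm (x - y) = 0 -> nrm x = nrm y.
Proof.
move=> h; apply/eqP; rewrite eq_le.
have := nrm_le_dist x y; have := nrm_le_dist y x; rewrite nrmB h !addr0 => -> ->.
by [].
Qed.

Lemma ip_dist0 x y z : nrm (x - y) = 0 -> ip x z = ip y z.
Proof. by move=> /nrm_eq0_ip => /(_ z); rewrite ipDl ipNl => /eqP; rewrite subr_eq0 => /eqP. Qed.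

Lemma nrm_dist0_trans x y z : nrm (x - y) = 0 -> nrm (y - z) = 0 -> nrm (x - z) = 0.
Proof.
move=> h1 h2; apply/eqP; rewrite eq_le nrm_ge0 andbT.
by apply: le_trans (nrm_triangle x y z) _; rewrite h1 h2 addr0.
Qed.

Lemma nrm_dist0D x y x' y' : nrm (x - y) = 0 -> nrm (x' - y') = 0 -> nrm (x + x' - (y + y')) = 0.
Proof.
move=> h1 h2; apply/eqP; rewrite eq_le nrm_ge0 andbT opprD addrACA.
by apply: le_trans (nrmD _ _) _; rewrite h1 h2 addr0.
Qed.

Lemma nrm_dist0Z a x y : nrm (x - y) = 0 -> nrm (a *: x - a *: y) = 0.
Proof. by move=> h; rewrite -scalerBr nrmZ h mulr0. Qed.

(** The derivative is stated in epsilon-delta form because [V] is merely a module and [ip] puts no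
    topology on it; it is determined up to null vectors. *)
Definition curve_der (u : R -> V) (t : R) (v : V) := forall e, 0 < e ->
  exists2 d, 0 < d & forall h : R, 0 < `|h| < d -> nrm (h^-1 *: (u (t + h) - u t) - v) <= e.

Lemma is_derive_ip (u w : R -> V) (t : R) (u' w' : V) :
  curve_der u t u' -> curve_der w t w' ->
  is_derive t (1 : R) (fun s => ip (u s) (w s)) (ip u' (w t) + ip (u t) w').
Proof.
move=> du dw.
have L : (h^-1 *: (((fun s => ip (u s) (w s)) \o shift t) (h *: (1 : R)) - ip (u t) (w t)))
    @[h --> (0 : R)^'] --> ip u' (w t) + ip (u t) w'.
  apply/cvgrPdist_le => e e0.
  (* K gathers the coefficients of e1 in the three error terms of the product rule, the last one
     being h <X, Y>. Keeping e1 <= 1 bounds the difference quotients X and Y by the norms of u' and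
     w' plus 1. *)
  pose K := nrm (w t) + nrm (u t) + (nrm u' + 1) * (nrm w' + 1) + 1.
  have K0 : 0 < K by rewrite /K ltr_wpDl// !addr_ge0 ?mulr_ge0 ?addr_ge0 ?nrm_ge0.
  pose e1 := Num.min 1 (e / K).
  have e10 : 0 < e1 by rewrite lt_min ltr01 divr_gt0.
  have e1K : e1 * K <= e by rewrite -ler_pdivlMr// ge_min lexx orbT.
  have e11 : e1 <= 1 by rewrite ge_min lexx.
  have [d1 d10 h1] := du _ e10; have [d2 d20 h2] := dw _ e10.
  near=> h.
  have hn0 : 0 < `|h| by rewrite normr_gt0; near: h; exact: nbhs_dnbhs_neq.
  have hd1 : `|h| < d1 by near: h; exact: dnbhs0_lt.
  have hd2 : `|h| < d2 by near: h; exact: dnbhs0_lt.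
  have he : `|h| <= e1 by near: h; exact: dnbhs0_le.
  have {h1} := h1 h; rewrite hn0 hd1 => /(_ isT).
  have {h2} := h2 h; rewrite hn0 hd2 => /(_ isT).
  set X := h^-1 *: (u (t + h) - u t); set Y := h^-1 *: (w (t + h) - w t) => hY hX.
  have h0 : h != 0 by rewrite -normr_gt0.
  rewrite /= -[h *: 1]/(h * 1) mulr1 (addrC h t) -[_ *: _]/(_ * _).
  have eu : u (t + h) = u t + h *: X by rewrite /X scalerA divff// scale1r addrCA subrr addr0.
  have ew : w (t + h) = w t + h *: Y by rewrite /Y scalerA divff// scale1r addrCA subrr addr0.
  have -> : ip u' (w t) + ip (u t) w' - h^-1 * (ip (u (t + h)) (w (t + h)) - ip (u t) (w t)) =
      - (ip (X - u') (w t) + ip (u t) (Y - w') + h * ip X Y).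
    rewrite eu ew !(ipDl, ipDr, ipNl, ipNr, ipZl, ipZr).
    by field.
  rewrite normrN.
  have nX : nrm X <= nrm u' + 1 by have := nrm_le_dist X u'; lra.
  have nY : nrm Y <= nrm w' + 1 by have := nrm_le_dist Y w'; lra.
  apply: le_trans (ler_normD _ _) _.
  apply: le_trans (lerD (ler_normD _ _) (lexx _)) _.
  have b1 : `|ip (X - u') (w t)| <= e1 * nrm (w t).
    by apply: le_trans (cauchy_schwarz _ _) _; rewrite ler_wpM2r ?nrm_ge0.
  have b2 : `|ip (u t) (Y - w')| <= e1 * nrm (u t).
    by apply: le_trans (cauchy_schwarz _ _) _; rewrite mulrC ler_wpM2r ?nrm_ge0.
  have b3 : `|h * ip X Y| <= e1 * ((nrm u' + 1) * (nrm w' + 1)).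
    rewrite normrM; apply: ler_pM => //.
    by apply: le_trans (cauchy_schwarz _ _) _; apply: ler_pM; rewrite ?nrm_ge0.
  apply: le_trans e1K; rewrite /K !mulrDr mulr1.
  have := ltW e10; lra.
apply: DeriveDef; first by apply/cvg_ex; exists (ip u' (w t) + ip (u t) w').
exact: cvg_lim L.
Unshelve. all: by end_near. Qed.

End psd_form.

Section halfline.
Context {R : realType}.

Lemma halfline_continuous (f f' : R -> R) :
  (forall t : R, 0 < t -> is_derive t (1 : R) f (f' t)) -> f t @[t --> 0^'+] --> f 0 ->
  {within `[0, +oo[, continuous f}.
Proof.
move=> df f0; apply/continuous_within_itvcyP; split => // t.
rewrite in_itv/= andbT => t0; apply: differentiable_continuous; apply/derivable1_diffP.
by have [] := df t t0.
Qed.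

Lemma halfline_nincr (f f' : R -> R) :
  (forall t : R, 0 < t -> is_derive t (1 : R) f (f' t)) -> f t @[t --> 0^'+] --> f 0 ->
  (forall t, 0 < t -> f' t <= 0) -> forall s t, 0 <= s -> s <= t -> f t <= f s.
Proof.
move=> df f0 f'0; apply: ler0_derive1_nincry.
- by move=> t; rewrite in_itv/= andbT => t0; have [] := df t t0.
- move=> t; rewrite in_itv/= andbT => t0; rewrite derive1E.
  by have [_ ->] := df t t0; exact: f'0.
- exact: halfline_continuous df f0.
Qed.

End halfline.

(** * Orbits of a strongly continuous semigroup *)

Section semigroup.
Context {R : realType} {V : lmodType R} (ip : V -> V -> R).
Hypotheses (ipC : forall x y, ip x y = ip y x)
  (ipDl : forall x y z, ip (x + y) z = ip x z + ip y z)
  (ipZl : forall a x y, ip (a *: x) y = a * ip x y)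
  (ip_ge0 : forall x, 0 <= ip x x).
Local Notation nrm := (nrm ip).
Hypothesis complete : forall u : nat -> V,
  (forall e, 0 < e -> exists N, forall m, (N <= m)%N -> nrm (u m - u N) <= e) ->
  exists x, forall e, 0 < e -> exists N, forall m, (N <= m)%N -> nrm (u m - x) <= e.
Variables (P : R -> V -> V) (A : V -> V -> Prop).
Hypotheses (P_lin : forall t a x y, 0 <= t -> nrm (P t (a *: x + y) - (a *: P t x + P t y)) = 0)
  (P_bnd : forall t, 0 <= t -> exists C, forall x, nrm (P t x) <= C * nrm x)
  (P_0 : forall x, nrm (P 0 x - x) = 0)
  (P_D : forall s t x, 0 <= s -> 0 <= t -> nrm (P (s + t) x - P s (P t x)) = 0)
  (P_cont : forall x e, 0 < e -> exists2 d, 0 < d & forall t, 0 < t < d -> nrm (P t x - x) <= e)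
  (P_gen : forall x y, A x y <-> forall e, 0 < e ->
     exists2 d, 0 < d & forall t, 0 < t < d -> nrm (t^-1 *: (P t x - x) - y) <= e).
Implicit Types (x y : V) (t s : R).

Let nrm_ge0 := nrm_ge0 ip.
Let nrmD := nrmD ipC ipDl ipZl ip_ge0.
Let nrmZ := nrmZ ipC ipZl.
Let nrmB := nrmB ipC ipZl.
Let nrmN := nrmN ipC ipZl.
Let nrm_triangle := nrm_triangle ipC ipDl ipZl ip_ge0.
Let nrm_le_dist := nrm_le_dist ipC ipDl ipZl ip_ge0.
Let nrm_dist0 := nrm_dist0 ipC ipDl ipZl ip_ge0.
Let nrm_dist0_trans := nrm_dist0_trans ipC ipDl ipZl ip_ge0.
Let nrm_dist0D := nrm_dist0D ipC ipDl ipZl ip_ge0.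
Let nrm_dist0Z := nrm_dist0Z ipC ipZl.

Let dist0_sym x y : nrm (x - y) = 0 -> nrm (y - x) = 0.
Proof. by rewrite nrmB. Qed.

Let dist_refl x : nrm (x - x) = 0.
Proof. by rewrite subrr nrm0. Qed.

Lemma semigroup_ind0 t : 0 <= t -> nrm (P t 0) = 0.
Proof.
move=> t0; have [C hC] := P_bnd t0.
by apply/eqP; rewrite eq_le nrm_ge0 andbT; have := hC 0; rewrite nrm0// mulr0.
Qed.

Lemma semigroupZ t a x : 0 <= t -> nrm (P t (a *: x) - a *: P t x) = 0.
Proof.
move=> t0; have := P_lin a x 0 t0; rewrite addr0 => h.
apply: nrm_dist0_trans h _; rewrite addrAC subrr add0r; exact: semigroup_ind0.
Qed.

Lemma semigroupB t x y : 0 <= t -> nrm (P t (x - y) - (P t x - P t y)) = 0.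
Proof.
move=> t0; have := P_lin (-1) y x t0.
by rewrite !scaleN1r !(addrC (- _)).
Qed.

Definition opnorm t := sup [set nrm (P t x) | x in [set x | nrm x <= 1]].

Let opn_has_sup t : 0 <= t -> has_sup [set nrm (P t x) | x in [set x | nrm x <= 1]].
Proof.
move=> t0; split; first by exists (nrm (P t 0)); exists 0 => //=; rewrite nrm0.
have [C hC] := P_bnd t0; exists `|C| => _ [x /= x1 <-].
apply: le_trans (hC x) _; apply: (@le_trans _ _ (`|C| * nrm x)).
  by rewrite ler_wpM2r ?ler_norm.
by rewrite -[leRHS]mulr1 ler_wpM2l.
Qed.

Lemma opnorm_ge0 t : 0 <= t -> 0 <= opnorm t.
Proof.
move=> t0; apply: le_trans (nrm_ge0 (P t 0)) _.
by apply: sup_upper_bound; [exact: opn_has_sup|exists 0 => //=; rewrite nrm0].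
Qed.

Lemma opnorm_le t x : 0 <= t -> nrm (P t x) <= opnorm t * nrm x.
Proof.
move=> t0; have [x0|x0] := eqVneq (nrm x) 0.
  by have [C hC] := P_bnd t0; have := hC x; rewrite x0 !mulr0.
have xp : 0 < nrm x by rewrite lt_def x0 nrm_ge0.
have h : nrm (P t ((nrm x)^-1 *: x)) <= opnorm t.
  apply: sup_upper_bound; first exact: opn_has_sup.
  exists ((nrm x)^-1 *: x) => //=.
  by rewrite nrmZ ger0_norm ?invr_ge0// mulVf.
rewrite (nrm_dist0 (semigroupZ (nrm x)^-1 x t0)) nrmZ ger0_norm ?invr_ge0// in h.
by rewrite mulrC -ler_pdivrMl.
Qed.

Lemma opnorm_norming t : 0 <= t -> exists2 x, nrm x <= 1 & 3 / 4 * opnorm t <= nrm (P t x).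
Proof.
move=> t0; have [n0|n0] := eqVneq (opnorm t) 0.
  by exists 0; rewrite ?nrm0// n0 mulr0.
have np : 0 < opnorm t by rewrite lt_def n0 opnorm_ge0.
have [_ [x /= x1 <-] h] := sup_adherent (divr_gt0 np (ltr0n R 4)) (opn_has_sup t0).
by exists x => //; move: h; rewrite -/(opnorm t) => h; lra.
Qed.

(** Since 2y = (x + y) - (x - y), at least one of the two signs gives an image no smaller than that
    of y. *)
Let halfD t x y : 0 <= t -> 2 * nrm (P t y) <= nrm (P t (x + y)) + nrm (P t (x - y)).
Proof.
move=> t0.
have h1 : nrm (P t (x + y) - (P t x + P t y)) = 0.
  by have := P_lin 1 x y t0; rewrite !scale1r.
have h2 := semigroupB x y t0.
have -> : 2 * nrm (P t y) = nrm ((P t x + P t y) - (P t x - P t y)).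
  rewrite (_ : P t x + P t y - (P t x - P t y) = 2 *: P t y) ?nrmZ ?normr_nat//.
  by rewrite scaler_nat mulr2n opprB addrAC addrCA subrr addr0.
rewrite (nrm_dist0 h1) (nrm_dist0 h2).
by apply: le_trans (nrmD _ _) _; rewrite nrmN.
Qed.

(* Sokal's gliding hump: if the operator norms were unbounded near 0, adding
   or subtracting 3^-k times nearly norming vectors would yield a vector at
   which the semigroup is unbounded near 0. *)
Lemma semigroup_locally_bounded : exists C d, [/\ 1 <= C, 0 < d &
  forall t x, 0 <= t <= d -> nrm (P t x) <= C * nrm x].
Proof.
apply: contrapT => hn.
(* The threshold is set for the final count. With r_k = 3^-k, the hump contributes at least 3/4 r_k
   times the operator norm at t_k, the later corrections at most 1/2 r_k times it, and the remaining
   quarter must exceed k. *)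
have step k : exists t, [/\ 0 <= t, t <= k.+1%:R^-1 & 4 * 3 ^+ k * k%:R < opnorm t].
  apply: contrapT => h; apply: hn.
  exists (Num.max 1 (4 * 3 ^+ k * k%:R)), k.+1%:R^-1; split.
  - by rewrite le_max lexx.
  - by rewrite invr_gt0.
  move=> t x /andP[t0 tk]; apply: le_trans (opnorm_le x t0) _.
  rewrite ler_wpM2r// le_max; apply/orP; right; rewrite leNgt; apply/negP => ht.
  by apply: h; exists t.
have /(_ _)/cid-/all_sig[t ht] := step.
have t0 k : 0 <= t k by have [] := ht k.
have ex k : {x | nrm x <= 1 & 3 / 4 * opnorm (t k) <= nrm (P (t k) x)}.
  exact/cid2/opnorm_norming.
pose e k := s2val (ex k).
have e1 k : nrm (e k) <= 1 by rewrite /e; case: (ex k).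
have e2 k : 3 / 4 * opnorm (t k) <= nrm (P (t k) (e k)) by rewrite /e; case: (ex k).
pose r k : R := 3^-1 ^+ k.
have r0 k : 0 < r k by rewrite exprn_gt0// invr_gt0.
pose next k x := if r k * nrm (P (t k) (e k)) <= nrm (P (t k) (x + r k *: e k))
  then x + r k *: e k else x - r k *: e k.
pose u := fix u k := if k is k'.+1 then next k' (u k') else 0.
have uS k : u k.+1 = next k (u k) by [].
have un k : r k * nrm (P (t k) (e k)) <= nrm (P (t k) (u k.+1)).
  rewrite uS /next; case: ifPn => // /negbTE; rewrite leNgt => /negbFE h.
  have := halfD (u k) (r k *: e k) (t0 k).
  rewrite (nrm_dist0 (semigroupZ (r k) (e k) (t0 k))) nrmZ gtr0_norm//.
  lra.
have ud k : nrm (u k.+1 - u k) <= r k.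
  have h : nrm (r k *: e k) <= r k.
    by rewrite nrmZ gtr0_norm// -[leRHS]mulr1 ler_wpM2l// ltW.
  by rewrite uS /next; case: ifPn => _; rewrite addrAC subrr add0r ?nrmN.
have udd k m : nrm (u (k + m)%N - u k) <= 3 / 2 * (r k - r (k + m)%N).
  elim: m => [|m IH]; first by rewrite addn0 !subrr nrm0// mulr0.
  apply: le_trans (nrm_triangle _ (u (k + m)%N) _) _.
  rewrite addnS; have := ud (k + m)%N.
  have -> : r (k + m).+1 = 3^-1 * r (k + m)%N by rewrite /r exprS.
  lra.
have r_small eps : 0 < eps -> exists N, r N <= eps.
  move=> eps0.
  have /cvgr0Pnorm_le/(_ _ eps0)[N _ hN] : (r k @[k --> \oo] --> (0 : R)).
    by apply: cvg_expr; rewrite ger0_norm ?invr_ge0// invf_lt1// ltr1n.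
  by exists N; have := hN N (leqnn N); rewrite gtr0_norm.
have [x hx] : exists x, forall e, 0 < e -> exists N, forall m, (N <= m)%N -> nrm (u m - x) <= e.
  apply: complete => eps eps0.
  have [N hN] := r_small (eps / (3 / 2)) (divr_gt0 eps0 (divr_gt0 (ltr0n _ 3) (ltr0n _ 2))).
  exists N => m Nm; rewrite -(subnKC Nm); apply: le_trans (udd _ _) _.
  rewrite ler_pdivlMr in hN; last by lra.
  have := r0 (N + (m - N))%N; lra.
(* Summing the geometric tail gives 3/2 r_k; at index k+1 this is r_k / 2, strictly less than the
   hump. *)
have ux k : nrm (u k - x) <= 3 / 2 * r k.
  apply/ler_addgt0Pr => eps eps0; have [N hN] := hx _ eps0.
  have h1 := hN (maxn N k) (leq_maxl _ _).
  have h2 := udd k (maxn N k - k)%N; rewrite subnKC ?leq_maxr// in h2.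
  apply: le_trans (nrm_triangle _ (u (maxn N k)) _) _; rewrite nrmB.
  have := r0 (maxn N k); lra.
have grow k : k%:R < nrm (P (t k) x).
  have [_ _ hk] := ht k.
  have h1 := nrm_le_dist (P (t k) (u k.+1)) (P (t k) x).
  rewrite -(nrm_dist0 (semigroupB (u k.+1) x (t0 k))) in h1.
  have h2 := opnorm_le (u k.+1 - x) (t0 k).
  have h3 : opnorm (t k) * nrm (u k.+1 - x) <= opnorm (t k) * (r k / 2).
    apply: ler_wpM2l; first exact: opnorm_ge0.
    apply: le_trans (ux _) _; rewrite /r exprS; have := r0 k; rewrite /r; lra.
  have h4 := un k.
  have h5 : r k * (3 / 4 * opnorm (t k)) <= r k * nrm (P (t k) (e k)) by rewrite ler_wpM2l// ltW.
  have h6 : k%:R < r k / 4 * opnorm (t k).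
    rewrite -ltr_pdivrMl ?divr_gt0//; apply: le_lt_trans hk.
    by rewrite /r invfM invrK exprVn invrK [3 ^+ k * 4]mulrC.
  nra.
have [d d0 hd] := P_cont x ltr01.
have [k [hk1 hk2]] : exists k, k.+1%:R^-1 < d /\ nrm x + 1 <= k%:R.
  pose k1 := (Num.truncn d^-1).+1; pose k2 := (Num.truncn (nrm x + 1)).+1.
  exists (maxn k1 k2); split.
    rewrite invf_plt ?posrE//; apply: lt_le_trans (truncnS_gt _) _.
    by rewrite ler_nat (leq_trans (leq_maxl _ k2))// leqnSn.
  by apply: le_trans (ltW (truncnS_gt _)) _; rewrite ler_nat leq_maxr.
have [tk0 tk1 _] := ht k; have := grow k.
(* Strong continuity is stated for positive times only, so t_k = 0 is settled with [P_0]. *)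
move: tk0; rewrite le_eqVlt => /orP[/eqP t0k|t0k].
  by rewrite -t0k (nrm_dist0 (P_0 x)); lra.
have := hd (t k); rewrite t0k (le_lt_trans tk1 hk1) => /(_ isT).
have := nrm_le_dist (P (t k) x) x; lra.
Qed.

(** The interval is covered by finitely many steps of length d, each costing a factor C; C >= 1 lets
    shorter times share the bound. *)
Lemma semigroup_bounded_on T : exists2 C, 0 <= C &
  forall t x, 0 <= t <= T -> nrm (P t x) <= C * nrm x.
Proof.
have [C [d [C1 d0 hC]]] := semigroup_locally_bounded.
have C0 : 0 <= C := le_trans ler01 C1.
have h m t x : 0 <= t <= m%:R * d -> nrm (P t x) <= C ^+ m.+1 * nrm x.
  elim: m t x => [|m IH] t x /andP[t0 tm].
    by rewrite expr1; apply: hC; rewrite t0/=; move: tm; rewrite mul0r => /le_trans; apply; exact: ltW.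
  have [tm'|tm'] := leP t (m%:R * d).
    apply: (@le_trans _ _ (C ^+ m.+1 * nrm x)); first by apply: IH; rewrite t0.
    by rewrite ler_wpM2r// [leRHS]exprS ler_peMl// exprn_ge0.
  have s0 : 0 <= t - m%:R * d by rewrite subr_ge0 ltW.
  have m0 : 0 <= m%:R * d by rewrite mulr_ge0// ltW.
  have := P_D x s0 m0; rewrite subrK => /nrm_dist0 ->.
  rewrite exprS -mulrA.
  apply: le_trans (hC _ _ _) _.
    by rewrite s0/= lerBlDr; move: tm; rewrite -natr1 mulrDl mul1r addrC.
  rewrite ler_wpM2l//; apply: IH; by rewrite m0/=.
pose m := (Num.truncn (T / d)).+1.
exists (C ^+ m.+1); first exact: exprn_ge0.
move=> t x /andP[t0 tT]; apply: h; rewrite t0/=.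
apply: le_trans tT _; rewrite -ler_pdivrMr//; exact/ltW/truncnS_gt.
Qed.

(** P_t commutes with the difference quotients at 0, up to null vectors, and is bounded. *)
Lemma generator_semigroup t x y : 0 <= t -> A x y -> A (P t x) (P t y).
Proof.
move=> t0 /P_gen hx; apply/P_gen => e e0.
have [C0 hC0] := P_bnd t0.
have [C C0' hC] : exists2 C, 0 < C & forall x, nrm (P t x) <= C * nrm x.
  exists (`|C0| + 1); first by rewrite ltr_wpDl.
  move=> z; apply: le_trans (hC0 z) _; rewrite ler_wpM2r//.
  by apply: le_trans (ler_norm _) _; rewrite lerDl.
have [d d0 hd] := hx _ (divr_gt0 e0 C0'); exists d => // h /andP[h0 hd'].
have -> : nrm (h^-1 *: (P h (P t x) - P t x) - P t y) =
    nrm (P t (h^-1 *: (P h x - x) - y)).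
  apply: nrm_dist0; apply: dist0_sym.
  apply: nrm_dist0_trans (semigroupB _ _ t0) _.
  apply: nrm_dist0D; last exact: dist_refl.
  apply: nrm_dist0_trans (semigroupZ _ _ t0) _.
  apply: nrm_dist0Z; apply: nrm_dist0_trans (semigroupB _ _ t0) _.
  apply: nrm_dist0D; last exact: dist_refl.
  have q1 := P_D x t0 (ltW h0); have q2 := P_D x (ltW h0) t0.
  rewrite (addrC h t) in q2.
  exact: nrm_dist0_trans (dist0_sym q1) q2.
apply: le_trans (hC _) _; rewrite -ler_pdivlMl//.
by rewrite mulrC; apply: hd; rewrite h0.
Qed.

(** The right derivative is the generator at P_t x. For the left one, with k > 0, the error is
    P_(t-k) (k^-1 (P_k x - x) - y) + P_(t-k) (y - P_k y): the operator in front varies with k, which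
    is why a bound uniform over [0, t] is needed. *)
Lemma semigroup_curve_der t x y : 0 < t -> A x y -> curve_der ip (fun s => P s x) t (P t y).
Proof.
move=> t0 Axy e e0.
have [d1 d10 h1] := (P_gen _ _).1 (generator_semigroup (ltW t0) Axy) e e0.
have [C0 C00 hC0] := semigroup_bounded_on t.
pose C := C0 + 1; have Cp : 0 < C by rewrite ltr_wpDl.
have hC s z : 0 <= s <= t -> nrm (P s z) <= C * nrm z.
  by move=> /hC0 /le_trans; apply; rewrite ler_wpM2r// lerDl.
have e20 : 0 < e / (2 * C) by rewrite divr_gt0 ?mulr_gt0.
have [d2 d20 h2] := (P_gen _ _).1 Axy _ e20.
have [d3 d30 h3] := P_cont y e20.
exists (Num.min (Num.min d1 d2) (Num.min d3 t)); first by rewrite !lt_min d10 d20 d30.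
move=> h; rewrite !lt_min => /andP[hn0 /andP[/andP[hd1 hd2] /andP[hd3 ht]]].
have [h0|h0|h0] := ltgtP h 0; last by move: hn0; rewrite h0 normr0 ltxx.
- have [k kE] : exists k, h = - k by exists (- h); rewrite opprK.
  rewrite ltr0_norm// kE opprK in hn0 hd1 hd2 hd3 ht; rewrite {}kE {h h0}.
  have s0 : 0 <= t - k by rewrite subr_ge0 ltW.
  have st : t - k <= t by rewrite lerBlDr lerDl ltW.
  have Pk z : nrm (P t z - P (t - k) (P k z)) = 0.
    by have := P_D z s0 (ltW hn0); rewrite subrK.
  have -> : nrm ((- k)^-1 *: (P (t - k) x - P t x) - P t y) =
     nrm (P (t - k) (k^-1 *: (P k x - x) - y) + P (t - k) (y - P k y)).
    apply: nrm_dist0; rewrite invrN scaleNr -scalerN opprB.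
    have -> : k^-1 *: (P t x - P (t - k) x) - P t y =
      (k^-1 *: (P t x - P (t - k) x) - P (t - k) y) + (P (t - k) y - P t y).
      by rewrite addrA subrK.
    apply: nrm_dist0D; apply: dist0_sym; last first.
      apply: nrm_dist0_trans (semigroupB _ _ s0) _.
      apply: nrm_dist0D; first exact: dist_refl.
      by rewrite opprK addrC; exact: Pk.
    apply: nrm_dist0_trans (semigroupB _ _ s0) _.
    apply: nrm_dist0D; last exact: dist_refl.
    apply: nrm_dist0_trans (semigroupZ _ _ s0) _.
    apply: nrm_dist0Z; apply: nrm_dist0_trans (semigroupB _ _ s0) _.
    by apply: nrm_dist0D; [exact/dist0_sym/Pk|exact: dist_refl].
  apply: le_trans (nrmD _ _) _.
  have k2 := h2 k; rewrite hn0 hd2 in k2; have {}k2 := k2 isT.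
  have k3 := h3 k; rewrite hn0 hd3 nrmB in k3; have {}k3 := k3 isT.
  have st' : 0 <= t - k <= t by rewrite s0.
  have m2 := hC _ (k^-1 *: (P k x - x) - y) st'.
  have m3 := hC _ (y - P k y) st'.
  have e' : C * (e / (2 * C)) = e / 2 by field; rewrite gt_eqF.
  have nle2 : C * nrm (k^-1 *: (P k x - x) - y) <= e / 2 by rewrite -e' ler_wpM2l// ltW.
  have n3 : C * nrm (y - P k y) <= e / 2 by rewrite -e' ler_wpM2l// ltW.
  lra.
- rewrite gtr0_norm// in hn0 hd1.
  have -> : nrm (h^-1 *: (P (t + h) x - P t x) - P t y) =
     nrm (h^-1 *: (P h (P t x) - P t x) - P t y).
    apply: nrm_dist0; apply: nrm_dist0D; last exact: dist_refl.
    apply: nrm_dist0Z; apply: nrm_dist0D; last exact: dist_refl.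
    by rewrite (addrC t h); exact: P_D (ltW h0) (ltW t0).
  by apply: h1; rewrite h0.
Qed.

Lemma semigroup_curve_der_rev (c r : R) x y : r < c -> A x y ->
  curve_der ip (fun s => P (c - s) x) r (- P (c - r) y).
Proof.
move=> rc Axy e e0; have cr : 0 < c - r by rewrite subr_gt0.
have [d d0 hd] := semigroup_curve_der cr Axy e0.
exists d => // h hh; have := hd (- h); rewrite normrN => /(_ hh).
have -> : c - r + - h = c - (r + h) by rewrite opprD addrA.
by rewrite invrN scaleNr -opprD nrmN opprK.
Qed.


(** The pairing has zero derivative for t > 0 and is right-continuous at 0. With w = 1 this is the
    conservation of the mean. *)
Lemma semigroup_ip_const x y w : A x y -> (forall t, 0 < t -> ip (P t y) w = 0) ->
  forall t, 0 <= t -> ip (P t x) w = ip x w.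
Proof.
move=> Axy h t t0.
have P0w : ip (P 0 x) w = ip x w by apply: (ip_dist0 ipC ipDl ipZl ip_ge0); exact: P_0.
have c0 : ip (P t x) w @[t --> 0^'+] --> ip (P 0 x) w.
  rewrite P0w; apply/cvgrPdist_le => e e0.
  have w1 : 0 < nrm w + 1 by rewrite ltr_wpDl.
  have e10 : 0 < e / (nrm w + 1) by rewrite divr_gt0.
  have [d d0 hd] := P_cont x e10.
  near=> s.
  have s0 : 0 < s by near: s; exact: nbhs_right_gt.
  have sd : s < d by near: s; exact: nbhs_right_lt.
  have := hd s; rewrite s0 sd => /(_ isT) hs.
  have -> : ip x w - ip (P s x) w = - ip (P s x - x) w by rewrite ipDl (ipNl ipZl); ring.
  rewrite normrN; apply: le_trans (cauchy_schwarz ipC ipDl ipZl ip_ge0 _ _) _.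
  apply: (@le_trans _ _ (e / (nrm w + 1) * (nrm w + 1))).
    by apply: ler_pM => //; rewrite lerDl.
  by rewrite divfK// gt_eqF.
have dP s : 0 < s -> is_derive s (1 : R) (fun s => ip (P s x) w) 0.
  move=> s0; have dw : curve_der ip (fun=> w) s 0.
    by move=> e e0; exists 1 => // k _; rewrite subrr scaler0 subrr (nrm0 ipZl) ltW.
  apply: is_derive_eq (is_derive_ip ipC ipDl ipZl ip_ge0 (semigroup_curve_der s0 Axy) dw) _.
  by rewrite h// ipC (ip0l ipZl) addr0.
have dN s : 0 < s -> is_derive s (1 : R) (fun s => - ip (P s x) w) 0.
  by move=> s0; apply: is_derive_eq (is_deriveN (dP s s0)) _; rewrite oppr0.
apply/le_anti/andP; rewrite -P0w; split.
  exact: (halfline_nincr dP c0 (fun _ _ => lexx _) (lexx 0) t0).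
rewrite -lerN2.
exact: (halfline_nincr dN (cvgN c0) (fun _ _ => lexx _) (lexx 0) t0).
Unshelve. all: by end_near. Qed.

(** * Exponential decay of the energy and the limit at infinity *)

Section decay.
Variable lam : R.
Hypotheses (lam_gt0 : 0 < lam)
  (A_sym : forall x x' y y', A x x' -> A y y' -> ip x' y = ip x y')
  (A_neg : forall x x', A x x' -> ip x x' <= 0)
  (A_gap : forall x x', A x x' -> lam * - ip x x' <= ip x' x').

Lemma is_derive_ip_semigroup x x' y y' t : 0 < t -> A x x' -> A y y' ->
  is_derive t (1 : R) (fun s => ip (P s x) (P s y)) (ip (P t x') (P t y) + ip (P t x) (P t y')).
Proof.
move=> t0 Ax Ay; apply: (is_derive_ip ipC ipDl ipZl ip_ge0);
  exact: semigroup_curve_der.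
Qed.

Lemma ip_semigroup_cvg0 x y : ip (P t x) (P t y) @[t --> 0^'+] --> ip (P 0 x) (P 0 y).
Proof.
have -> : ip (P 0 x) (P 0 y) = ip x y.
  rewrite (ip_dist0 ipC ipDl ipZl ip_ge0 _ (P_0 x)) ipC.
  by rewrite (ip_dist0 ipC ipDl ipZl ip_ge0 _ (P_0 y)) ipC.
apply/cvgrPdist_le => e e0.
pose K := nrm x + nrm y + 1; have K0 : 0 < K by rewrite ltr_wpDl// addr_ge0.
pose e1 := Num.min 1 (e / K).
have e10 : 0 < e1 by rewrite lt_min ltr01 divr_gt0.
have e1K : e1 * K <= e by rewrite -ler_pdivlMr// ge_min lexx orbT.
have e11 : e1 <= 1 by rewrite ge_min lexx.
have [d1 d10 h1] := P_cont x e10; have [d2 d20 h2] := P_cont y e10.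
near=> t.
have t0 : 0 < t by near: t; exact: nbhs_right_gt.
have td1 : t < d1 by near: t; exact: nbhs_right_lt.
have td2 : t < d2 by near: t; exact: nbhs_right_lt.
have {h1} := h1 t; rewrite t0 td1 => /(_ isT) h1.
have {h2} := h2 t; rewrite t0 td2 => /(_ isT) h2.
have -> : ip x y - ip (P t x) (P t y) =
  - (ip (P t x - x) y + ip x (P t y - y) + ip (P t x - x) (P t y - y)).
  rewrite !(ipDl, ipDr ipC ipDl, ipNl ipZl, ipNr ipC ipZl); ring.
rewrite normrN; apply: le_trans (ler_normD _ _) _.
apply: le_trans (lerD (ler_normD _ _) (lexx _)) _.
have cs := cauchy_schwarz ipC ipDl ipZl ip_ge0.
have b1 : `|ip (P t x - x) y| <= e1 * nrm y.
  by apply: le_trans (cs _ _) _; rewrite ler_wpM2r.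
have b2 : `|ip x (P t y - y)| <= e1 * nrm x.
  by apply: le_trans (cs _ _) _; rewrite mulrC ler_wpM2r.
have b3 : `|ip (P t x - x) (P t y - y)| <= e1 * 1.
  apply: le_trans (cs _ _) _; apply: ler_pM => //; exact: le_trans h2 e11.
apply: le_trans e1K; rewrite /K !mulrDr; lra.
Unshelve. all: by end_near. Qed.

Variables x y z : V.
Hypotheses (Axy : A x y) (Ayz : A y z).

Let a t := ip (P t x) (P t x).
Let E t := - ip (P t x) (P t y).
Let N t := ip (P t y) (P t y).

Let Axt t : 0 <= t -> A (P t x) (P t y).
Proof. by move=> t0; exact: generator_semigroup. Qed.
Let Ayt t : 0 <= t -> A (P t y) (P t z).
Proof. by move=> t0; exact: generator_semigroup. Qed.

Let E_ge0 t : 0 <= t -> 0 <= E t.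
Proof. by move=> t0; rewrite oppr_ge0; exact: A_neg (Axt t0). Qed.

Let E_le t : 0 <= t -> lam * E t <= N t.
Proof. by move=> t0; exact: A_gap (Axt t0). Qed.

Let da t : 0 < t -> is_derive t (1 : R) a (- 2 * E t).
Proof.
move=> t0; apply: is_derive_eq (is_derive_ip_semigroup t0 Axy Axy) _.
rewrite (ipC (P t y)) /E; ring.
Qed.

(** Differentiating E also differentiates P_t y, whence the assumption that y is in the domain; the
    symmetry of A merges the two resulting terms into one. *)
Let dE t : 0 < t -> is_derive t (1 : R) E (- 2 * N t).
Proof.
move=> t0; apply: is_derive_eq (is_deriveN (is_derive_ip_semigroup t0 Axy Ayz)) _.
rewrite -(A_sym (Axt (ltW t0)) (Ayt (ltW t0))) /N; ring.
Qed.

Let dN t : 0 < t -> is_derive t (1 : R) N (ip (P t z) (P t y) + ip (P t y) (P t z)).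
Proof. by move=> t0; exact: (is_derive_ip_semigroup t0 Ayz Ayz). Qed.

Let a0 : a t @[t --> 0^'+] --> a 0. Proof. exact: ip_semigroup_cvg0. Qed.
Let E0 : E t @[t --> 0^'+] --> E 0. Proof. by apply: cvgN; exact: ip_semigroup_cvg0. Qed.
Let N0 : N t @[t --> 0^'+] --> N 0. Proof. exact: ip_semigroup_cvg0. Qed.

Let a_nincr s t : 0 <= s -> s <= t -> a t <= a s.
Proof.
apply: (halfline_nincr da a0) => r r0.
by rewrite mulNr oppr_le0 mulr_ge0// E_ge0// ltW.
Qed.

(** Gronwall: E' = -2N <= -2 lam E, so exp(2 lam t) E(t) is nonincreasing. *)
Let E_decay t : 0 <= t -> expR (2 * lam * t) * E t <= E 0.
Proof.
move=> t0.
have dg s : is_derive (s : R) (1 : R) (fun s : R => expR (2 * lam * s)) (expR (2 * lam * s) * (2 * lam)).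
  have d2 : is_derive (s : R) (1 : R) (fun s : R => 2 * lam * s) (2 * lam).
    apply: is_derive_eq (is_deriveM (is_derive_cst (2 * lam : R) s (1 : R)) (is_derive_id _ _)) _.
    by rewrite scaler0 addr0 [LHS]mulr1.
  exact: (@is_derive1_comp _ (@expR R) (fun s : R => 2 * lam * s) s _ _ (is_derive_expR _) d2).
have d s : 0 < s -> is_derive (s : R) (1 : R) (fun s => expR (2 * lam * s) * E s)
    (expR (2 * lam * s) * (2 * (lam * E s - N s))).
  move=> s0; apply: is_derive_eq (is_deriveM (dg s) (dE s0)) _.
  rewrite /GRing.scale/=; ring.
have c0 : expR (2 * lam * s) * E s @[s --> 0^'+] --> expR (2 * lam * 0) * E 0.
  apply: cvgM E0; apply: cvg_at_right_filter.
  suff : {for (0 : R), continuous (fun s : R => expR (2 * lam * s))} by [].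
  by apply: differentiable_continuous; apply/derivable1_diffP; have [] := dg 0.
have := @halfline_nincr _ _ _ d c0 _ 0 t (lexx 0) t0.
rewrite mulr0 expR0 mul1r; apply => s s0.
rewrite pmulr_rle0 ?expR_gt0// pmulr_rle0// subr_le0; exact/E_le/ltW.
Qed.

(** With c the midpoint of s and t, the pairing of P_(c+q) x with P_(c-q) x has zero derivative in q
    by the symmetry of A; compare q = 0 with q = (t - s)/2. *)
Lemma semigroup_selfadjoint s t : 0 < s -> s <= t -> ip (P t x) (P s x) = a ((t + s) / 2).
Proof.
move=> s0 st; pose c := (t + s) / 2; pose r := (t - s) / 2.
have rc : r < c by rewrite /r /c; lra.
have r0 : 0 <= r by rewrite /r; lra.
pose h (q : R) := ip (P (c + q) x) (P (c - q) x).
have dh (q : R) : - c < q -> q < c -> is_derive q (1 : R) h 0.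
  move=> qc1 qc2.
  have cq : 0 < c + q by lra.
  have cq' : 0 <= c - q by lra.
  have du : curve_der ip (fun s => P (c + s) x) q (P (c + q) y).
    move=> e e0; have [d d0 hd] := semigroup_curve_der cq Axy e0.
    by exists d => // k /hd; rewrite -addrA.
  have dw := semigroup_curve_der_rev qc2 Axy.
  apply: is_derive_eq (is_derive_ip ipC ipDl ipZl ip_ge0 du dw) _.
  rewrite (ipNr ipC ipZl) (A_sym (Axt (ltW cq)) (Axt cq')); ring.
have [| |q _] := @MVT_segment _ h (fun=> 0) 0 r r0.
- move=> q; rewrite in_itv/= => /andP[q0 qr]; apply: dh; lra.
- apply: derivable_within_continuous => q; rewrite in_itv/= => /andP[q0 qr].
  have hc1 : - c < q by lra.
  have hc2 : q < c by lra.
  by have [] := dh q hc1 hc2.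
rewrite mul0r => /eqP; rewrite subr_eq0 => /eqP.
rewrite /h addr0 subr0.
have -> : c + r = t by rewrite /c /r; field.
by have -> : c - r = s by rewrite /c /r; field.
Qed.

Lemma ip_sqrB (u v : V) : ip (u - v) (u - v) = ip u u + ip v v - 2 * ip u v.
Proof.
rewrite !ipDl !(ipDr ipC ipDl) !(ipNl ipZl) !(ipNr ipC ipZl) (ipC v u); ring.
Qed.

(** The function a is nonincreasing and nonnegative, hence has a limit l, and the midpoint identity
    turns this into the Cauchy property of the orbit. Only times m+1 are sampled, which are positive
    as that identity requires. *)
Theorem semigroup_limit : exists xinf,
  [/\ forall e, 0 < e -> exists K, forall m, (K <= m)%N -> nrm (P m.+1%:R x - xinf) <= e,
   forall e, 0 < e -> exists K, forall m, (K <= m)%N -> - ip (P m.+1%:R x) (P m.+1%:R y) <= e,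
   lam * (ip x x - ip xinf xinf) <= - ip x y &
   (\int[@lebesgue_measure R]_(t in `[0%R, +oo[)
      (ip (P t y) (P t y) + lam * ip (P t x) (P t y))%:E =
    (2^-1 * (- ip x y - lam * (ip x x - ip xinf xinf)))%:E)%E].
Proof.
have a_ge0 t : 0 <= a t by exact: ip_ge0.
pose l := inf [set a t | t in [set t | 0 < t]].
have linf : has_inf [set a t | t in [set t | 0 < t]].
  split; first by exists (a 1); exists 1 => //=.
  by exists 0 => _ [t _ <-].
have la t : 0 < t -> l <= a t by move=> t0; apply: inf_lbound; [have [] := linf|exists t].
have al eps : 0 < eps -> exists K : nat, forall t, K%:R <= t -> a t <= l + eps.
  move=> eps0; have [_ [t0 /= t0p <-] ht0] := inf_adherent eps0 linf.
  exists (Num.truncn t0).+1 => t Kt; apply: le_trans (ltW ht0); apply: a_nincr; first exact: ltW.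
  by apply: le_trans Kt; exact/ltW/truncnS_gt.
have nS (k : nat) : (0 : R) < k.+1%:R by rewrite ltr0n.
have [xinf hx] : exists xinf, forall e, 0 < e -> exists K, forall m, (K <= m)%N -> nrm (P m.+1%:R x - xinf) <= e.
  apply: complete => e e0.
  (* The square of the distance is at most 2 (l + e^2/2) - 2l = e^2, the midpoint value being at
     least l. *)
  have [K hK] := al (e ^+ 2 / 2) (divr_gt0 (exprn_gt0 2 e0) (ltr0n _ 2)).
  exists K => m Km; rewrite -(@ler_pXn2r _ 2) ?nnegrE//; last exact: ltW.
  rewrite nrm_sqr// ip_sqrB (@semigroup_selfadjoint K.+1%:R m.+1%:R) ?ler_nat//.
  have h1 : a m.+1%:R <= l + e ^+ 2 / 2 by apply: hK; rewrite ler_nat leqW.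
  have h2 : a K.+1%:R <= l + e ^+ 2 / 2 by apply: hK; rewrite ler_nat.
  have h3 := la _ (divr_gt0 (addr_gt0 (nS m) (nS K)) (ltr0n _ 2)).
  apply: (@le_trans _ _ ((l + e ^+ 2 / 2) + (l + e ^+ 2 / 2) - 2 * l)).
    by apply: lerB; [exact: lerD h1 h2|rewrite ler_wpM2l].
  by rewrite le_eqVlt; apply/orP; left; apply/eqP; field.
have al' : l = ip xinf xinf.
  apply/eqP; rewrite -subr_eq0 -normr_le0; apply/ler_addgt0Pl => eps eps0; rewrite addr0.
  pose b := nrm xinf; have b0 : 0 <= b by exact: nrm_ge0.
  have B0 : 0 < 2 * b + 2 by lra.
  pose e1 := Num.min 1 (eps / (2 * b + 2)).
  have e10 : 0 < e1 by rewrite lt_min ltr01 divr_gt0.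
  have e1K : e1 * (2 * b + 2) <= eps by rewrite -ler_pdivlMr// ge_min lexx orbT.
  have e11 : e1 <= 1 by rewrite ge_min lexx.
  have [K1 hK1] := hx _ e10; have [K2 hK2] := al _ e10.
  pose m := maxn K1 K2; pose u := P m.+1%:R x.
  have h1 : nrm (u - xinf) <= e1 by apply: hK1; exact: leq_maxl.
  have h2 : ip u u <= l + e1.
    by apply: hK2; rewrite ler_nat; apply: leqW; exact: leq_maxr.
  have h3 : l <= ip u u by exact: la.
  have e2 : ip u u - ip xinf xinf = nrm (u - xinf) ^+ 2 + 2 * ip (u - xinf) xinf.
    rewrite nrm_sqr// ip_sqrB ipDl (ipNl ipZl); ring.
  have h4 : nrm (u - xinf) ^+ 2 <= e1.
    by rewrite expr2 -[leRHS]mulr1; apply: ler_pM => //; exact: le_trans h1 e11.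
  have h4' : 0 <= nrm (u - xinf) ^+ 2 by exact: sqr_ge0.
  have h5 : `|ip (u - xinf) xinf| <= e1 * b.
    by apply: le_trans (cauchy_schwarz ipC ipDl ipZl ip_ge0 _ _) _; rewrite ler_wpM2r.
  move: h5; rewrite !ler_norml => /andP[h5 h6]; apply/andP; split; lra.
have acvg : a t @[t --> +oo] --> l.
  apply/cvgrPdist_le => e e0; have [K hK] := al e e0; near=> t.
  have t0 : 0 < t by near: t; exact: nbhs_pinfty_gt.
  have Kt : K%:R <= t by near: t; exact: nbhs_pinfty_ge.
  have := la t t0; have := hK t Kt; rewrite ler_norml => ? ?; apply/andP; split; lra.
have Ecvg : E t @[t --> +oo] --> (0 : R).
  apply/cvgrPdist_le => e e0; near=> t.
  have t0 : 0 < t by near: t; exact: nbhs_pinfty_gt.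
  have Kt : E 0 / (2 * lam * e) <= t by near: t; apply: nbhs_pinfty_ge; rewrite num_real.
  rewrite sub0r normrN ger0_norm; last exact/E_ge0/ltW.
  have hd := E_decay (ltW t0).
  have h1 : 2 * lam * t <= expR (2 * lam * t).
    by apply: le_trans (expR_ge1Dx _); rewrite lerDr.
  have le0 : 0 < 2 * lam by rewrite mulr_gt0.
  rewrite ler_pdivrMr ?mulr_gt0// in Kt.
  have h2 : (2 * lam * t) * E t <= (2 * lam * t) * e.
    apply: (@le_trans _ _ (E 0)); last by rewrite mulrAC mulrC.
    by apply: le_trans hd; rewrite ler_wpM2r// E_ge0// ltW.
  by rewrite ler_pM2l ?mulr_gt0// in h2.
have e0E : E 0 = - ip x y.
  rewrite /E (ip_dist0 ipC ipDl ipZl ip_ge0 _ (P_0 x)) ipC.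
  by rewrite (ip_dist0 ipC ipDl ipZl ip_ge0 _ (P_0 y)) ipC.
have a0E : a 0 = ip x x.
  rewrite /a (ip_dist0 ipC ipDl ipZl ip_ge0 _ (P_0 x)) ipC.
  by rewrite (ip_dist0 ipC ipDl ipZl ip_ge0 _ (P_0 x)).
(* An antiderivative of the nonnegative integrand N - lam E. Its increments give both remaining
   claims: F(0) <= F(+oo) is the Poincare inequality, and F(+oo) - F(0), with F(+oo) = lam l / 2, is
   the value of the integral. *)
pose F t := 2^-1 * (lam * a t - E t).
have dF (t : R) : 0 < t -> is_derive t (1 : R) F (N t - lam * E t).
  move=> t0.
  have d1 := is_deriveM (is_derive_cst (lam : R) t (1 : R)) (da t0).
  have d2 := is_deriveB d1 (dE t0).
  apply: is_derive_eq (is_deriveM (is_derive_cst (2^-1 : R) t (1 : R)) d2) _.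
  by rewrite !scaler0 !addr0 /GRing.scale/=; field.
have F0 : F t @[t --> 0^'+] --> F 0.
  apply: cvgM; first exact: cvg_cst.
  by apply: cvgB E0; apply: cvgM a0; exact: cvg_cst.
have Fl : F t @[t --> +oo] --> 2^-1 * (lam * l - 0).
  apply: cvgM; first exact: cvg_cst.
  by apply: cvgB Ecvg; apply: cvgM acvg; exact: cvg_cst.
exists xinf; split => //.
- move=> e e0; have /cvgrPdist_le/(_ e e0)[M [_ hM]] := Ecvg.
  exists (Num.truncn M).+1 => m Km; have := hM m.+1%:R.
  rewrite sub0r normrN -/(E _) => /(_ _)/(le_trans (ler_norm _)); apply.
  apply: lt_le_trans (truncnS_gt _) _; rewrite ler_nat; exact: leqW.
- rewrite -al' -e0E -a0E.
  have : F 0 <= 2^-1 * (lam * l - 0).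
    rewrite -(cvg_lim _ Fl)//; apply: limr_ge; first by apply/cvg_ex; eexists; exact: Fl.
    near=> t; have t0 : 0 <= t by near: t; exact: nbhs_pinfty_ge.
    have dNF (r : R) : 0 < r -> is_derive r (1 : R) (fun s => - F s) (- (N r - lam * E r)).
      by move=> r0; exact: is_deriveN (dF r r0).
    have NF0 : - F t @[t --> 0^'+] --> - F 0 by apply: cvgN.
    have := @halfline_nincr _ _ _ dNF NF0 _ 0 t (lexx 0) t0; rewrite lerN2; apply => s s0.
    by rewrite oppr_le0 subr_ge0 E_le// ltW.
  rewrite /F; lra.
- rewrite -al' -e0E -a0E.
  transitivity (\int[@lebesgue_measure R]_(t in `[0%R, +oo[) (N t - lam * E t)%:E)%E.
    by apply: eq_integral => t _; rewrite /N /E mulrN opprK.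
  rewrite (@ge0_continuous_FTC2y _ _ F 0 (2^-1 * (lam * l - 0))) => //.
  + by rewrite -EFinB; congr EFin; rewrite /F; ring.
  + by move=> t t0; rewrite subr_ge0 E_le.
  + apply/continuous_within_itvcyP; split.
      move=> t; rewrite in_itv/= andbT => t0.
      apply: cvgB; last apply: cvgM; first 2 last.
      * apply: differentiable_continuous; apply/derivable1_diffP; by have [] := dE t0.
      * apply: differentiable_continuous; apply/derivable1_diffP; by have [] := dN t0.
      * exact: cvg_cst.
    by apply: cvgB N0 _; apply: cvgM E0; exact: cvg_cst.
  + by move=> t t0; have [] := dF t t0.
  + by move=> t; rewrite in_itv/= andbT => t0; rewrite derive1E; have [_ ->] := dF t t0.
Unshelve. all: by end_near. Qed.

End decay.

End semigroup.

(** * The space L^2 of a probability *)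

Section L2.
Context d (T : measurableType d) (R : realType) (mu : probability T R).
Local Notation L2 f := ((f : T -> R) \in Lfun mu 2%:E).
Implicit Types f g : T -> R.

Lemma L2_measurable f : L2 f -> measurable_fun setT f.
Proof. by rewrite inE => /andP[]; rewrite inE. Qed.

Lemma Lnorm2E f : 'N[mu]_2%:E[EFin \o f]%E = ((\int[mu]_x (f x ^+ 2)%:E) `^ 2^-1)%E.
Proof.
rewrite unlock; congr (_ `^ _)%E; apply: eq_integral => x _.
by rewrite /= powR_mulrn// real_normK// num_real.
Qed.

Lemma L2P f : L2 f <-> measurable_fun setT f /\ (\int[mu]_x (f x ^+ 2)%:E < +oo)%E.
Proof.
split=> [Lf|[mf fi]].
  split; first exact: L2_measurable.
  have /integrableP[_] := Lfun2_integrable_sqr Lf.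
  by under eq_integral do rewrite gee0_abs ?lee_fin ?sqr_ge0//.
rewrite inE; apply/andP; split; rewrite inE//=.
rewrite /finite_norm Lnorm2E; exact: poweR_lty.
Qed.

Lemma L2_le f g : measurable_fun setT f -> (forall x, `|f x| <= `|g x|) -> L2 g -> L2 f.
Proof.
move=> mf fg /L2P[mg gi]; apply/L2P; split => //; apply: le_lt_trans gi.
apply: ge0_le_integral => //.
- by move=> x _; rewrite lee_fin sqr_ge0.
- by apply/measurable_EFinP; exact: measurable_funX.
- by apply/measurable_EFinP; exact: measurable_funX.
- by move=> x _; rewrite lee_fin -(real_normK (num_real (f x))) -(real_normK (num_real (g x))) lerXn2r ?nnegrE.
Qed.

Definition one_le2 : (1 <= 2%:E :> \bar R)%E.
Proof. by rewrite lee_fin ler1n. Qed.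

(** Square-integrable functions themselves, not their classes: the module structure is available,
    and the inner product on it is only semi-definite. *)
Definition L2T := LfunType mu one_le2.

Definition L2pack f (Lf : L2 f) : L2T := Lfun_Sub one_le2 Lf.

Lemma L2T_L2 (u : L2T) : L2 u.
Proof. exact: LfunP. Qed.

Lemma L2Z (c : R) f : L2 f -> L2 (fun x => c * f x).
Proof. by move=> Lf; exact: (L2T_L2 (c *: L2pack Lf)). Qed.

Lemma L2D f g : L2 f -> L2 g -> L2 (fun x => f x + g x).
Proof. by move=> Lf Lg; exact: (L2T_L2 (L2pack Lf + L2pack Lg)). Qed.

Lemma L2N f : L2 f -> L2 (fun x => - f x).
Proof. by move=> Lf; exact: (L2T_L2 (- L2pack Lf)). Qed.

Lemma L2B f g : L2 f -> L2 g -> L2 (fun x => f x - g x).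
Proof. by move=> Lf Lg; apply: L2D => //; exact: L2N. Qed.

Lemma L2_mulb (b f : T -> R) C : measurable_fun setT b -> (forall x, `|b x| <= C) -> L2 f ->
  L2 (fun x => b x * f x).
Proof.
move=> mb bC Lf; apply: (L2_le (g := fun x => C * f x)); last exact: L2Z.
  by apply: measurable_funM => //; exact: L2_measurable.
by move=> x; rewrite !normrM ler_wpM2r// (le_trans (bC x))// ler_norm.
Qed.

Lemma L2_cst (c : R) : L2 (fun=> c).
Proof.
apply/L2P; split => //; rewrite integral_cst//= probability_setT mule1 ltry//.
Qed.

Lemma L2_bounded (b : T -> R) C : measurable_fun setT b -> (forall x, `|b x| <= C) -> L2 b.
Proof.
move=> mb bC; have := L2_mulb mb bC (L2_cst 1).
by under eq_fun do rewrite mulr1.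
Qed.

Lemma L2_sum (I : Type) (r : seq I) (F : I -> T -> R) : (forall i, L2 (F i)) ->
  L2 (fun x => \sum_(i <- r) F i x).
Proof.
move=> LF; elim: r => [|i r IH].
  by under eq_fun do rewrite big_nil; exact: L2_cst.
by under eq_fun do rewrite big_cons; exact: L2D.
Qed.

Lemma integrableM_L2 f g : L2 f -> L2 g -> mu.-integrable setT (EFin \o (fun x => f x * g x)).
Proof. by move=> Lf Lg; apply/Lfun1_integrable; exact: Lfun2_mul_Lfun1. Qed.

Lemma integrable_L2 f : L2 f -> mu.-integrable setT (EFin \o f).
Proof.
move=> Lf; have := integrableM_L2 Lf (L2_cst 1).
by under eq_fun do rewrite mulr1.
Qed.

Definition ip2 f g : R := (\int[mu]_x (f x * g x))%R.

Lemma ip2E f g : L2 f -> L2 g -> ((ip2 f g)%:E = \int[mu]_x (f x * g x)%:E)%E.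
Proof. by move=> Lf Lg; rewrite /ip2 /Rintegral fineK//; apply: integrable_fin_num => //; exact: integrableM_L2. Qed.

Lemma ip2_sqrE f : L2 f -> ((ip2 f f)%:E = \int[mu]_x (f x ^+ 2)%:E)%E.
Proof. by move=> Lf; rewrite ip2E//; apply: eq_integral => x _; rewrite expr2. Qed.

Lemma ip2C f g : ip2 f g = ip2 g f.
Proof. by apply: eq_Rintegral => x _; rewrite mulrC. Qed.

Lemma ip2Dl f g h : L2 f -> L2 g -> L2 h -> ip2 (fun x => f x + g x) h = ip2 f h + ip2 g h.
Proof.
move=> Lf Lg Lh; rewrite /ip2 -RintegralD//; [|exact: integrableM_L2..].
by apply: eq_Rintegral => x _; rewrite mulrDl.
Qed.

Lemma ip2Zl (c : R) f h : L2 f -> L2 h -> ip2 (fun x => c * f x) h = c * ip2 f h.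
Proof.
move=> Lf Lh; rewrite /ip2 -RintegralZl//; last exact: integrableM_L2.
by apply: eq_Rintegral => x _; rewrite mulrA.
Qed.

Lemma ip2_ge0 f : 0 <= ip2 f f.
Proof. by apply: Rintegral_ge0 => x _; rewrite -expr2 sqr_ge0. Qed.

Definition ipV (u v : L2T) : R := ip2 u v.

Lemma ipVC u v : ipV u v = ipV v u. Proof. exact: ip2C. Qed.
Lemma ipVDl u v w : ipV (u + v) w = ipV u w + ipV v w.
Proof. by apply: ip2Dl; exact: L2T_L2. Qed.
Lemma ipVZl (c : R) u v : ipV (c *: u) v = c * ipV u v.
Proof. by apply: ip2Zl; exact: L2T_L2. Qed.
Lemma ipV_ge0 u : 0 <= ipV u u.
Proof. exact: ip2_ge0. Qed.

Definition norm2 f : R := Num.sqrt (ip2 f f).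

Lemma norm2_ge0 f : 0 <= norm2 f. Proof. exact: sqrtr_ge0. Qed.
Lemma norm2_sqr f : norm2 f ^+ 2 = ip2 f f. Proof. by apply: sqr_sqrtr; exact: ip2_ge0. Qed.

Lemma Lnorm_norm2 f : L2 f -> 'N[mu]_2%:E[EFin \o f]%E = (norm2 f)%:E.
Proof.
move=> Lf; rewrite Lnorm2E -ip2_sqrE// poweR_EFin powR12_sqrt//; exact: ip2_ge0.
Qed.

Lemma norm2_nrm (u : L2T) : nrm ipV u = norm2 u. Proof. by []. Qed.

Lemma norm2_cauchy_schwarz f g : L2 f -> L2 g -> `|ip2 f g| <= norm2 f * norm2 g.
Proof.
by move=> Lf Lg; exact: (cauchy_schwarz ipVC ipVDl ipVZl ipV_ge0 (L2pack Lf) (L2pack Lg)).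
Qed.

Lemma norm2D f g : L2 f -> L2 g -> norm2 (fun x => f x + g x) <= norm2 f + norm2 g.
Proof.
by move=> Lf Lg; exact: (nrmD ipVC ipVDl ipVZl ipV_ge0 (L2pack Lf) (L2pack Lg)).
Qed.

Lemma norm2Z (c : R) f : L2 f -> norm2 (fun x => c * f x) = `|c| * norm2 f.
Proof. by move=> Lf; exact: (nrmZ ipVC ipVZl c (L2pack Lf)). Qed.

Lemma norm2N f : norm2 (fun x => - f x) = norm2 f.
Proof. by rewrite /norm2; congr Num.sqrt; apply: eq_Rintegral => x _; rewrite mulrNN. Qed.

Lemma norm2_le f g : L2 f -> L2 g -> (forall x, `|f x| <= `|g x|) -> norm2 f <= norm2 g.
Proof.
move=> Lf Lg fg; rewrite ler_wsqrtr// -lee_fin !ip2_sqrE//.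
apply: ge0_le_integral => //.
- by move=> x _; rewrite lee_fin sqr_ge0.
- by apply/measurable_EFinP; apply: measurable_funX; exact: L2_measurable.
- by apply/measurable_EFinP; apply: measurable_funX; exact: L2_measurable.
- by move=> x _; rewrite lee_fin -(real_normK (num_real (f x))) -(real_normK (num_real (g x))) lerXn2r ?nnegrE.
Qed.

Lemma ae_eq_norm2 f g : measurable_fun setT f -> measurable_fun setT g ->
  f = g %[ae mu] -> norm2 f = norm2 g.
Proof.
move=> mf mg fg; rewrite /norm2 /ip2 /Rintegral; congr (Num.sqrt (fine _)).
apply: ae_eq_integral => //; try by apply/measurable_EFinP; exact: measurable_funM.
by apply: filterS fg => x h _; rewrite h.
Qed.

Lemma ae_eq_ip2 f g h : measurable_fun setT f -> measurable_fun setT g -> measurable_fun setT h ->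
  f = g %[ae mu] -> ip2 f h = ip2 g h.
Proof.
move=> mf mg mh fg; rewrite /ip2 /Rintegral; congr (fine _).
apply: ae_eq_integral => //; try by apply/measurable_EFinP; exact: measurable_funM.
by apply: filterS fg => x e _; rewrite e.
Qed.

Lemma ae_eq_norm2B0 f g : measurable_fun setT f -> measurable_fun setT g ->
  f = g %[ae mu] -> norm2 (fun x => f x - g x) = 0.
Proof.
move=> mf mg fg; rewrite (@ae_eq_norm2 _ (fun=> 0))//.
- by rewrite /norm2 /ip2 Rintegral_cst// mul0r mul0r sqrtr0.
- exact: measurable_funB.
- by apply: filterS fg => x /= h Dx; rewrite h ?subrr.
Qed.

Definition cvg2 (u : nat -> T -> R) f :=
  forall e, 0 < e -> exists N, forall m, (N <= m)%N -> norm2 (fun x => u m x - f x) <= e.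

Lemma cvg_LnormP (u : nat -> T -> R) f : (forall k, L2 (u k)) -> L2 f ->
  'N[mu]_2%:E[EFin \o (u k - f)%R]%E @[k --> \oo] --> 0%E <-> cvg2 u f.
Proof.
move=> Lu Lf.
have E k : 'N[mu]_2%:E[EFin \o (u k - f)%R]%E = (norm2 (fun x => u k x - f x))%:E.
  by apply: Lnorm_norm2; exact: L2B.
under eq_fun do rewrite E.
split=> [/fine_cvgP[_ /cvgrPdist_le h] e e0|h].
  have [N _ hN] := h e e0; exists N => m Nm.
  by have := hN m Nm; rewrite /= sub0r normrN ger0_norm// norm2_ge0.
apply/fine_cvgP; split; first exact: nearW.
apply/cvgrPdist_le => e e0; have [N hN] := h e e0.
exists N => // m /= Nm; rewrite sub0r normrN ger0_norm ?norm2_ge0//; exact: hN.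
Qed.

(** A subsequence v has increments bounded by a geometric sequence in L^2, hence in L^1 since the
    measure is a probability. The sum of their absolute values is then finite almost everywhere,
    which gives a pointwise limit, set to 0 on the exceptional set. Fatou's lemma brings the
    convergence back to L^2 for the whole sequence. *)
Lemma riesz_fischer (u : nat -> T -> R) : (forall k, L2 (u k)) ->
  (forall e, 0 < e -> exists N, forall m, (N <= m)%N -> norm2 (fun x => u m x - u N x) <= e) ->
  exists2 f, L2 f & cvg2 u f.
Proof.
move=> Lu cu.
have mu_ k : measurable_fun setT (u k) := L2_measurable (Lu k).
have /(_ _)/cid-/all_sig[N hN] : forall k : nat, exists N, forall m, (N <= m)%N ->
    norm2 (fun x => u m x - u N x) <= 2^-1 ^+ k.
  by move=> k; apply: cu; rewrite exprn_gt0// invr_gt0.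
pose phi := fix phi k := if k is k'.+1 then maxn (phi k').+1 (N k) else N 0.
have phiN k : (N k <= phi k)%N by case: k => //= k; exact: leq_maxr.
have phiS k : (phi k < phi k.+1)%N by exact: leq_maxl.
have phi_ge k : (k <= phi k)%N by elim: k => // k IH; exact: leq_ltn_trans IH (phiS k).
pose v k := u (phi k).
have triv (a b c : nat) : norm2 (fun x => u a x - u c x) <= norm2 (fun x => u a x - u b x) + norm2 (fun x => u c x - u b x).
  rewrite -[X in _ <= _ + X]norm2N.
  have -> : (fun x => u a x - u c x) = (fun x => (u a x - u b x) + - (u c x - u b x)).
    by apply/funext => x; ring.
  by apply: norm2D; [exact: L2B|apply: L2N; exact: L2B].
have vS k : norm2 (fun x => v k.+1 x - v k x) <= 2 * 2^-1 ^+ k.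
  apply: le_trans (triv _ (N k) _) _; rewrite mulr_natl mulr2n; apply: lerD; apply: hN => //.
  exact: leq_trans (phiN k) (ltnW (phiS k)).
pose h k x := `|v k.+1 x - v k x|.
have h0 k x : (0 <= (h k x)%:E)%E by rewrite lee_fin /h normr_ge0.
have mh k : measurable_fun setT (h k).
  apply: measurableT_comp => //; apply: measurable_funB; exact: mu_.
have ih k : (\int[mu]_x (h k x)%:E <= (2 * 2^-1 ^+ k)%:E)%E.
  have Lh : L2 (h k) by apply: (L2_le (mh k) _ (L2B (Lu (phi k.+1)) (Lu (phi k)))) => x; rewrite normr_id.
  have := norm2_cauchy_schwarz Lh (L2_cst 1).
  have -> : norm2 (fun=> 1) = 1 by rewrite /norm2 /ip2 Rintegral_cst//= probability_setT !mulr1 sqrtr1.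
  have -> : norm2 (h k) = norm2 (fun x => v k.+1 x - v k x).
    by rewrite /norm2; congr Num.sqrt; apply: eq_Rintegral => x _; rewrite /h -!expr2 real_normK ?num_real.
  rewrite mulr1 => /(le_trans (ler_norm _))/le_trans/(_ (vS k)).
  rewrite -lee_fin ip2E//; last exact: L2_cst.
  by under eq_integral do rewrite mulr1.
pose S x := (\sum_(k <oo) (h k x)%:E)%E.
have mS : measurable_fun setT S.
  apply: (@ge0_emeasurable_sum _ _ _ setT (fun k x => (h k x)%:E) xpredT).
    by move=> k x _ _; exact: h0.
  by move=> k _; exact/measurable_EFinP.
have S0 x : (0 <= S x)%E by apply: nneseries_ge0 => k _ _; exact: h0.
have iS : (\int[mu]_x S x < +oo)%E.
  rewrite /S integral_nneseries//; last by move=> k; exact/measurable_EFinP.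
  apply: (@le_lt_trans _ _ (\sum_(k <oo) (2 * 2^-1 ^+ k)%:E)%E).
    by apply: lee_nneseries => k _; [move=> _; apply: integral_ge0 => x _; exact: h0|exact: ih].
  have -> : (\sum_(k <oo) (2 * 2^-1 ^+ k)%:E = (4 : R)%:E)%E.
    have L := @cvg_geometric_eseries_half R 4 0; rewrite expr0 divr1 in L.
    apply: esym; apply: etrans (esym (cvg_lim _ L)) _ => //.
    apply: esym; congr (limn _); apply/funext => m; apply: eq_bigr => k _; congr EFin.
    by rewrite addn1 natrX exprS invfM mulrA exprVn; congr (_ * _); field.
  by rewrite ltry.
pose D := [set x | S x \is a fin_num].
have mD : measurable D by rewrite -[D]setTI; exact: emeasurable_fin_num.
have aeD : {ae mu, forall x, D x}.
  have : mu.-integrable setT S.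
    by apply/integrableP; split => //; under eq_integral do rewrite gee0_abs//.
  by move=> /(integrable_ae measurableT); apply: filterS => x; exact.
have cvD x : D x -> cvgn (v ^~ x).
  move=> Dx; rewrite (_ : v ^~ x = fun k => v 0%N x + series (telescope (v ^~ x)) k); last first.
    by apply/funext => k; rewrite -eq_sum_telescope.
  apply: is_cvgD; first exact: is_cvg_cst.
  apply: normed_cvg.
  suff : cvgn (fun k => \sum_(0 <= i < k) h i x) by [].
  apply: nondecreasing_is_cvgn.
    by apply/nondecreasing_seqP => k; rewrite big_nat_recr//= lerDl normr_ge0.
  exists (fine (S x)) => _ [k _ <-].
  rewrite -lee_fin fineK// -sumEFin.
  by apply: (@nneseries_lim_ge _ (fun k => (h k x)%:E) xpredT 0 k) => i _ _; exact: h0.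
pose f x := if `[< D x >] then limn (v ^~ x) else 0.
have fD x : D x -> v k x @[k --> \oo] --> f x.
  by move=> Dx; rewrite /f asboolT//; exact: cvD.
have mf : measurable_fun setT f.
  apply: (@measurable_fun_cvg _ _ _ _ (fun k x => v k x * \1_D x)).
    by move=> k; apply: measurable_funM; [exact: mu_|exact: measurable_indic].
  move=> x _; rewrite indicE; have [Dx|Dx] := pselect (D x).
    by rewrite mem_set//; under eq_fun do rewrite mulr1; exact: fD.
  by rewrite memNset// /f asboolF//; under eq_fun do rewrite mulr0; exact: cvg_cst.
have key e : 0 < e -> exists N, forall m, (N <= m)%N ->
    (\int[mu]_x ((u m x - f x) ^+ 2)%:E <= (e ^+ 2)%:E)%E.
  move=> e0; have [M hM] := cu _ (divr_gt0 e0 (ltr0n R 2)).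
  exists M => m Mm.
  (* Shifting by M keeps the indices of the subsequence beyond M, where the Cauchy estimate
     holds. *)
  pose F k x := ((u m x - v (k + M)%N x) ^+ 2)%:E : \bar R.
  have mF k : measurable_fun setT (F k).
    by apply/measurable_EFinP; apply: measurable_funX; apply: measurable_funB => //; exact: mu_.
  have F0 k x : setT x -> (0 <= F k x)%E by rewrite lee_fin sqr_ge0.
  have iF k : (\int[mu]_x F k x <= (e ^+ 2)%:E)%E.
    rewrite -ip2_sqrE; last by apply: L2B; exact: Lu.
    rewrite lee_fin -norm2_sqr lerXn2r ?nnegrE ?norm2_ge0//; first exact: ltW.
    apply: le_trans (triv _ M _) _; rewrite [leRHS](splitr e); apply: lerD; apply: hM => //.
    exact: leq_trans (leq_addl k M) (phi_ge _).
  apply: (@le_trans _ _ (limn_einf (fun k => \int[mu]_x F k x))%E); last first.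
    rewrite limn_einf_lim; apply: lime_le; first exact: is_cvg_einfs.
    apply: nearW => k; apply: le_trans (iF k).
    by apply: ereal_inf_lbound; exists k => /=.
  apply: le_trans (fatou mu measurableT mF F0).
  apply: ae_ge0_le_integral => //.
  - by move=> x _; rewrite lee_fin sqr_ge0.
  - by apply/measurable_EFinP; apply: measurable_funX; apply: measurable_funB => //; exact: mu_.
  - by move=> x _; rewrite limn_einf_lim; apply: lime_ge; [exact: is_cvg_einfs|
      apply: nearW => k; apply: le_ereal_inf_tmp => _ [i /= _ <-]; exact: F0].
  - by apply: measurableT_comp => //; apply: measurable_fun_limn_esup => k; exact: measurableT_comp.
  - apply: filterS aeD => x Dx _.
    have : F k x @[k --> \oo] --> ((u m x - f x) ^+ 2)%:E.
      apply/fine_cvgP; split; first exact: nearW.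
      have fs : v (k + M)%N x @[k --> \oo] --> f x.
        by move: (fD x Dx); rewrite -(cvg_shiftn M).
      have fd : u m x - v (k + M)%N x @[k --> \oo] --> u m x - f x by apply: cvgB fs; exact: cvg_cst.
      exact: (cvgM fd fd).
    by move=> /cvg_limn_einf_sup[-> _].
have Lf : L2 f.
  have [M hM] := key 1 ltr01.
  have Lfu : L2 (fun x => u M x - f x).
    apply/L2P; split; first by apply: measurable_funB => //; exact: mu_.
    by apply: le_lt_trans (hM M (leqnn M)) _; rewrite ltry.
  have := L2B (Lu M) Lfu; by under eq_fun do rewrite subKr.
exists f => // e e0; have [M hM] := key e e0; exists M => m Mm.
rewrite -(@ler_pXn2r _ 2) ?nnegrE ?norm2_ge0//; last exact: ltW.
by rewrite norm2_sqr -lee_fin ip2_sqrE ?hM//; exact: L2B.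
Qed.

End L2.

Section cvg2_theory.
Context d (T : measurableType d) (R : realType) (mu : probability T R).
Local Notation L2 f := ((f : T -> R) \in Lfun mu 2%:E).
Local Notation ip2 := (@ip2 _ _ _ mu).
Local Notation norm2 := (@norm2 _ _ _ mu).
Local Notation cvg2 := (@cvg2 _ _ _ mu).
Implicit Types (f g : T -> R) (u v : nat -> T -> R).

Lemma cvg2P u f : cvg2 u f <-> norm2 (fun x => u k x - f x) @[k --> \oo] --> 0.
Proof.
split=> [h|/cvgrPdist_le h e e0].
  apply/cvgrPdist_le => e e0; have [N hN] := h e e0; exists N => // m /= Nm.
  by rewrite sub0r normrN ger0_norm ?norm2_ge0//; exact: hN.
have [N _ hN] := h e e0; exists N => m Nm.
by have := hN m Nm; rewrite /= sub0r normrN ger0_norm// norm2_ge0.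
Qed.

Lemma cvg2_dominated u f v g (C : R) : (forall k, norm2 (fun x => u k x - f x) <= C * norm2 (fun x => v k x - g x)) ->
  cvg2 v g -> cvg2 u f.
Proof.
move=> h /cvg2P vg; apply/cvg2P.
apply: (@squeeze_cvgr _ _ _ _ (fun=> 0) (fun k => C * norm2 (fun x => v k x - g x))).
- by apply: nearW => k; rewrite norm2_ge0 h.
- exact: cvg_cst.
- by rewrite -[X in _ --> X](mulr0 C); apply: cvgM vg; exact: cvg_cst.
Qed.

Lemma cvg2_cst f : cvg2 (fun=> f) f.
Proof.
move=> e e0; exists 0%N => m _; rewrite /norm2 /ip2.
rewrite (_ : (\int[mu]_x _)%R = 0) ?sqrtr0 1?ltW//.
by rewrite (@eq_Rintegral _ _ _ _ _ (fun=> 0)) ?Rintegral_cst ?mul0r// => x _; rewrite subrr mul0r.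
Qed.

Lemma cvg2D u f v g : (forall k, L2 (u k)) -> (forall k, L2 (v k)) -> L2 f -> L2 g ->
  cvg2 u f -> cvg2 v g -> cvg2 (fun k x => u k x + v k x) (fun x => f x + g x).
Proof.
move=> Lu Lv Lf Lg /cvg2P uf /cvg2P vg; apply/cvg2P.
apply: (@squeeze_cvgr _ _ _ _ (fun=> 0) (fun k => norm2 (fun x => u k x - f x) + norm2 (fun x => v k x - g x))).
- apply: nearW => k; rewrite norm2_ge0 /=.
  rewrite (_ : (fun x => _) = (fun x => (u k x - f x) + (v k x - g x))); last first.
    by apply/funext => x; ring.
  by apply: norm2D; exact: L2B.
- exact: cvg_cst.
- by rewrite -[X in _ --> X](addr0 0); exact: cvgD.
Qed.

Lemma cvg2_mulb (b : T -> R) C u f : measurable_fun setT b -> (forall x, `|b x| <= C) ->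
  (forall k, L2 (u k)) -> L2 f -> cvg2 u f -> cvg2 (fun k x => b x * u k x) (fun x => b x * f x).
Proof.
move=> mb bC Lu Lf; apply: (@cvg2_dominated _ _ _ _ `|C|) => k.
have LB : L2 (fun x => u k x - f x) by exact: L2B.
rewrite -norm2Z//.
apply: norm2_le => [||y].
- by under eq_fun do rewrite -mulrBr; exact: L2_mulb bC _.
- exact: L2Z.
- by rewrite -mulrBr !normrM ler_wpM2r// (le_trans (bC y))// ler_norm.
Qed.

Lemma cvg2_sum (I : Type) (r : seq I) (U : nat -> I -> T -> R) (F : I -> T -> R) :
  (forall k i, L2 (U k i)) -> (forall i, L2 (F i)) -> (forall i, cvg2 (fun k => U k i) (F i)) ->
  cvg2 (fun k x => \sum_(i <- r) U k i x) (fun x => \sum_(i <- r) F i x).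
Proof.
move=> LU LF UF; elim: r => [|i r IH].
  rewrite (_ : (fun k x => _) = (fun=> fun=> 0)); last by apply/funext => k; apply/funext => x; rewrite big_nil.
  by rewrite (_ : (fun x => _) = fun=> 0); [exact: cvg2_cst|apply/funext => x; rewrite big_nil].
rewrite (_ : (fun k x => _) = (fun k x => U k i x + \sum_(j <- r) U k j x)); last first.
  by apply/funext => k; apply/funext => x; rewrite big_cons.
rewrite (_ : (fun x => _) = (fun x => F i x + \sum_(j <- r) F j x)); last first.
  by apply/funext => x; rewrite big_cons.
by apply: cvg2D => // [k|]; exact: L2_sum.
Qed.

Lemma ip2_sub f g h : L2 f -> L2 g -> L2 h -> ip2 (fun x => f x - g x) h = ip2 f h - ip2 g h.
Proof.
move=> Lf Lg Lh; rewrite (_ : (fun x => _) = (fun x => f x + -1 * g x)); last first.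
  by apply/funext => x; rewrite mulN1r.
by rewrite ip2Dl// ?ip2Zl ?mulN1r//; exact: L2Z.
Qed.

Lemma cvg2_ip u f v g : (forall k, L2 (u k)) -> (forall k, L2 (v k)) -> L2 f -> L2 g ->
  cvg2 u f -> cvg2 v g -> ip2 (u k) (v k) @[k --> \oo] --> ip2 f g.
Proof.
move=> Lu Lv Lf Lg /cvg2P uf /cvg2P vg.
pose a k := norm2 (fun x => u k x - f x); pose b k := norm2 (fun x => v k x - g x).
suff h : ip2 (u k) (v k) - ip2 f g @[k --> \oo] --> 0.
  rewrite (_ : (fun k => _) = fun k => (ip2 (u k) (v k) - ip2 f g) + ip2 f g); last first.
    by apply/funext => k; rewrite subrK.
  by rewrite -[X in _ --> X]add0r; apply: cvgD h _; exact: cvg_cst.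
apply: norm_cvg0.
apply: (@squeeze_cvgr _ _ _ _ (fun=> 0) (fun k => a k * (norm2 g + b k) + b k * norm2 f)).
- apply: nearW => k; rewrite normr_ge0 /=.
  have -> : ip2 (u k) (v k) - ip2 f g =
      ip2 (fun x => u k x - f x) (v k) + ip2 (fun x => v k x - g x) f.
    by rewrite !ip2_sub// (ip2C _ (v k) f) (ip2C _ g f); ring.
  apply: le_trans (ler_normD _ _) _; apply: lerD; last by apply: norm2_cauchy_schwarz => //; exact: L2B.
  apply: le_trans (norm2_cauchy_schwarz (L2B (Lu k) Lf) (Lv k)) _.
  apply: ler_wpM2l; first exact: norm2_ge0.
  have e : v k = (fun x => g x + (v k x - g x)) by apply/funext => x; ring.
  by rewrite [X in norm2 X <= _]e; apply: norm2D => //; exact: L2B.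
- exact: cvg_cst.
- rewrite (_ : 0 = 0 * (norm2 g + 0) + 0 * norm2 f); last by ring.
  apply: cvgD; last by apply: cvgM => //; exact: cvg_cst.
  by apply: cvgM => //; apply: cvgD => //; exact: cvg_cst.
Qed.

(** The form in which the a priori estimate is used: w will be L u_k, which converges, and u a
    weighted derivative of u_k. *)
Lemma riesz_fischer_dominated u w g C : 0 <= C -> (forall k, L2 (u k)) -> (forall k, L2 (w k)) -> L2 g -> cvg2 w g ->
  (forall k l, norm2 (fun x => u k x - u l x) <= C * norm2 (fun x => w k x - w l x)) ->
  exists2 f, L2 f & cvg2 u f.
Proof.
move=> C0 Lu Lw Lg wg h; apply: riesz_fischer => // e e0.
have C1 : 0 < C + 1 by rewrite ltr_wpDl.
pose e1 := e / (2 * (C + 1)).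
have e10 : 0 < e1 by rewrite divr_gt0// mulr_gt0.
have [N hN] := wg _ e10; exists N => m Nm; apply: le_trans (h m N) _.
apply: (@le_trans _ _ ((C + 1) * (e1 + e1))); last first.
  by rewrite le_eqVlt; apply/orP; left; apply/eqP; rewrite /e1; field; rewrite gt_eqF.
apply: (@le_trans _ _ (C * (e1 + e1))); last by rewrite ler_wpM2r ?lerDl ?addr_ge0 ?ltW.
apply: ler_wpM2l => //.
rewrite (_ : (fun x => _) = (fun x => (w m x - g x) + - (w N x - g x))); last first.
  by apply/funext => x; ring.
apply: le_trans (norm2D _ _) _; [exact: L2B|by apply: L2N; exact: L2B|].
by rewrite norm2N; apply: lerD; exact: hN.
Qed.

End cvg2_theory.

Lemma powR_omegaS {R : realType} n (x : 'rV[R]_n) p : omega x `^ (p + 1) = omega x * omega x `^ p.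
Proof.
rewrite powRD; last by apply/implyP => _; rewrite gt_eqF// omega_gt0.
by rewrite powRr1 ?(ltW (omega_gt0 x))// mulrC.
Qed.

Lemma powR_omega_1B {R : realType} n (x : 'rV[R]_n) b : omega x `^ (1 - b) = omega x * omega x `^ (- b).
Proof. by rewrite addrC powR_omegaS. Qed.

Lemma powR_omega_2B {R : realType} n (x : 'rV[R]_n) b : omega x `^ (2 - b) = omega x ^+ 2 * omega x `^ (- b).
Proof. by rewrite (_ : 2 - b = - b + 1 + 1) ?powR_omegaS ?mulrA//; ring. Qed.

(* [t i j] stands for the third derivative d_i d_j d_j u and [d1], [d2], [y] for
   the first two derivatives and the point; the third derivatives cancel. *)
Lemma div_field1_alg {R : realType} {I : finType} (c o w : R) (y d1 : I -> R) (d2 t : I -> I -> R) :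
  \sum_i ((c * (o * w)) * (2 * y i) * (\sum_j d2 i j * d1 j + - ((\sum_j d2 j j) * d1 i))
    + o ^+ 2 * w * (\sum_j (t j i * d1 j + d2 i j * d2 i j)
      + - ((\sum_j t i j) * d1 i + (\sum_j d2 j j) * d2 i i))) =
  w * (o ^+ 2 * (\sum_i \sum_j d2 i j ^+ 2 - (\sum_i d2 i i) ^+ 2)
    + 2 * c * o * ((\sum_i y i * \sum_j d2 i j * d1 j) - (\sum_i d2 i i) * \sum_i y i * d1 i)).
Proof.
set l := \sum_j d2 j j.
rewrite (eq_bigr (fun i => c * (o * w) * 2 * (y i * \sum_j d2 i j * d1 j)
  + - (c * (o * w) * 2 * l) * (y i * d1 i)
  + o ^+ 2 * w * (\sum_j t j i * d1 j) + o ^+ 2 * w * (\sum_j d2 i j ^+ 2)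
  + - (o ^+ 2 * w) * (\sum_j t i j * d1 i) + - (o ^+ 2 * w * l) * d2 i i)); last first.
  move=> i _; rewrite big_split /=.
  under [X in _ * (_ + X + _)]eq_bigr do rewrite -expr2.
  by rewrite -[X in _ + _ + _ + _ + _ * X + _]mulr_suml; ring.
rewrite !big_split /= -!mulr_sumr.
have ex : \sum_i \sum_j t j i * d1 j = \sum_i \sum_j t i j * d1 i by exact: exchange_big.
rewrite ex; rewrite -/l; ring.
Qed.

(** * The integrated Bochner identity *)

(* The derivatives are abstract so that the same expressions serve for classical
   and for weak derivatives. *)
Section expressions.
Context {R : realType} {n : nat}.
Variables (beta : R) (d1 : 'I_n -> 'rV[R]_n -> R) (d2 : 'I_n -> 'I_n -> 'rV[R]_n -> R).
Implicit Types x : 'rV[R]_n.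

Definition lapl x : R := \sum_i d2 i i x.
Definition radial x : R := \sum_i x ord0 i * d1 i x.
Definition gradsq x : R := \sum_i d1 i x ^+ 2.
Definition hesssq x : R := \sum_i \sum_j d2 i j x ^+ 2.
Definition hess_radial x : R := \sum_i x ord0 i * \sum_j d2 i j x * d1 j x.
Definition cauchy_expr x : R := omega x * lapl x - 2 * (beta - 1) * radial x.

(** The divergence form of the operator: the divergence of this field is omega^(-beta) L u. It
    yields the symmetry of L, while the other three fields yield the Bochner identity. *)
Definition field0 i x := omega x `^ (1 - beta) * d1 i x.
Definition field1 i x := omega x `^ (2 - beta) * (\sum_j d2 i j x * d1 j x + - (lapl x * d1 i x)).
Definition field2 i x := omega x `^ (1 - beta) * ((\sum_j d1 j x * d1 j x) * x ord0 i).
Definition field3 i x := omega x `^ (1 - beta) * (radial x * d1 i x).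

Definition bochner_density x : R :=
  n%:R / (n%:R - 1) * (omega x ^+ 2 * hesssq x - n%:R^-1 * (omega x * lapl x) ^+ 2)
  + 4 * (beta - 1) * ((n%:R + 1 - beta) / (n%:R - 1)) * (gradsq x * sqnorm x - radial x ^+ 2).

End expressions.

Section divergence.
Context {R : realType} {n : nat}.
Variables (beta : R) (d1 : 'I_n -> 'rV[R]_n -> R) (d2 : 'I_n -> 'I_n -> 'rV[R]_n -> R)
  (d3 : 'I_n -> 'I_n -> 'I_n -> 'rV[R]_n -> R).
Hypotheses (h1 : forall i j, has_partial i (d1 j) (d2 i j))
  (h2 : forall i j k, has_partial i (d2 j k) (d3 i j k))
  (d2C : forall i j x, d2 i j x = d2 j i x) (d3C : forall i j x, d3 i i j x = d3 j i i x).
Implicit Types x : 'rV[R]_n.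
Local Notation w := (fun x : 'rV[R]_n => omega x `^ (- beta)).
Local Notation lapl := (lapl d2).
Local Notation radial := (radial d1).
Local Notation gradsq := (gradsq d1).
Local Notation hesssq := (hesssq d2).
Local Notation hess_radial := (hess_radial d1 d2).

Lemma div_field0 : exists2 dv, forall i, has_partial i (field0 beta d1 i) (dv i) &
  forall x, \sum_i dv i x = w x * cauchy_expr beta d1 d2 x.
Proof.
eexists => [i|x]; first exact: (has_partialM (@has_partial_powR_omega R n i (1 - beta)) (h1 i i)).
rewrite /= (eq_bigr (fun i => (1 - beta) * 2 * w x * (x ord0 i * d1 i x) + omega x * w x * d2 i i x)); last first.
  move=> i _; rewrite powR_omega_1B (_ : 1 - beta - 1 = - beta); last by ring.
  ring.
by rewrite big_split /= -!mulr_sumr /cauchy_expr -/(lapl x) -/(radial x); ring.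
Qed.

(** The combination Hess u du - (Lap u) du is chosen so that the third derivatives in its divergence
    cancel; what remains, besides the derivative of the weight, is |Hess u|^2 - (Lap u)^2. *)
Lemma div_field1 : exists2 dv, forall i, has_partial i (field1 beta d1 d2 i) (dv i) &
  forall x, \sum_i dv i x = w x * (omega x ^+ 2 * (hesssq x - lapl x ^+ 2) +
         2 * (2 - beta) * omega x * (hess_radial x - lapl x * radial x)).
Proof.
eexists => [i|x].
  have a2 := @has_partial_sum R n i _ (index_enum 'I_n) _ _ (fun j => has_partialM (h2 i i j) (h1 i j)).
  have al := @has_partial_sum R n i _ (index_enum 'I_n) _ _ (fun j => h2 i j j).
  exact: (has_partialM (@has_partial_powR_omega R n i (2 - beta)) (has_partialD a2 (has_partialN (has_partialM al (h1 i i))))).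
have w1 : omega x `^ (2 - beta - 1) = omega x * w x.
  by rewrite -powR_omega_1B; congr (_ `^ _); ring.
rewrite /=.
under eq_bigr => i _ do [rewrite w1 powR_omega_2B; under [X in _ + _ * (X + _)]eq_bigr do rewrite d3C].
exact: (@div_field1_alg _ _ (2 - beta) (omega x) (w x) (x ord0) (d1 ^~ x) (fun i j => d2 i j x) (fun i j => d3 i j j x)).
Qed.

Lemma div_field2 : exists2 dv, forall i, has_partial i (field2 beta d1 i) (dv i) &
  forall x, \sum_i dv i x =
  w x * (2 * omega x * hess_radial x + gradsq x * (n%:R * omega x - 2 * (beta - 1) * sqnorm x)).
Proof.
eexists => [i|x].
  have a2 := @has_partial_sum R n i _ (index_enum 'I_n) _ _ (fun j => has_partialM (h1 i j) (h1 i j)).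
  exact: (has_partialM (@has_partial_powR_omega R n i (1 - beta)) (has_partialM a2 (@has_partial_coord R n i i))).
have gE : \sum_j d1 j x * d1 j x = gradsq x by apply: eq_bigr => j _; rewrite expr2.
rewrite /= (eq_bigr (fun i => (1 - beta) * w x * 2 * gradsq x * (x ord0 i * x ord0 i)
   + omega x * w x * 2 * (x ord0 i * \sum_j d2 i j x * d1 j x) + omega x * w x * gradsq x)); last first.
  move=> i _; rewrite gE powR_omega_1B eqxx (_ : 1 - beta - 1 = - beta); last by ring.
  rewrite big_split /=; under [X in _ + _ * ((_ + X) * _ + _)]eq_bigr do rewrite mulrC.
  by rewrite mulr1; ring.
rewrite !big_split /= -!mulr_sumr sumr_const card_ord -/(dotv x x) -/(sqnorm x).
by rewrite -/(hess_radial x) -mulr_natl; ring.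
Qed.

Lemma div_field3 : exists2 dv, forall i, has_partial i (field3 beta d1 i) (dv i) &
  forall x, \sum_i dv i x =
  w x * (omega x * (lapl x * radial x + gradsq x + hess_radial x) - 2 * (beta - 1) * radial x ^+ 2).
Proof.
eexists => [i|x].
  have a2 := @has_partial_sum R n i _ (index_enum 'I_n) _ _ (fun j => has_partialM (@has_partial_coord R n i j) (h1 i j)).
  exact: (has_partialM (@has_partial_powR_omega R n i (1 - beta)) (has_partialM a2 (h1 i i))).
have s1 i : \sum_j (j == i)%:R * d1 j x = d1 i x.
  rewrite (bigD1 i)//= eqxx mul1r big1 ?addr0// => j /negbTE ->.
  by rewrite mul0r.
have hE : \sum_i (\sum_j x ord0 j * d2 i j x) * d1 i x = hess_radial x.
  under eq_bigr do rewrite mulr_suml.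
  rewrite exchange_big /=; apply: eq_bigr => i _; rewrite mulr_sumr; apply: eq_bigr => j _.
  by rewrite d2C mulrA.
rewrite /= (eq_bigr (fun i => (1 - beta) * w x * 2 * radial x * (x ord0 i * d1 i x)
   + omega x * w x * (d1 i x ^+ 2) + omega x * w x * ((\sum_j x ord0 j * d2 i j x) * d1 i x)
   + omega x * w x * radial x * d2 i i x)); last first.
  move=> i _; rewrite powR_omega_1B (_ : 1 - beta - 1 = - beta); last by ring.
  by rewrite big_split /= s1 -/(radial x); ring.
by rewrite !big_split /= -!mulr_sumr hE -/(radial x) -/(gradsq x) -/(lapl x); ring.
Qed.

(** Multiplication by n - 1 clears the denominators. The coefficient -n of the first divergence is
    forced by the Hessian terms, that of the third by the product of [lapl] and [radial], and that
    of the second by the cancellation of [hess_radial]. The terms in [gradsq] and [radial] squared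
    then match, which is where 4 (beta - n/2 - 1) and n + 1 - beta come from. *)
Lemma bochner_div x : (1 < n)%N ->
  (n%:R - 1) * (cauchy_expr beta d1 d2 x ^+ 2 - 4 * (beta - n%:R / 2 - 1) * (omega x * gradsq x)
    - bochner_density beta d1 d2 x) =
  - n%:R * (omega x ^+ 2 * (hesssq x - lapl x ^+ 2) +
         2 * (2 - beta) * omega x * (hess_radial x - lapl x * radial x))
  + (2 * n%:R - 2 * (beta - 1)) *
    (2 * omega x * hess_radial x + gradsq x * (n%:R * omega x - 2 * (beta - 1) * sqnorm x))
  + (- 2 * n%:R * (beta - 1) + 4 * (beta - 1) - 2 * n%:R) *
    (omega x * (lapl x * radial x + gradsq x + hess_radial x) - 2 * (beta - 1) * radial x ^+ 2).
Proof.
move=> n_gt1.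
have n0 : n%:R != 0 :> R by rewrite pnatr_eq0 -lt0n (ltn_trans _ n_gt1).
have n1 : n%:R - 1 != 0 :> R by rewrite subr_eq0 (eqr_nat _ n 1) gtn_eqF.
rewrite /bochner_density /cauchy_expr /omega; field.
by apply/andP; split.
Qed.

End divergence.

Section quadratic.
Context {R : realType} {n : nat}.
Implicit Types x y : 'rV[R]_n.

Lemma dotvC x y : dotv x y = dotv y x.
Proof. by apply: eq_bigr => i _; rewrite mulrC. Qed.

Lemma dotv_sqr_le x y : dotv x y ^+ 2 <= sqnorm x * sqnorm y.
Proof.
apply: (@ip_sqr_le R _ dotv) => [a b|a b c|a b c|a].
- exact: dotvC.
- by rewrite /dotv -big_split /=; apply: eq_bigr => i _; rewrite mxE mulrDl.
- by rewrite /dotv mulr_sumr; apply: eq_bigr => i _; rewrite mxE mulrA.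
- exact: sqnorm_ge0.
Qed.

Lemma radial_le (d1 : 'I_n -> 'rV[R]_n -> R) x : radial d1 x ^+ 2 <= gradsq d1 x * sqnorm x.
Proof.
have := dotv_sqr_le (\row_i d1 i x) x; congr (_ ^+ 2 <= _ * _).
  by rewrite dotvC; apply: eq_bigr => i _; rewrite mxE.
by apply: eq_bigr => i _; rewrite mxE expr2.
Qed.

Lemma lapl_le (d2 : 'I_n -> 'I_n -> 'rV[R]_n -> R) x : lapl d2 x ^+ 2 <= n%:R * hesssq d2 x.
Proof.
have := dotv_sqr_le (\row_i d2 i i x) (\row_i 1).
rewrite (_ : dotv _ _ = lapl d2 x); last by apply: eq_bigr => i _; rewrite !mxE mulr1.
rewrite [X in _ * X](_ : _ = n%:R); last first.
  rewrite /sqnorm /dotv (eq_bigr (fun=> 1)); last by move=> i _; rewrite mxE mulr1.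
  by rewrite sumr_const card_ord.
move=> /le_trans; apply; rewrite mulrC ler_wpM2l// /sqnorm /dotv /hesssq.
apply: ler_sum => i _; rewrite mxE -expr2 (bigD1 i)//= lerDl.
by apply: sumr_ge0 => j _; exact: sqr_ge0.
Qed.

Lemma gradsq_ge0 (d1 : 'I_n -> 'rV[R]_n -> R) x : 0 <= gradsq d1 x.
Proof. by apply: sumr_ge0 => i _; exact: sqr_ge0. Qed.

(** The gradient term is nonnegative by Cauchy-Schwarz and beta <= n + 1; the trace-free part of the
    Hessian is nonnegative and its factor n/(n - 1) is at least 1. *)
Lemma bochner_density_ge (beta : R) (d1 : 'I_n -> 'rV[R]_n -> R) (d2 : 'I_n -> 'I_n -> 'rV[R]_n -> R) x :
  (1 < n)%N -> 1 <= beta -> beta <= n%:R + 1 ->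
  omega x ^+ 2 * hesssq d2 x <= bochner_density beta d1 d2 x + n%:R^-1 * (omega x * lapl d2 x) ^+ 2.
Proof.
move=> n1 b1 bn; have nn1 : (1 : R) < n%:R by rewrite (ltr_nat _ 1).
have nm1 : 0 < n%:R - 1 :> R by rewrite subr_gt0.
rewrite /bochner_density -lerBlDr; apply: ler_wpDr.
  rewrite mulr_ge0// ?subr_ge0; last exact: radial_le.
  by rewrite mulr_ge0 ?divr_ge0 ?mulr_ge0 ?subr_ge0 ?(ltW nn1).
set q := (X in X <= _); rewrite -[leLHS]mul1r; apply: ler_wpM2r; last first.
  by rewrite ler_pdivlMr// mul1r gerBl.
rewrite /q subr_ge0 exprMn mulrCA ler_wpM2l ?sqr_ge0// ler_pdivrMl ?lapl_le//.
exact: lt_trans nn1.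
Qed.

End quadratic.

(** * Integration against the Cauchy probability *)

Section test_L2.
Context {R : realType} {n : nat}.
Implicit Types u v : 'rV[R]_n -> R.

Lemma partialCC i j x u : smooth u -> partial i (partial i (partial j u)) x = partial j (partial i (partial i u)) x.
Proof.
move=> su; have e : partial i (partial j u) = partial j (partial i u).
  by apply/funext => y; exact: partialC.
apply: (@etrans _ _ (partial i (partial j (partial i u)) x)).
  exact: (congr1 (fun f => partial i f x) e).
exact: (partialC i j x (smooth_partial i su)).
Qed.

Lemma test_bounded u : test_function u -> exists C, forall x, `|u x| <= C.
Proof.
move=> tu; have [M hM] := test_supp tu.
have [C hC] := @continuous_bounded_box R n M u (smooth_continuous (test_smooth tu)).
exists (Num.max C 0) => x; have [xM|/hM ->] := pselect (box M x).
  by rewrite le_max hC.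
by rewrite normr0 le_max lexx orbT.
Qed.

Lemma test_measurable u : test_function u -> measurable_fun setT u.
Proof. by move=> tu; apply: continuous_measurable_rV; apply: smooth_continuous; exact: test_smooth. Qed.

Lemma test_L2 (mu : probability 'rV[R]_n R) u : test_function u -> u \in Lfun mu 2%:E.
Proof.
move=> tu; have [C hC] := test_bounded tu.
by apply: L2_bounded hC; exact: test_measurable.
Qed.

Lemma testM u v : test_function u -> test_function v -> test_function (fun x => u x * v x).
Proof. by move=> tu tv; apply: testMl => //; exact: test_smooth. Qed.

Lemma test_sqr u : test_function u -> test_function (fun x => u x ^+ 2).
Proof.
move=> tu; rewrite (_ : (fun x => _) = fun x => u x * u x); first exact: testM.
by apply/funext => x; rewrite expr2.
Qed.

Lemma testB u v : test_function u -> test_function v -> test_function (fun x => u x - v x).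
Proof.
move=> tu tv; rewrite (_ : (fun x => _) = fun x => u x + -1 * v x).
  by apply: testD => //; exact: testZ.
by apply/funext => x; rewrite mulN1r.
Qed.

Lemma has_partialZ i (c : R) u u' : has_partial i u u' ->
  has_partial i (fun x => c * u x) (fun x => c * u' x).
Proof.
move=> h; rewrite (_ : (fun x => c * u' x) = fun x => 0 * u x + c * u' x).
  by apply: has_partialM => //; exact: has_partial_cst.
by apply/funext => x; rewrite mul0r add0r.
Qed.

Lemma partialB u v : smooth u -> smooth v -> forall i,
  partial i (fun x => u x - v x) = fun x => partial i u x - partial i v x.
Proof.
move=> su sv i; apply: has_partialE; apply: has_partialD; last apply: has_partialN; exact: smooth_has_partial.
Qed.

End test_L2.

Section bochner.
Context {R : realType} {n : nat} (beta : R).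
Hypotheses (n1 : (1 < n)%N) (beta_gt : n%:R / 2 + 1 < beta) (beta_le : beta <= n%:R + 1).
Local Notation mu := (cauchy_prob n beta).
Local Notation leb := (@lebesgue_rV R n).
Local Notation "u ^1" := (fun i => partial i u) (at level 2, format "u ^1").
Local Notation "u ^2" := (fun i j => partial i (partial j u)) (at level 2, format "u ^2").
Implicit Types (u v : 'rV[R]_n -> R) (x : 'rV[R]_n).

Lemma bochner_n_gt0 : (0 < n)%N. Proof. exact: ltn_trans n1. Qed.
Lemma bochner_beta_gt : n%:R / 2 < beta.
Proof. by apply: lt_trans beta_gt; rewrite ltrDl. Qed.
Let n0 := bochner_n_gt0.
Let b0 := bochner_beta_gt.

(** The weight omega^(-beta) turns the divergence with respect to Lebesgue measure into an integrand
    for mu; each partial derivative of a test function integrates to 0. *)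
Lemma integral_div (F dF : 'I_n -> 'rV[R]_n -> R) (g : 'rV[R]_n -> R) :
  (forall i, test_function (F i)) -> (forall i, has_partial i (F i) (dF i)) -> measurable_fun setT g ->
  (forall x, \sum_i dF i x = omega x `^ (- beta) * g x) -> (\int[mu]_x g x)%R = 0.
Proof.
move=> tF hF mg E; rewrite /Rintegral integral_cauchy//.
have h x : g x * cauchy_pdf beta x = \sum_i (cauchy_Z n beta)^-1 * dF i x.
  by rewrite -mulr_sumr E /cauchy_pdf; ring.
under eq_integral do rewrite h -sumEFin.
rewrite integral_sum//; last first.
  move=> i; apply: (@integrable_test R n (fun x => (cauchy_Z n beta)^-1 * dF i x)).
  by apply: testZ; rewrite -(has_partialE (hF i)); exact: test_partial.
rewrite big1// => i _; under eq_integral do rewrite EFinM.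
rewrite integralZl//; last first.
  by apply: (@integrable_test R n (dF i)); rewrite -(has_partialE (hF i)); exact: test_partial.
by rewrite -(has_partialE (hF i)) integral_partial_test// mule0.
Qed.

Lemma cauchy_opE u x : cauchy_op beta u x = cauchy_expr beta u^1 u^2 x.
Proof.
rewrite /cauchy_op /laplacian /dotv /cauchy_expr; congr (_ - _ * _).
by apply: eq_bigr => i _; rewrite mxE.
Qed.

(** The square root of omega, written as a power so that the smoothness of powers of omega
    applies. *)
Definition rho x := omega x `^ 2^-1.

Lemma rho_gt0 x : 0 < rho x.
Proof. by rewrite powR_gt0// omega_gt0. Qed.

Lemma rho_sqr x : rho x ^+ 2 = omega x.
Proof.
by rewrite -powR_mulrn ?powR_ge0// -powRrM mulVf ?pnatr_eq0// powRr1// ltW// omega_gt0.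
Qed.

(** A sum of squared L^2 norms rather than one integral, so that estimates can be made component by
    component. *)
Definition energy u : R := \sum_i @ip2 _ _ _ mu (fun x => rho x * partial i u x) (fun x => rho x * partial i u x).

Lemma test_rho_partial u i : test_function u -> test_function (fun x => rho x * partial i u x).
Proof. by move=> tu; apply: testMl; [exact: smooth_powR_omega|exact: test_partial]. Qed.

Lemma test_omega_partial2 u i j : test_function u -> test_function (fun x => omega x * partial i (partial j u) x).
Proof. by move=> tu; apply: testMl; [exact: smooth_omega|do 2 apply: test_partial]. Qed.

Lemma Rintegral_sum_test (F : 'I_n -> 'rV[R]_n -> R) : (forall i, mu.-integrable setT (EFin \o F i)) ->
  (\int[mu]_x (\sum_i F i x))%R = \sum_i (\int[mu]_x F i x)%R.
Proof.
move=> iF; rewrite /Rintegral; under eq_integral do rewrite -sumEFin.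
rewrite integral_sum; [|done..].
rewrite -sum_fine // => i _; have := iF i; move=> /integrable_fin_num; exact.
Qed.

Lemma energyE u : test_function u -> energy u = (\int[mu]_x (omega x * gradsq u^1 x))%R.
Proof.
move=> tu; rewrite /energy /ip2 -Rintegral_sum_test.
  apply: eq_Rintegral => x _; rewrite mulr_sumr; apply: eq_bigr => i _.
  by rewrite mulrACA -expr2 rho_sqr -expr2.
by move=> i; apply: integrableM_L2; apply: test_L2; exact: test_rho_partial.
Qed.

Let has1 u : test_function u -> forall i, has_partial i u (partial i u).
Proof. by move=> tu i; apply: smooth_has_partial; exact: test_smooth. Qed.
Let has2 u : test_function u -> forall i j, has_partial i (u^1 j) (u^2 i j).
Proof. by move=> tu i j; apply: has1; exact: test_partial. Qed.
Let has3 u : test_function u -> forall i j k, has_partial i (u^2 j k) (partial i (u^2 j k)).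
Proof. by move=> tu i j k; apply: has1; do 2 apply: test_partial. Qed.

Lemma integral_cauchy_op u : test_function u -> (\int[mu]_x cauchy_op beta u x)%R = 0.
Proof.
move=> tu; have [dv hdv E] := @div_field0 R n beta u^1 u^2 (has2 tu).
apply: (integral_div _ hdv).
- by move=> i; apply: testMl; [exact: smooth_powR_omega|exact: test_partial].
- by apply: test_measurable; exact: test_cauchy_op.
- by move=> x; rewrite E cauchy_opE.
Qed.

(** The field v omega^(1-beta) du has divergence omega^(-beta) (v L u + omega <dv, du>). *)
Lemma ip2_cauchy_op u v : test_function u -> test_function v ->
  @ip2 _ _ _ mu v (cauchy_op beta u) = - \sum_i @ip2 _ _ _ mu (fun x => rho x * partial i v x) (fun x => rho x * partial i u x).
Proof.
move=> tu tv; have [dv hdv E] := @div_field0 R n beta u^1 u^2 (has2 tu).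
pose F i x := v x * field0 beta u^1 i x.
pose dF i x := partial i v x * field0 beta u^1 i x + v x * dv i x.
have iv i : mu.-integrable setT (EFin \o (fun x => (rho x * partial i v x) * (rho x * partial i u x))).
  by apply: integrableM_L2; apply: test_L2; exact: test_rho_partial.
have mS : test_function (fun x => \sum_i (rho x * partial i v x) * (rho x * partial i u x)).
  by apply: test_sum => i; apply: testM; exact: test_rho_partial.
have tL : test_function (fun x => v x * cauchy_op beta u x).
  by apply: testM => //; exact: test_cauchy_op.
have /eqP : (\int[mu]_x (v x * cauchy_op beta u x + \sum_i (rho x * partial i v x) * (rho x * partial i u x)))%R = 0.
  apply: (@integral_div F dF).
  - by move=> i; apply: testM => //; apply: testMl; [exact: smooth_powR_omega|exact: test_partial].
  - by move=> i; apply: has_partialM; [exact: has1|exact: hdv].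
  - by apply: test_measurable; exact: testD.
  - move=> x; rewrite big_split /= -mulr_sumr E cauchy_opE [LHS]addrC [RHS]mulrDr; congr (_ + _); first by ring.
    rewrite mulr_sumr; apply: eq_bigr => i _; rewrite mulrACA -expr2 rho_sqr /field0 powR_omega_1B; ring.
rewrite RintegralD//; [|by apply: integrable_L2; exact: test_L2..].
by rewrite Rintegral_sum_test// addr_eq0 => /eqP.
Qed.

Lemma ip2_cauchy_op_energy u : test_function u -> @ip2 _ _ _ mu u (cauchy_op beta u) = - energy u.
Proof. by move=> tu; rewrite ip2_cauchy_op. Qed.

Lemma cauchy_op_sym u v : test_function u -> test_function v ->
  @ip2 _ _ _ mu v (cauchy_op beta u) = @ip2 _ _ _ mu (cauchy_op beta v) u.
Proof.
move=> tu tv; apply: etrans (ip2_cauchy_op tu tv) _; apply: esym.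
apply: etrans (ip2C _ _ _) _; apply: etrans (ip2_cauchy_op tv tu) _; congr (- _).
by apply: eq_bigr => i _; rewrite ip2C.
Qed.

Lemma energy_ge0 u : 0 <= energy u.
Proof. by apply: sumr_ge0 => i _; exact: ip2_ge0. Qed.

Lemma test_lapl u : test_function u -> test_function (lapl u^2).
Proof. by move=> tu; apply: test_sum => i; do 2 apply: test_partial. Qed.

Lemma test_radial u : test_function u -> test_function (radial u^1).
Proof. by move=> tu; apply: test_sum => i; apply: testMl; [exact: smooth_coord|exact: test_partial]. Qed.

Lemma test_gradsq u : test_function u -> test_function (gradsq u^1).
Proof. by move=> tu; apply: test_sum => i; apply: test_sqr; exact: test_partial. Qed.

Lemma test_hesssq u : test_function u -> test_function (hesssq u^2).
Proof. by move=> tu; apply: test_sum => i; apply: test_sum => j; apply: test_sqr; do 2 apply: test_partial. Qed.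

Lemma test_bochner_density u : test_function u -> test_function (bochner_density beta u^1 u^2).
Proof.
move=> tu; apply: testD; apply: testZ; apply: testB.
- apply: testMl; last exact: test_hesssq.
  by apply: smoothM; exact: smooth_omega.
- apply: testZ; apply: test_sqr; apply: testMl; [exact: smooth_omega|exact: test_lapl].
- rewrite (_ : (fun x => _) = fun x => sqnorm x * gradsq u^1 x); last by apply/funext => x; rewrite mulrC.
  apply: testMl; last exact: test_gradsq.
  by apply: smooth_sum => i; apply: smoothM; exact: smooth_coord.
- by apply: test_sqr; exact: test_radial.
Qed.

Theorem integral_bochner u : test_function u -> (\int[mu]_x bochner_density beta u^1 u^2 x)%R =
  @ip2 _ _ _ mu (cauchy_op beta u) (cauchy_op beta u) - 4 * (beta - n%:R / 2 - 1) * energy u.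
Proof.
move=> tu.
have d2C i j x : u^2 i j x = u^2 j i x by apply: partialC; exact: test_smooth.
have d3C i j x : partial i (u^2 i j) x = partial j (u^2 i i) x by exact: (partialCC i j x (test_smooth tu)).
have [v1 h1 E1] := @div_field1 R n beta u^1 u^2 _ (has2 tu) (has3 tu) d3C.
have [v2 h2 E2] := @div_field2 R n beta u^1 u^2 (has2 tu).
have [v3 h3 E3] := @div_field3 R n beta u^1 u^2 (has2 tu) d2C.
set c1 : R := - n%:R; set c2 : R := 2 * n%:R - 2 * (beta - 1).
set c3 : R := - 2 * n%:R * (beta - 1) + 4 * (beta - 1) - 2 * n%:R.
pose F i x := c1 * field1 beta u^1 u^2 i x + c2 * field2 beta u^1 i x + c3 * field3 beta u^1 i x.
pose dF i x := c1 * v1 i x + c2 * v2 i x + c3 * v3 i x.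
pose lam := 4 * (beta - n%:R / 2 - 1).
have tL := test_cauchy_op beta tu.
have tL2 : test_function (fun x => cauchy_op beta u x * cauchy_op beta u x) by exact: testM.
have tE : test_function (fun x => lam * (omega x * gradsq u^1 x)).
  by apply: testZ; apply: testMl; [exact: smooth_omega|exact: test_gradsq].
have tQ := test_bochner_density tu.
have int f : test_function f -> mu.-integrable setT (EFin \o f).
  by move=> tf; apply: integrable_L2; exact: test_L2.
have nm1 : n%:R - 1 != 0 :> R by rewrite subr_eq0 (eqr_nat _ n 1) gtn_eqF.
have : (\int[mu]_x ((n%:R - 1) * (cauchy_op beta u x * cauchy_op beta u x - lam * (omega x * gradsq u^1 x)
    - bochner_density beta u^1 u^2 x)))%R = 0.
  apply: (@integral_div F dF).
  - move=> i; apply: testD; [apply: testD|]; apply: testZ; (apply: testMl; first exact: smooth_powR_omega).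
    + apply: testD; first by apply: test_sum => j; apply: testM; [do 2 apply: test_partial|exact: test_partial].
      rewrite (_ : (fun x => _) = fun x => -1 * (lapl u^2 x * partial i u x)).
        by apply: testZ; apply: testM; [exact: test_lapl|exact: test_partial].
      by apply/funext => x; rewrite mulN1r.
    + rewrite (_ : (fun x => _) = fun x => x ord0 i * \sum_j partial j u x * partial j u x); last first.
        by apply/funext => x; rewrite mulrC.
      by apply: testMl; [exact: smooth_coord|apply: test_sum => j; apply: testM; exact: test_partial].
    + by apply: testM; [exact: test_radial|exact: test_partial].
  - by move=> i; apply: has_partialD; [apply: has_partialD|]; apply: has_partialZ.
  - by apply: test_measurable; apply: testZ; apply: testB => //; exact: testB.
  - move=> x; rewrite !big_split /= -!mulr_sumr E1 E2 E3 -expr2 cauchy_opE bochner_div//.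
    by rewrite -/c1 -/c2 -/c3; ring.
rewrite RintegralZl//; last by apply: int; apply: testB => //; exact: testB.
move/eqP; rewrite mulf_eq0 (negbTE nm1) /= RintegralB//; [|by apply: int; exact: testB|exact: int].
rewrite RintegralB//; [|exact: int..].
rewrite RintegralZl//; last by apply: int; apply: testMl; [exact: smooth_omega|exact: test_gradsq].
by rewrite -energyE// subr_eq0 => /eqP <-.
Qed.

End bochner.

Lemma hesssq_ge {R : realType} {n : nat} (d2 : 'I_n -> 'I_n -> 'rV[R]_n -> R) i j x :
  (omega x * d2 i j x) * (omega x * d2 i j x) <= omega x ^+ 2 * hesssq d2 x.
Proof.
rewrite mulrACA -!expr2 ler_wpM2l ?sqr_ge0// /hesssq (bigD1 i)//= (bigD1 j)//= -addrA lerDl.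
by rewrite addr_ge0// sumr_ge0// => k _; rewrite ?sqr_ge0// sumr_ge0// => l _; rewrite sqr_ge0.
Qed.

Section apriori.
Context {R : realType} {n : nat} (beta : R).
Hypotheses (n1 : (1 < n)%N) (beta_gt : n%:R / 2 + 1 < beta) (beta_le : beta <= n%:R + 1).
Local Notation mu := (cauchy_prob n beta).
Local Notation ip2 := (@ip2 _ _ _ mu).
Local Notation norm2 := (@norm2 _ _ _ mu).
Local Notation "u ^1" := (fun i => partial i u) (at level 2, format "u ^1").
Local Notation "u ^2" := (fun i j => partial i (partial j u)) (at level 2, format "u ^2").
Implicit Types (u v : 'rV[R]_n -> R) (x : 'rV[R]_n).

Definition gap : R := 4 * (beta - n%:R / 2 - 1).

Lemma gap_gt0 : 0 < gap.
Proof. by rewrite /gap; move: beta_gt; lra. Qed.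

Let beta_ge1 : 1 <= beta.
Proof. by apply/ltW/(le_lt_trans _ beta_gt); rewrite lerDr divr_ge0. Qed.

Lemma integrable_test_cauchy f : test_function f -> mu.-integrable setT (EFin \o f).
Proof. by move=> tf; apply: integrable_L2; exact: test_L2. Qed.

Lemma le_Rintegral_test f g : test_function f -> test_function g -> (forall x, f x <= g x) ->
  (\int[mu]_x f x)%R <= (\int[mu]_x g x)%R.
Proof.
by move=> tf tg fg; apply: le_Rintegral => //; exact: integrable_test_cauchy.
Qed.

Lemma energy_gap u : test_function u -> gap * energy beta u <= ip2 (cauchy_op beta u) (cauchy_op beta u).
Proof.
move=> tu; rewrite -subr_ge0 -(integral_bochner n1 beta_gt tu).
apply: Rintegral_ge0 => x _.
apply: (@le_trans _ _ (omega x ^+ 2 * hesssq u^2 x - n%:R^-1 * (omega x * lapl u^2 x) ^+ 2)).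
  rewrite subr_ge0 exprMn mulrCA ler_wpM2l ?sqr_ge0// ler_pdivrMl ?lapl_le//.
  by rewrite ltr0n ltnW.
by rewrite lerBlDr; exact: bochner_density_ge.
Qed.

(** Applied to differences u_k - u_l, this makes the weighted derivatives Cauchy whenever L u_k
    converges. *)
Lemma apriori : exists2 C, 0 <= C & forall u, test_function u ->
  (forall i, norm2 (fun x => rho x * partial i u x) <= C * norm2 (cauchy_op beta u)) /\
  (forall i j, norm2 (fun x => omega x * partial i (partial j u) x) <= C * norm2 (cauchy_op beta u)).
Proof.
(* With N the squared norm of L u, the energy is at most N / gap, which accounts for the 1. For the
   Hessian, the integral of Q is at most N, and omega Lap u = L u + 2 (beta - 1) [radial] gives
   (omega Lap u)^2 <= 2 (L u)^2 + 8 (beta - 1)^2 omega |du|^2: in total 3N + 8 (beta - 1)^2 N /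
   gap. *)
pose C0 := 3 + (8 * (beta - 1) ^+ 2 + 1) / gap.
have C00 : 0 <= C0 by rewrite addr_ge0// divr_ge0 ?(ltW gap_gt0)// addr_ge0// mulr_ge0// sqr_ge0.
exists (Num.sqrt C0) => [|u tu]; first exact: sqrtr_ge0.
set N := ip2 (cauchy_op beta u) (cauchy_op beta u).
have N0 : 0 <= N by exact: ip2_ge0.
have EN : energy beta u <= N / gap.
  by rewrite ler_pdivlMr ?gap_gt0// mulrC; exact: energy_gap.
have NG : 0 <= N / gap by rewrite divr_ge0// ltW// gap_gt0.
have C0E : C0 * N = 3 * N + (8 * (beta - 1) ^+ 2) * (N / gap) + N / gap by rewrite /C0; ring.
have K0 : 0 <= 8 * (beta - 1) ^+ 2 by rewrite mulr_ge0// sqr_ge0.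
have sq f : ip2 f f <= C0 * N -> norm2 f <= Num.sqrt C0 * norm2 (cauchy_op beta u).
  by move=> h; rewrite -sqrtrM//; exact: ler_wsqrtr.
have tL := test_cauchy_op beta tu.
split=> [i|i j]; apply: sq.
  apply: (@le_trans _ _ (energy beta u)).
    by rewrite /energy (bigD1 i)//= lerDl; apply: sumr_ge0 => j _; exact: ip2_ge0.
  by apply: le_trans EN _; rewrite C0E; have := mulr_ge0 K0 NG; lra.
have tH : test_function (fun x => omega x ^+ 2 * hesssq u^2 x).
  by apply: testMl; [apply: smoothM; exact: smooth_omega|exact: test_hesssq].
have tQ := test_bochner_density beta tu.
have tE : test_function (fun x => omega x * gradsq u^1 x).
  by apply: testMl; [exact: smooth_omega|exact: test_gradsq].
have tLL : test_function (fun x => cauchy_op beta u x * cauchy_op beta u x) by exact: testM.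
apply: (@le_trans _ _ (\int[mu]_x (omega x ^+ 2 * hesssq u^2 x))%R).
  apply: le_Rintegral_test => // [|x].
    by apply: testM; exact: test_omega_partial2.
  exact: (hesssq_ge (fun i j => partial i (partial j u)) i j x).
apply: (@le_trans _ _ (\int[mu]_x (bochner_density beta u^1 u^2 x +
    (2 * (cauchy_op beta u x * cauchy_op beta u x) + 8 * (beta - 1) ^+ 2 * (omega x * gradsq u^1 x))))%R).
  apply: le_Rintegral_test => // [|x].
    by apply: testD => //; apply: testD; exact: testZ.
  apply: (le_trans (bochner_density_ge u^1 u^2 x n1 beta_ge1 beta_le)); apply: lerD; first exact: lexx.
  apply: (@le_trans _ _ ((omega x * lapl u^2 x) ^+ 2)).
    by rewrite ler_piMl ?sqr_ge0// invf_le1 ?ltr0n ?ler1n ltnW.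
  have rE : omega x * lapl u^2 x = cauchy_op beta u x + 2 * (beta - 1) * radial u^1 x.
    by rewrite cauchy_opE /cauchy_expr; ring.
  have h1 : radial u^1 x ^+ 2 <= omega x * gradsq u^1 x.
    apply: le_trans (radial_le _ _) _; rewrite mulrC ler_wpM2r ?gradsq_ge0//.
    by rewrite /omega lerDr.
  rewrite rE; have := sqr_ge0 (cauchy_op beta u x - 2 * (beta - 1) * radial u^1 x).
  have := ler_wpM2l (sqr_ge0 (beta - 1)) h1.
  move: (cauchy_op beta u x) (radial u^1 x) (omega x * gradsq u^1 x) => p q r; nra.
have e1 : (\int[mu]_x (omega x * gradsq u^1 x))%R = energy beta u by rewrite energyE.
rewrite RintegralD//; [|exact: integrable_test_cauchy|apply: integrable_test_cauchy; apply: testD; exact: testZ].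
rewrite (integral_bochner n1 beta_gt tu) -/gap.
rewrite RintegralD; [|by []|exact: (integrable_test_cauchy (testZ 2 tLL))|exact: (integrable_test_cauchy (testZ (8 * (beta - 1) ^+ 2) tE))].
rewrite RintegralZl; [|by []|exact: (integrable_test_cauchy tLL)].
rewrite RintegralZl; [|by []|exact: (integrable_test_cauchy tE)].
rewrite e1 -/N.
have E0 := energy_ge0 beta u.
have h : 0 <= gap * energy beta u by rewrite mulr_ge0// ltW// gap_gt0.
have h2 : (8 * (beta - 1) ^+ 2) * energy beta u <= (8 * (beta - 1) ^+ 2) * (N / gap).
  by rewrite ler_wpM2l// mulr_ge0// sqr_ge0.
rewrite -/(ip2 (cauchy_op beta u) (cauchy_op beta u)) -/N C0E; lra.
Qed.

End apriori.

(** * The domain of the generator *)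

Section weak_limits.
Context {R : realType} {n : nat} (beta : R).
Hypotheses (n1 : (1 < n)%N) (beta_gt : n%:R / 2 + 1 < beta) (beta_le : beta <= n%:R + 1).
Local Notation mu := (cauchy_prob n beta).
Local Notation leb := (@lebesgue_rV R n).
Local Notation ip2 := (@ip2 _ _ _ mu).
Local Notation norm2 := (@norm2 _ _ _ mu).
Local Notation cvg2 := (@cvg2 _ _ _ mu).
Local Notation L2 f := ((f : 'rV[R]_n -> R) \in Lfun mu 2%:E).
Implicit Types (u v F G phi : 'rV[R]_n -> R) (x : 'rV[R]_n).
Let n0 := bochner_n_gt0 n1.
Let b0 := bochner_beta_gt beta_gt.
Let Z := cauchy_Z n beta.
Let Z_neq0 : Z != 0. Proof. by rewrite gt_eqF// cauchy_Z_gt0. Qed.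

Lemma powR_omega_mul p q x : omega x `^ p * omega x `^ q = omega x `^ (p + q).
Proof. by rewrite -powRD//; apply/implyP => _; rewrite gt_eqF// omega_gt0. Qed.

Lemma powR_omegaK p x : omega x `^ (- p) * omega x `^ p = 1.
Proof. by rewrite powR_omega_mul addNr powRr0. Qed.

Lemma powR_omega_split p x : omega x `^ (- p) = omega x `^ (beta - p) * omega x `^ (- beta).
Proof. by rewrite powR_omega_mul; congr (_ `^ _); ring. Qed.

Lemma measurable_powR_omega p : measurable_fun setT (fun x : 'rV[R]_n => omega x `^ p).
Proof. by apply: continuous_measurable_rV; exact: continuous_powR_omega. Qed.

(** On a compact set the powers of omega are bounded, so passing from the density of mu to the
    weight omega^(-p) costs only a constant. *)
Lemma L2_locally_integrable p F : L2 F -> locally_integrable_rV (fun x => omega x `^ (- p) * F x).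
Proof.
move=> LF K cK; have mF := L2_measurable LF.
have mK : measurable K.
  by apply: closed_measurable_rV; apply: compact_closed => //; exact: norm_hausdorff.
have /compact_bounded[M [_ hM]] := cK.
pose h x := Z * omega x `^ (beta - p).
have ch : continuous h.
  by apply: ctsM; [exact: cts_cst|exact: continuous_powR_omega].
have [C hC] := @continuous_bounded_box R n (M + 1) h ch.
have KC x : K x -> `|h x| <= C.
  move=> Kx; apply: hC => i; rewrite -ler_norml; apply: (@le_trans _ _ `|x|).
    exact: norm_coord_le.
  by apply: hM => //; rewrite ltrDl.
have iF : leb.-integrable K (EFin \o (fun x => C * (F x * cauchy_pdf beta x))).
  apply: (@integrableS _ _ _ _ setT) => //.
  rewrite (_ : EFin \o _ = fun x => (C%:E * (F x * cauchy_pdf beta x)%:E)%E)//.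
  apply: integrableZl => //; apply/(integrable_cauchy n0 b0 mF).
  exact: integrable_L2.
apply: le_integrable iF => //.
  apply/measurable_EFinP; apply: (measurable_funS measurableT) => //.
  by apply: measurable_funM => //; exact: measurable_powR_omega.
move=> x Kx; rewrite lee_fin.
have -> : omega x `^ (- p) * F x = h x * (F x * cauchy_pdf beta x).
  by rewrite /h /cauchy_pdf -/Z (powR_omega_split p); field; exact: Z_neq0.
rewrite (normrM (h x)) (normrM C) ler_wpM2r//; exact: le_trans (KC x Kx) (ler_norm C).
Qed.

(* int h phi dx for h = omega^-p F is the inner product in L^2(mu) of F with this
   test function, so it is continuous in F. *)
Definition pairing_test p phi x : R := Z * (omega x `^ (beta - p) * phi x).

Lemma test_pairing p phi : test_function phi -> test_function (pairing_test p phi).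
Proof. by move=> tphi; apply: testZ; apply: testMl => //; exact: smooth_powR_omega. Qed.

Lemma integral_pairing p F phi : L2 F -> test_function phi ->
  (\int[leb]_x ((omega x `^ (- p) * F x) * phi x)%:E = (ip2 F (pairing_test p phi))%:E)%E.
Proof.
move=> LF tphi; have Lp : L2 (pairing_test p phi) by apply: test_L2; exact: test_pairing.
rewrite ip2E// integral_cauchy//; last by apply: measurable_funM; [exact: L2_measurable LF|exact: L2_measurable Lp].
apply: eq_integral => x _; congr EFin; rewrite /pairing_test /cauchy_pdf -/Z.
by rewrite (powR_omega_split p); field; exact: Z_neq0.
Qed.

Lemma integral_by_parts_test i u phi : test_function u -> test_function phi ->
  (\int[leb]_x (u x * partial i phi x)%:E = - \int[leb]_x (partial i u x * phi x)%:E)%E.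
Proof.
move=> tu tphi.
have t1 : test_function (fun x => u x * partial i phi x) by apply: testM => //; exact: test_partial.
have t2 : test_function (fun x => partial i u x * phi x) by apply: testM => //; exact: test_partial.
have e : partial i (fun x => u x * phi x) = fun x => partial i u x * phi x + u x * partial i phi x.
  by apply: has_partialE; apply: has_partialM; apply: smooth_has_partial; exact: test_smooth.
have := @integral_partial_test R n i _ (testM tu tphi); rewrite e.
under eq_integral do rewrite EFinD.
rewrite integralD//; [|exact: integrable_test t2|exact: integrable_test t1].
have f1 := integrable_fin_num measurableT (integrable_test t1).
have f2 := integrable_fin_num measurableT (integrable_test t2).
rewrite -(fineK f1) -(fineK f2) -EFinD => -[] /eqP.
by rewrite addrC addr_eq0 => /eqP ->; rewrite EFinN.
Qed.

(* Used with (p, q) = (0, 1/2) for du and (1/2, 1) for the Hessian: only the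
   derivatives weighted by these powers of omega converge in L^2(mu). *)
Lemma weak_limit i (u : nat -> 'rV[R]_n -> R) F G p q : (forall k, test_function (u k)) -> L2 F -> L2 G ->
  cvg2 (fun k x => omega x `^ p * u k x) F ->
  cvg2 (fun k x => omega x `^ q * partial i (u k) x) G ->
  is_weak_partial i (fun x => omega x `^ (- p) * F x) (fun x => omega x `^ (- q) * G x).
Proof.
move=> tu LF LG uF uG; split; [exact: L2_locally_integrable..|move=> phi tphi].
have tphi1 := test_partial i tphi.
rewrite !integral_pairing// -EFinN; congr EFin.
have t1 k : test_function (fun x => omega x `^ p * u k x) by apply: testMl => //; exact: smooth_powR_omega.
have t2 k : test_function (fun x => omega x `^ q * partial i (u k) x).
  by apply: testMl; [exact: smooth_powR_omega|exact: test_partial].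
have c1 := cvg2_ip (fun k => test_L2 mu (t1 k)) (fun=> test_L2 mu (test_pairing p tphi1)) LF (test_L2 mu (test_pairing p tphi1)) uF (@cvg2_cst _ _ _ mu _).
have c2 := cvg2_ip (fun k => test_L2 mu (t2 k)) (fun=> test_L2 mu (test_pairing q tphi)) LG (test_L2 mu (test_pairing q tphi)) uG (@cvg2_cst _ _ _ mu _).
apply: (cvg_unique (@norm_hausdorff _ _) c1).
rewrite (_ : (fun k => _) = fun k => - ip2 (fun x => omega x `^ q * partial i (u k) x) (pairing_test q phi)); first exact: cvgN.
apply/funext => k; apply: EFin_inj; rewrite EFinN -!integral_pairing//; [|exact: test_L2..].
under eq_integral do rewrite mulrA powR_omegaK mul1r.
under [in RHS]eq_integral do rewrite mulrA powR_omegaK mul1r.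
exact: integral_by_parts_test.
Qed.

(** Needed for second derivatives: the inner [weak_partial j g] is known only almost everywhere. *)
Lemma is_weak_partial_ae i u v w : is_weak_partial i u w -> locally_integrable_rV v ->
  {ae leb, forall x, v x = u x} -> is_weak_partial i v w.
Proof.
move=> [lu lw h] lv uv; split => // phi tphi; rewrite -h//.
have mp := test_measurable (test_partial i tphi).
apply: ae_eq_integral => //.
- by apply/measurable_EFinP; apply: measurable_funM => //; exact: locally_integrable_measurable.
- by apply/measurable_EFinP; apply: measurable_funM => //; exact: locally_integrable_measurable.
- by apply: filterS uv => x e _; rewrite e.
Qed.

End weak_limits.

Lemma cvg_sum_seq {R : realType} (I : Type) (r : seq I) (F : nat -> I -> R) (l : I -> R) :
  (forall i, F k i @[k --> \oo] --> l i) ->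
  (\sum_(i <- r) F k i) @[k --> \oo] --> \sum_(i <- r) l i.
Proof.
move=> h; elim: r => [|i r IH].
  by rewrite big_nil; under eq_fun do rewrite big_nil; exact: cvg_cst.
by rewrite big_cons; under eq_fun do rewrite big_cons; exact: cvgD.
Qed.

Section quadratic_form.
Context {R : realType} {n : nat} (beta : R).
Hypotheses (n1 : (1 < n)%N) (beta_gt : n%:R / 2 + 1 < beta) (beta_le : beta <= n%:R + 1).
Local Notation mu := (cauchy_prob n beta).
Local Notation leb := (@lebesgue_rV R n).
Local Notation ip2 := (@ip2 _ _ _ mu).
Local Notation norm2 := (@norm2 _ _ _ mu).
Local Notation cvg2 := (@cvg2 _ _ _ mu).
Local Notation L2 f := ((f : 'rV[R]_n -> R) \in Lfun mu 2%:E).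
Implicit Types (u v F : 'rV[R]_n -> R) (x : 'rV[R]_n)
  (G : 'I_n -> 'rV[R]_n -> R) (H : 'I_n -> 'I_n -> 'rV[R]_n -> R).

(** The bounded factor that remains of a coordinate once the gradient is weighted by omega^(1/2);
    multiplication by it preserves convergence in L^2. *)
Definition unit_coord i x : R := x ord0 i * omega x `^ (- 2^-1).

Lemma unit_coord_le1 i x : `|unit_coord i x| <= 1.
Proof.
rewrite -(@ler_pXn2r _ 2) ?nnegrE// expr1n real_normK ?num_real// /unit_coord exprMn.
have r0 := rho_gt0 x.
have e : omega x `^ (- 2^-1) = (rho x)^-1 by rewrite powRN.
rewrite e exprVn rho_sqr ler_pdivrMr ?omega_gt0// mul1r.
by apply: le_trans (coord_sqr_le_omega x i); rewrite lerDr.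
Qed.

Lemma measurable_unit_coord i : measurable_fun setT (unit_coord i).
Proof. by apply: measurable_funM; [exact: measurable_rV_coord|exact: measurable_powR_omega]. Qed.

Definition hess_coef : R := n%:R / (n%:R - 1).
Definition grad_coef : R := 4 * (beta - 1) * ((n%:R + 1 - beta) / (n%:R - 1)).

Lemma bochner_density_weighted G H x :
  bochner_density beta (fun i x => omega x `^ (- 2^-1) * G i x) (fun i j x => omega x `^ (- 1) * H i j x) x =
  hess_coef * (\sum_i \sum_j H i j x * H i j x - n%:R^-1 * ((\sum_i H i i x) * (\sum_i H i i x)))
  + grad_coef * (\sum_i \sum_j (unit_coord j x * G i x) * (unit_coord j x * G i x)
    - (\sum_i unit_coord i x * G i x) * (\sum_i unit_coord i x * G i x)).
Proof.
have o0 : omega x != 0 by rewrite gt_eqF// omega_gt0.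
have oV : omega x `^ (- 1) = (omega x)^-1 by rewrite powRN powRr1// ltW// omega_gt0.
rewrite /bochner_density; congr (_ * (_ - _ * _) + _ * (_ - _)).
- rewrite /hesssq mulr_sumr; apply: eq_bigr => i _; rewrite mulr_sumr; apply: eq_bigr => j _.
  by rewrite oV; field.
- rewrite -expr2; congr (_ ^+ 2); rewrite /lapl mulr_sumr; apply: eq_bigr => i _.
  by rewrite oV; field.
- rewrite /gradsq mulr_suml; apply: eq_bigr => i _; rewrite /sqnorm /dotv mulr_sumr.
  by apply: eq_bigr => j _; rewrite /unit_coord; ring.
- rewrite -expr2; congr (_ ^+ 2); rewrite /radial; apply: eq_bigr => i _.
  by rewrite /unit_coord; ring.
Qed.

(** The integral of Q in terms of the weighted derivatives G = omega^(1/2) du and H = omega Hess u.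
    As a combination of inner products it is continuous under L^2 convergence, without any pointwise
    limit inside the integral. *)
Definition bochner_form G H : R :=
  hess_coef * (\sum_i \sum_j ip2 (H i j) (H i j)
    - n%:R^-1 * ip2 (fun x => \sum_i H i i x) (fun x => \sum_i H i i x))
  + grad_coef * (\sum_i \sum_j ip2 (fun x => unit_coord j x * G i x) (fun x => unit_coord j x * G i x)
    - ip2 (fun x => \sum_i unit_coord i x * G i x) (fun x => \sum_i unit_coord i x * G i x)).

Let L2_unit i F : L2 F -> L2 (fun x => unit_coord i x * F x).
Proof. by apply: L2_mulb (unit_coord_le1 i); exact: measurable_unit_coord. Qed.

Local Notation int f := (mu.-integrable setT (EFin \o (f : 'rV[R]_n -> R))).

Lemma integrableD_fin f g : int f -> int g -> int (fun x => f x + g x).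
Proof. by move=> If Ig; exact: (integrableD measurableT If Ig). Qed.
Lemma integrableB_fin f g : int f -> int g -> int (fun x => f x - g x).
Proof. by move=> If Ig; exact: (integrableB measurableT If Ig). Qed.
Lemma integrableZ_fin c f : int f -> int (fun x => c * f x).
Proof. by move=> If; exact: (integrableZl measurableT c If). Qed.
Lemma integrable_sum_fin (f : 'I_n -> 'rV[R]_n -> R) : (forall i, int (f i)) -> int (fun x => \sum_i f i x).
Proof.
move=> If; rewrite (_ : EFin \o _ = fun x => \sum_i (f i x)%:E)%E.
  by apply: integrable_sum => // i _; exact: If.
by apply/funext => x /=; rewrite sumEFin.
Qed.

Lemma integral_bochner_form G H : (forall i, L2 (G i)) -> (forall i j, L2 (H i j)) ->
  (\int[mu]_x (bochner_density beta (fun i x => omega x `^ (- 2^-1) * G i x) (fun i j x => omega x `^ (- 1) * H i j x) x)%:E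
   = (bochner_form G H)%:E)%E.
Proof.
move=> LG LH.
have a1 i j : int (fun x => H i j x * H i j x) by exact: integrableM_L2.
have LT : L2 (fun x => \sum_i H i i x) by apply: L2_sum.
have LR : L2 (fun x => \sum_i unit_coord i x * G i x) by apply: L2_sum => i; exact: L2_unit.
have a2 : int (fun x => (\sum_i H i i x) * (\sum_i H i i x)) by exact: integrableM_L2.
have a3 i j : int (fun x => (unit_coord j x * G i x) * (unit_coord j x * G i x)).
  by apply: integrableM_L2; exact: L2_unit.
have a4 : int (fun x => (\sum_i unit_coord i x * G i x) * (\sum_i unit_coord i x * G i x)).
  exact: integrableM_L2.
have b1 := integrable_sum_fin (fun i => integrable_sum_fin (a1 i)).
have b3 := integrable_sum_fin (fun i => integrable_sum_fin (a3 i)).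
have b2 := integrableZ_fin n%:R^-1 a2.
have c1 := integrableB_fin b1 b2.
have c2 := integrableB_fin b3 a4.
have d1 := integrableZ_fin hess_coef c1.
have d2 := integrableZ_fin grad_coef c2.
under eq_integral do rewrite bochner_density_weighted.
rewrite -[LHS]fineK; last exact: (integrable_fin_num measurableT (integrableD_fin d1 d2)).
congr EFin; rewrite -/(Rintegral mu setT _) (RintegralD measurableT d1 d2).
rewrite (RintegralZl hess_coef measurableT c1) (RintegralZl grad_coef measurableT c2).
rewrite (RintegralB measurableT b1 b2) (RintegralB measurableT b3 a4) (RintegralZl _ measurableT a2).
rewrite (Rintegral_sum_test (fun i => integrable_sum_fin (a1 i))).
rewrite (Rintegral_sum_test (fun i => integrable_sum_fin (a3 i))).
rewrite /bochner_form; congr (_ * (_ - _) + _ * (_ - _)).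
  by apply: eq_bigr => i _; rewrite (Rintegral_sum_test (a1 i)).
by apply: eq_bigr => i _; rewrite (Rintegral_sum_test (a3 i)).
Qed.

Lemma cvg_bochner_form (Gk : nat -> 'I_n -> 'rV[R]_n -> R) (Hk : nat -> 'I_n -> 'I_n -> 'rV[R]_n -> R) G H :
  (forall k i, L2 (Gk k i)) -> (forall k i j, L2 (Hk k i j)) ->
  (forall i, L2 (G i)) -> (forall i j, L2 (H i j)) ->
  (forall i, cvg2 (fun k => Gk k i) (G i)) -> (forall i j, cvg2 (fun k => Hk k i j) (H i j)) ->
  bochner_form (Gk k) (Hk k) @[k --> \oo] --> bochner_form G H.
Proof.
move=> LGk LHk LG LH cG cH.
have LU k i j : L2 (fun x => unit_coord j x * Gk k i x) by exact: L2_unit.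
have LV i j : L2 (fun x => unit_coord j x * G i x) by exact: L2_unit.
have cU i j : cvg2 (fun k x => unit_coord j x * Gk k i x) (fun x => unit_coord j x * G i x).
  by apply: cvg2_mulb (unit_coord_le1 j) _ _ _ => //; exact: measurable_unit_coord.
apply: cvgD; apply: cvgM; try exact: cvg_cst; apply: cvgB.
- by apply: cvg_sum_seq => i; apply: cvg_sum_seq => j; exact: cvg2_ip.
- apply: cvgM; first exact: cvg_cst.
  have c : cvg2 (fun k x => \sum_i Hk k i i x) (fun x => \sum_i H i i x).
    by apply: (@cvg2_sum _ _ _ mu _ _ (fun k i => Hk k i i) (fun i => H i i)).
  have l1 k : L2 (fun x => \sum_i Hk k i i x) by exact: (@L2_sum _ _ _ mu _ _ (fun i => Hk k i i)).
  have l2 : L2 (fun x => \sum_i H i i x) by exact: (@L2_sum _ _ _ mu _ _ (fun i => H i i)).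
  exact: cvg2_ip.
- by apply: cvg_sum_seq => i; apply: cvg_sum_seq => j; exact: cvg2_ip.
- have c : cvg2 (fun k x => \sum_i unit_coord i x * Gk k i x) (fun x => \sum_i unit_coord i x * G i x).
    by apply: (@cvg2_sum _ _ _ mu _ _ (fun k i x => unit_coord i x * Gk k i x)).
  have l1 k : L2 (fun x => \sum_i unit_coord i x * Gk k i x).
    by apply: (@L2_sum _ _ _ mu _ _ (fun i x => unit_coord i x * Gk k i x)).
  have l2 : L2 (fun x => \sum_i unit_coord i x * G i x).
    by apply: (@L2_sum _ _ _ mu _ _ (fun i x => unit_coord i x * G i x)).
  exact: cvg2_ip.
Qed.

End quadratic_form.

Lemma cauchy_exprB {R : realType} {n : nat} (beta : R) (a1 b1 c1 : 'I_n -> 'rV[R]_n -> R)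
    (a2 b2 c2 : 'I_n -> 'I_n -> 'rV[R]_n -> R) x :
  lapl c2 x = lapl a2 x - lapl b2 x -> radial c1 x = radial a1 x - radial b1 x ->
  cauchy_expr beta c1 c2 x = cauchy_expr beta a1 a2 x - cauchy_expr beta b1 b2 x.
Proof. by rewrite /cauchy_expr => -> ->; ring. Qed.

Section generator.
Context {R : realType} {n : nat} (beta : R).
Hypotheses (n1 : (1 < n)%N) (beta_gt : n%:R / 2 + 1 < beta) (beta_le : beta <= n%:R + 1).
Local Notation mu := (cauchy_prob n beta).
Local Notation leb := (@lebesgue_rV R n).
Local Notation ip2 := (@ip2 _ _ _ mu).
Local Notation norm2 := (@norm2 _ _ _ mu).
Local Notation cvg2 := (@cvg2 _ _ _ mu).
Local Notation L2 f := ((f : 'rV[R]_n -> R) \in Lfun mu 2%:E).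
Local Notation Lop := (cauchy_op beta).
Local Notation lam := (@gap R n beta).
Implicit Types (f g h phi : 'rV[R]_n -> R) (x : 'rV[R]_n).
Let n0 := bochner_n_gt0 n1.
Let b0 := bochner_beta_gt beta_gt.

Lemma partial2B f g : smooth f -> smooth g -> forall i j,
  partial i (partial j (fun x => f x - g x)) = fun x => partial i (partial j f) x - partial i (partial j g) x.
Proof.
move=> sf sg i j; apply: etrans (congr1 (partial i) (partialB sf sg j)) _.
exact: (partialB (smooth_partial j sf) (smooth_partial j sg) i).
Qed.

Lemma mul_partialB (r : 'rV[R]_n -> R) (a b c : 'rV[R]_n -> R) : (c = fun x => a x - b x) ->
  (fun x => r x * c x) = (fun x => r x * a x - r x * b x).
Proof. by move=> ->; apply/funext => x; rewrite mulrBr. Qed.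

Lemma cauchy_opB f g : smooth f -> smooth g ->
  Lop (fun x => f x - g x) = fun x => Lop f x - Lop g x.
Proof.
move=> sf sg; apply/funext => x.
have l : lapl (fun i j => partial i (partial j (fun x => f x - g x))) x =
    lapl (fun i j => partial i (partial j f)) x - lapl (fun i j => partial i (partial j g)) x.
  by rewrite /lapl -sumrB; apply: eq_bigr => i _; exact: (congr1 (fun F => F x) (partial2B sf sg i i)).
have r : radial (fun i => partial i (fun x => f x - g x)) x =
    radial (fun i => partial i f) x - radial (fun i => partial i g) x.
  rewrite /radial -sumrB; apply: eq_bigr => i _; apply: etrans (mulrBr _ _ _).
  by congr (_ * _); exact: (congr1 (fun F => F x) (partialB sf sg i)).
by rewrite !cauchy_opE; exact: (cauchy_exprB beta l r).
Qed.

Definition core_sequence g h (u : nat -> 'rV[R]_n -> R) :=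
  [/\ forall k, test_function (u k), L2 g, L2 h, cvg2 u g & cvg2 (fun k => Lop (u k)) h].

Lemma generatorP g h : cauchy_generator beta g h <-> exists u, core_sequence g h u.
Proof.
split=> [[Lg Lh [u [tu cu cLu]]]|[u [tu Lg Lh cu cLu]]].
  exists u; split => //; apply/cvg_LnormP => // k; apply: test_L2 => //.
  exact: test_cauchy_op.
split => //; exists u; split => //; apply/cvg_LnormP => // k; apply: test_L2 => //.
exact: test_cauchy_op.
Qed.

Lemma test_generator f : test_function f -> cauchy_generator beta f (Lop f).
Proof.
move=> tf; apply/generatorP; exists (fun=> f).
by split => //; try exact: cvg2_cst; apply: test_L2 => //; exact: test_cauchy_op.
Qed.

Section core.
Variables (g h : 'rV[R]_n -> R) (u : nat -> 'rV[R]_n -> R).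
Hypothesis gu : core_sequence g h u.
Let tu k : test_function (u k). Proof. by case: gu. Qed.
Let Lg : L2 g. Proof. by case: gu. Qed.
Let Lh : L2 h. Proof. by case: gu. Qed.
Let cu : cvg2 u g. Proof. by case: gu. Qed.
Let cLu : cvg2 (fun k => Lop (u k)) h. Proof. by case: gu. Qed.
Let Lu k : L2 (u k). Proof. exact: test_L2. Qed.
Let tLu k : test_function (Lop (u k)). Proof. exact: test_cauchy_op. Qed.
Let LLu k : L2 (Lop (u k)). Proof. exact: test_L2. Qed.

Lemma core_ip : ip2 (u k) (Lop (u k)) @[k --> \oo] --> ip2 g h.
Proof. exact: cvg2_ip. Qed.

Lemma core_energy : energy beta (u k) @[k --> \oo] --> - ip2 g h.
Proof.
rewrite (_ : (fun k => _) = fun k => - ip2 (u k) (Lop (u k))).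
  by apply: cvgN; exact: core_ip.
by apply/funext => k; rewrite ip2_cauchy_op_energy// opprK.
Qed.

Lemma core_sqr : ip2 (Lop (u k)) (Lop (u k)) @[k --> \oo] --> ip2 h h.
Proof. exact: cvg2_ip. Qed.

(** The estimate [apriori] for u_k - u_l and the linearity of L make this sequence Cauchy. *)
Lemma core_grad i : exists2 G, L2 G & cvg2 (fun k x => rho x * partial i (u k) x) G.
Proof.
have [C C0 hC] := apriori n1 beta_gt beta_le.
apply: (riesz_fischer_dominated C0 _ LLu Lh cLu) => [k|k l].
  by apply: test_L2; exact: test_rho_partial.
have [/(_ i) + _] := hC _ (testB (tu k) (tu l)).
have sk := test_smooth (tu k); have sl := test_smooth (tu l).
by rewrite (cauchy_opB sk sl) (mul_partialB rho (partialB sk sl i)).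
Qed.

Lemma core_hess i j : exists2 H, L2 H & cvg2 (fun k x => omega x * partial i (partial j (u k)) x) H.
Proof.
have [C C0 hC] := apriori n1 beta_gt beta_le.
apply: (riesz_fischer_dominated C0 _ LLu Lh cLu) => [k|k l].
  by apply: test_L2; exact: test_omega_partial2.
have [_ /(_ i j)] := hC _ (testB (tu k) (tu l)).
have sk := test_smooth (tu k); have sl := test_smooth (tu l).
by rewrite (cauchy_opB sk sl) (mul_partialB (@omega R n) (partial2B sk sl i j)).
Qed.

End core.

Lemma generator_L2 g h : cauchy_generator beta g h -> L2 g /\ L2 h.
Proof. by case. Qed.

Lemma generator_sym g g' h h' : cauchy_generator beta g g' -> cauchy_generator beta h h' ->
  ip2 g' h = ip2 g h'.
Proof.
move=> /generatorP[u gu] /generatorP[v hv].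
have [tu Lg Lg' cu cLu] := gu; have [tv Lh Lh' cv cLv] := hv.
have c1 : ip2 (Lop (u k)) (v k) @[k --> \oo] --> ip2 g' h.
  by apply: cvg2_ip => // k; apply: test_L2 => //; exact: test_cauchy_op.
have c2 : ip2 (u k) (Lop (v k)) @[k --> \oo] --> ip2 g h'.
  by apply: cvg2_ip => // k; apply: test_L2 => //; exact: test_cauchy_op.
apply: (cvg_unique (@norm_hausdorff _ _) c1).
rewrite (_ : (fun k => _) = fun k => ip2 (u k) (Lop (v k))) //.
by apply/funext => k; apply: esym; exact: cauchy_op_sym.
Qed.

Lemma generator_le0 g h : cauchy_generator beta g h -> ip2 g h <= 0.
Proof.
move=> /generatorP[u gu]; rewrite -oppr_ge0.
apply: (ler_cvg_to (cvg_cst 0) (core_energy gu)).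
by apply: nearW => k; exact: energy_ge0.
Qed.

Lemma generator_gap g h : cauchy_generator beta g h -> lam * - ip2 g h <= ip2 h h.
Proof.
move=> /generatorP[u gu]; have [tu _ _ _ _] := gu.
apply: (ler_cvg_to (cvgM (cvg_cst lam) (core_energy gu)) (core_sqr gu)).
by apply: nearW => k; exact: energy_gap.
Qed.

(** On test functions L u is the weighted divergence of a compactly supported field; the pairing
    with 1 is continuous in L^2. *)
Lemma generator_mean g h : cauchy_generator beta g h -> ip2 h (fun=> 1) = 0.
Proof.
move=> /generatorP[u [tu Lg Lh cu cLu]].
have c : ip2 (Lop (u k)) (fun=> 1) @[k --> \oo] --> ip2 h (fun=> 1).
  apply: cvg2_ip => // [k|k||]; try exact: L2_cst; try exact: cvg2_cst.
  by apply: test_L2; exact: test_cauchy_op.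
apply: (cvg_unique (@norm_hausdorff _ _) c).
rewrite (_ : (fun k => _) = fun=> 0); first exact: cvg_cst.
apply/funext => k; rewrite -(integral_cauchy_op n1 beta_gt (tu k)).
by apply: eq_Rintegral => x _; rewrite mulr1.
Qed.

(** Integration by parts moves the derivative to u_k, and Cauchy-Schwarz produces its energy, which
    converges to -<g, h>. Thus a sequence whose energy tends to 0 has only limits with zero weak
    gradient. *)
Lemma generator_pairing g h i phi : cauchy_generator beta g h -> test_function phi ->
  ip2 g (pairing_test beta 0 (partial i phi)) ^+ 2 <=
  - ip2 g h * ip2 (pairing_test beta 2^-1 phi) (pairing_test beta 2^-1 phi).
Proof.
move=> /generatorP[u gu] tphi; have [tu Lg Lh cu cLu] := gu.
have t0 := test_pairing beta 0 (test_partial i tphi).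
have tp := test_pairing beta 2^-1 tphi.
have c1 : ip2 (u k) (pairing_test beta 0 (partial i phi)) @[k --> \oo] --> ip2 g (pairing_test beta 0 (partial i phi)).
  by apply: cvg2_ip => // [k|k||]; try exact: test_L2; exact: cvg2_cst.
have c2 : energy beta (u k) * ip2 (pairing_test beta 2^-1 phi) (pairing_test beta 2^-1 phi) @[k --> \oo] -->
    - ip2 g h * ip2 (pairing_test beta 2^-1 phi) (pairing_test beta 2^-1 phi).
  by apply: cvgM; [exact: core_energy|exact: cvg_cst].
have c3 : ip2 (u k) (pairing_test beta 0 (partial i phi)) ^+ 2 @[k --> \oo] -->
    ip2 g (pairing_test beta 0 (partial i phi)) ^+ 2.
  by rewrite expr2; under eq_fun do rewrite expr2; exact: cvgM.
apply: (ler_cvg_to c3 c2).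
apply: nearW => k.
have Lk := test_L2 mu (test_rho_partial i (tu k)).
have e : ip2 (u k) (pairing_test beta 0 (partial i phi)) =
    - ip2 (fun x => rho x * partial i (u k) x) (pairing_test beta 2^-1 phi).
  apply: EFin_inj; rewrite EFinN -(integral_pairing n1 beta_gt 0 (test_L2 mu (tu k)) (test_partial i tphi)).
  rewrite -(integral_pairing n1 beta_gt 2^-1 Lk tphi).
  under eq_integral do rewrite oppr0 powRr0 mul1r.
  under [in RHS]eq_integral do rewrite mulrA powR_omegaK mul1r.
  exact: integral_by_parts_test.
rewrite e sqrrN -(real_normK (num_real _)).
apply: (@le_trans _ _ ((norm2 (fun x => rho x * partial i (u k) x) * norm2 (pairing_test beta 2^-1 phi)) ^+ 2)).
  rewrite lerXn2r ?nnegrE//; first by rewrite mulr_ge0// norm2_ge0.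
  by apply: norm2_cauchy_schwarz => //; exact: test_L2.
rewrite exprMn !norm2_sqr ler_wpM2r ?ip2_ge0// /energy (bigD1 i)//= lerDl.
by apply: sumr_ge0 => j _; exact: ip2_ge0.
Qed.

Lemma measurable_bochner_density (d1 : 'I_n -> 'rV[R]_n -> R) (d2 : 'I_n -> 'I_n -> 'rV[R]_n -> R) :
  (forall i, measurable_fun setT (d1 i)) -> (forall i j, measurable_fun setT (d2 i j)) ->
  measurable_fun setT (bochner_density beta d1 d2).
Proof.
move=> m1 m2; have mo : measurable_fun setT (@omega R n) := @measurable_omega R n.
have ms : measurable_fun setT (@sqnorm R n) by apply: continuous_measurable_rV; exact: continuous_sqnorm.
have ml : measurable_fun setT (lapl d2) by apply: measurable_sum.
have mr : measurable_fun setT (radial d1).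
  by apply: measurable_sum => i; apply: measurable_funM => //; exact: measurable_rV_coord.
have mg : measurable_fun setT (gradsq d1) by apply: measurable_sum => i; exact: measurable_funX.
have mh : measurable_fun setT (hesssq d2).
  by apply: measurable_sum => i; apply: measurable_sum => j; exact: measurable_funX.
apply: measurable_funD; apply: measurable_funM => //; apply: measurable_funB.
- by apply: measurable_funM => //; exact: measurable_funX.
- by apply: measurable_funM => //; apply: measurable_funX; exact: measurable_funM.
- exact: measurable_funM.
- exact: measurable_funX.
Qed.

(** The limits G and H of the weighted derivatives of a core sequence give the weak derivatives
    omega^(-1/2) G and omega^(-1) H of g; the identity for test functions then passes to the limit
    on both sides through [bochner_form]. *)
Theorem generator_bochner g h : cauchy_generator beta g h ->
  (\int[mu]_x (bochner_density beta (fun i => weak_partial i g) (fun i j => weak_partial i (weak_partial j g)) x)%:E =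
   (ip2 h h + lam * ip2 g h)%:E)%E.
Proof.
move=> /generatorP[u gu]; have [tu Lg Lh cu cLu] := gu.
have /(_ _)/cid2-/all_sig2[G LG cG] := core_grad gu.
have /(_ _ _)/cid2-/(_ _)/all_sig2 HH : forall i j, exists2 H, L2 H & cvg2 (fun k x => omega x * partial i (partial j (u k)) x) H := core_hess gu.
have [H LH cH] : exists2 H, forall i j, L2 (H i j) & forall i j, cvg2 (fun k x => omega x * partial i (partial j (u k)) x) (H i j).
  exists (fun i => s2val (HH i)) => i j; first exact: (s2valP (HH i)).
  exact: (s2valP' (HH i)).
pose G' i x := omega x `^ (- 2^-1) * G i x.
pose H' i j x := omega x `^ (- 1) * H i j x.
have w1 i : is_weak_partial i g (G' i).
  have : is_weak_partial i (fun x => omega x `^ (- 0) * g x) (G' i).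
    apply: (weak_limit n1 beta_gt tu Lg (LG i) _ (cG i)).
    by under eq_fun => k do under eq_fun do rewrite powRr0 mul1r.
  by under [X in is_weak_partial i X _]eq_fun do rewrite oppr0 powRr0 mul1r.
have w2 i j : is_weak_partial i (G' j) (H' i j).
  apply: (weak_limit n1 beta_gt (fun k => test_partial j (tu k)) (LG j) (LH i j) (cG j)).
  rewrite (_ : (fun k x => _) = (fun k x => omega x * partial i (partial j (u k)) x)); first exact: cH.
  by apply/funext => k; apply/funext => x; rewrite powRr1// ltW// omega_gt0.
have p1 i := weak_partialP (w1 i).
(* [w2] differentiates the explicit representative G' j, whereas the statement differentiates the
   representative selected by [weak_partial]. *)
have p2 i j : is_weak_partial i (weak_partial j g) (H' i j).
  apply: is_weak_partial_ae (w2 i j) _ (p1 j).2.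
  by have [[]] := p1 j.
have p3 i j := weak_partialP (p2 i j).
have mw1 i : measurable_fun setT (weak_partial i g).
  by apply: locally_integrable_measurable; have [[]] := p1 i.
have mw2 i j : measurable_fun setT (weak_partial i (weak_partial j g)).
  by apply: locally_integrable_measurable; have [[]] := p3 i j.
have mG i : measurable_fun setT (G' i) by apply: locally_integrable_measurable; have [] := w1 i.
have mH i j : measurable_fun setT (H' i j) by apply: locally_integrable_measurable; have [] := w2 i j.
transitivity (\int[mu]_x (bochner_density beta G' H' x)%:E)%E.
  apply: ae_eq_integral => //; try by apply/measurable_EFinP; exact: measurable_bochner_density.
  apply: (ae_cauchy n0 b0).
  have a1 : {ae leb, forall x, forall i, weak_partial i g x = G' i x}.
    by apply: filter_forall => i; exact: (p1 i).2.
  have a2 : {ae leb, forall x, forall i j, weak_partial i (weak_partial j g) x = H' i j x}.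
    by apply: filter_forall => i; apply: filter_forall => j; exact: (p3 i j).2.
  move: a1 a2; apply: filterS2 => x e1 e2 _; congr EFin.
  rewrite /bochner_density /hesssq /lapl /gradsq /radial.
  congr (_ * (_ * _ - _ * (_ * _) ^+ 2) + _ * (_ * _ - _ ^+ 2)).
  - by apply: eq_bigr => i _; apply: eq_bigr => j _; rewrite e2.
  - by apply: eq_bigr => i _; rewrite e2.
  - by apply: eq_bigr => i _; rewrite e1.
  - by apply: eq_bigr => i _; rewrite e1.
rewrite /G' /H' integral_bochner_form//; congr EFin.
have tG k i : test_function (fun x => rho x * partial i (u k) x) by exact: test_rho_partial.
have tH k i j : test_function (fun x => omega x * partial i (partial j (u k)) x) by exact: test_omega_partial2.
have c1 := cvg_bochner_form (fun k i => test_L2 mu (tG k i)) (fun k i j => test_L2 mu (tH k i j)) LG LH cG cH.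
apply: (cvg_unique (@norm_hausdorff _ _) c1).
rewrite -[lam * _]opprK -mulrN.
have c2 : ip2 (Lop (u k)) (Lop (u k)) - lam * energy beta (u k) @[k --> \oo] --> ip2 h h - lam * - ip2 g h.
  by apply: cvgB; [exact: (core_sqr gu)|apply: cvgM; [exact: cvg_cst|exact: (core_energy gu)]].
apply: cvg_trans c2.
rewrite (_ : (fun k => bochner_form beta _ _) = fun k => ip2 (Lop (u k)) (Lop (u k)) - lam * energy beta (u k)) //.
apply/funext => k; rewrite -(integral_bochner n1 beta_gt (tu k)).
apply: EFin_inj; rewrite -integral_bochner_form; [|by move=> i; exact: test_L2|by move=> i j; exact: test_L2].
rewrite /Rintegral fineK; last first.
  by apply: integrable_fin_num => //; apply: integrable_test_cauchy; exact: test_bochner_density.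
apply: eq_integral => x _; congr EFin.
congr (bochner_density beta _ _ x).
  by apply/funext => i; apply/funext => y; rewrite mulrA powR_omegaK mul1r.
apply/funext => i; apply/funext => j; apply/funext => y.
by rewrite mulrA -{2}[omega y]powRr1 ?powR_omegaK ?mul1r// ltW// omega_gt0.
Qed.

End generator.

Lemma near_at_right0P (R : realType) (Q : R -> Prop) :
  (\forall t \near 0^'+, Q t) <-> exists2 d : R, 0 < d & forall t, 0 < t < d -> Q t.
Proof.
split=> [[e /= e0 h]|[d d0 h]].
  exists e => // t /andP[t0 te]; apply: h => //=.
  by rewrite sub0r normrN gtr0_norm.
exists d => //= t /= td t0; apply: h; rewrite t0 /=.
by move: td; rewrite sub0r normrN gtr0_norm.
Qed.

(** * The semigroup in L^2 *)

Section L2_semigroup.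
Context d (T : measurableType d) (R : realType) (mu : probability T R).
Variables (A : (T -> R) -> (T -> R) -> Prop) (P : R -> (T -> R) -> T -> R).
Hypothesis HP : is_semigroup_of mu A P.
Local Notation L2 f := ((f : T -> R) \in Lfun mu 2%:E).
Local Notation ip2 := (@ip2 _ _ _ mu).
Local Notation norm2 := (@norm2 _ _ _ mu).
Local Notation cvg2 := (@cvg2 _ _ _ mu).
Local Notation V := (L2T mu).
Local Notation nrm := (nrm (@ipV _ _ _ mu)).

Lemma cvg_Lnorm_rightP (F : R -> T -> R) : (forall t, 0 < t -> L2 (F t)) ->
  'N[mu]_2%:E[EFin \o F t]%E @[t --> 0^'+] --> 0%E <->
  forall e, 0 < e -> exists2 d, 0 < d & forall t, 0 < t < d -> norm2 (F t) <= e.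
Proof.
move=> LF; split=> [/fine_cvgP[_ /cvgrPdist_le h] e e0|h].
  have [D D0 hD] := (near_at_right0P _).1 (h e e0).
  exists D => // t /andP[t0 tD]; have := hD t; rewrite t0 tD => /(_ isT).
  by rewrite /= Lnorm_norm2 ?LF//= sub0r normrN ger0_norm// norm2_ge0.
apply/fine_cvgP; split.
  apply/near_at_right0P; exists 1 => // t /andP[t0 _].
  by rewrite Lnorm_norm2 ?LF.
apply/cvgrPdist_le => e e0; apply/near_at_right0P.
have [D D0 hD] := h e e0; exists D => // t tD.
rewrite /= Lnorm_norm2 ?LF//=; last by case/andP: tD.
by rewrite sub0r normrN ger0_norm ?norm2_ge0//; exact: hD.
Qed.

(** An element of the L^2 space must come with a proof of square-integrability, which the axioms
    provide for t >= 0; 0 is a default value elsewhere. *)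
Definition lift_semigroup t (x : V) : V :=
  if pselect (L2 (P t x)) is left H then L2pack H else 0.
Local Notation P' := lift_semigroup.

Lemma lift_semigroupE t (x : V) : 0 <= t -> P' t x = P t x :> (T -> R).
Proof.
move=> t0; rewrite /P'; case: pselect => // -[].
by apply: (semigroup_Lfun HP) => //; exact: L2T_L2.
Qed.

Let A' (x y : V) := A x y.

Lemma nrm_dist0_ae (u v : V) : (u : T -> R) = (v : T -> R) %[ae mu] -> nrm (u - v) = 0.
Proof. by move=> uv; rewrite norm2_nrm; apply: ae_eq_norm2B0 => //; apply: L2_measurable; exact: L2T_L2. Qed.

Lemma lift_lin t a (x y : V) : 0 <= t -> nrm (P' t (a *: x + y) - (a *: P' t x + P' t y)) = 0.
Proof.
move=> t0; apply: nrm_dist0_ae.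
apply: filterS (semigroup_linear HP a t0 (L2T_L2 x) (L2T_L2 y)) => z e Dz.
rewrite (lift_semigroupE _ t0); apply: etrans (e Dz) _.
change (a * P t x z + P t y z = a * (P' t x : T -> R) z + (P' t y : T -> R) z).
by rewrite !(lift_semigroupE _ t0).
Qed.

Lemma lift_bnd t : 0 <= t -> exists C, forall x : V, nrm (P' t x) <= C * nrm x.
Proof.
move=> t0; have [C hC] := semigroup_bounded HP t0; exists C => x.
rewrite !norm2_nrm lift_semigroupE//.
have := hC _ (L2T_L2 x); rewrite !Lnorm_norm2 ?L2T_L2//.
by apply: (semigroup_Lfun HP) => //; exact: L2T_L2.
Qed.

Lemma lift_0 (x : V) : nrm (P' 0 x - x) = 0.
Proof.
apply: nrm_dist0_ae; rewrite (lift_semigroupE _ (lexx 0)).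
by apply: (semigroup0 HP); exact: L2T_L2.
Qed.

Lemma lift_D s t (x : V) : 0 <= s -> 0 <= t -> nrm (P' (s + t) x - P' s (P' t x)) = 0.
Proof.
move=> s0 t0; apply: nrm_dist0_ae.
rewrite (lift_semigroupE _ (addr_ge0 s0 t0)) (lift_semigroupE _ s0) (lift_semigroupE _ t0).
by apply: (semigroupD HP) => //; exact: L2T_L2.
Qed.

Lemma lift_cont (x : V) e : 0 < e ->
  exists2 d, 0 < d & forall t, 0 < t < d -> nrm (P' t x - x) <= e.
Proof.
have Lx := L2T_L2 x.
have := semigroup_continuous HP Lx.
rewrite (@cvg_Lnorm_rightP (fun t => P t x - x)%R); last first.
  by move=> t t0; apply: L2B => //; apply: (semigroup_Lfun HP) => //; exact: ltW.
move=> h e0; have [D D0 hD] := h e e0; exists D => // t tD; rewrite norm2_nrm.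
have t0 : 0 <= t by case/andP: tD => /ltW.
by have := hD t tD; rewrite -(lift_semigroupE _ t0).
Qed.

Lemma lift_gen (x y : V) : A' x y <-> forall e, 0 < e ->
  exists2 d, 0 < d & forall t, 0 < t < d -> nrm (t^-1 *: (P' t x - x) - y) <= e.
Proof.
have Lx := L2T_L2 x; have Ly := L2T_L2 y.
apply: (iff_trans (semigroup_generator HP Lx Ly)).
rewrite (@cvg_Lnorm_rightP (fun t => t^-1 *: (P t x - x) - y)%R); last first.
  move=> t t0; apply: L2B => //; apply: L2Z; apply: L2B => //.
  by apply: (semigroup_Lfun HP) => //; exact: ltW.
by split=> h e e0; have [D D0 hD] := h e e0; exists D => // t tD;
  have t0 : 0 <= t by [case/andP: tD => /ltW];
  have := hD t tD; rewrite ?norm2_nrm -(lift_semigroupE _ t0).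
Qed.

Lemma lift_complete (u : nat -> V) :
  (forall e, 0 < e -> exists N, forall m, (N <= m)%N -> nrm (u m - u N) <= e) ->
  exists x, forall e, 0 < e -> exists N, forall m, (N <= m)%N -> nrm (u m - x) <= e.
Proof.
move=> cu; have [f Lf cf] := @riesz_fischer _ _ _ mu (fun k => u k : T -> R) (fun k => L2T_L2 (u k)) cu.
by exists (L2pack Lf).
Qed.

Let gs := @generator_semigroup R V _ (@ipVC _ _ _ mu) (@ipVDl _ _ _ mu) (@ipVZl _ _ _ mu) (@ipV_ge0 _ _ _ mu)
  P' A' lift_lin lift_bnd lift_D lift_gen.

Lemma generator_L2semigroup t f g : L2 f -> L2 g -> 0 <= t -> A f g -> A (P t f) (P t g).
Proof.
move=> Lf Lg t0 Afg; have := gs t0 (Afg : A' (L2pack Lf) (L2pack Lg)).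
by rewrite /A' !lift_semigroupE.
Qed.

Lemma L2semigroup_ip_const f g w : L2 f -> L2 g -> L2 w -> A f g -> (forall t, 0 < t -> ip2 (P t g) w = 0) ->
  forall t, 0 <= t -> ip2 (P t f) w = ip2 f w.
Proof.
move=> Lf Lg Lw Afg h t t0.
have := @semigroup_ip_const R V _ (@ipVC _ _ _ mu) (@ipVDl _ _ _ mu) (@ipVZl _ _ _ mu) (@ipV_ge0 _ _ _ mu)
  lift_complete P' A' lift_lin lift_bnd lift_0 lift_D lift_cont lift_gen (L2pack Lf) (L2pack Lg) (L2pack Lw) Afg.
move=> /(_ _ t t0); rewrite /ipV lift_semigroupE//; apply => s s0.
by rewrite lift_semigroupE ?ltW//; exact: h.
Qed.

Theorem L2semigroup_limit (lam : R) (lam_gt0 : 0 < lam)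
    (A_sym : forall f f' g g', A f f' -> A g g' -> ip2 f' g = ip2 f g')
    (A_neg : forall f f', A f f' -> ip2 f f' <= 0)
    (A_gap : forall f f', A f f' -> lam * - ip2 f f' <= ip2 f' f')
    f g h (Lf : L2 f) (Lg : L2 g) (Lh : L2 h) (Afg : A f g) (Agh : A g h) :
  exists finf, [/\ L2 finf, cvg2 (fun m => P m.+1%:R f) finf,
    - ip2 (P m.+1%:R f) (P m.+1%:R g) @[m --> \oo] --> 0,
    lam * (ip2 f f - ip2 finf finf) <= - ip2 f g &
    (\int[@lebesgue_measure R]_(t in `[0%R, +oo[)
      (ip2 (P t g) (P t g) + lam * ip2 (P t f) (P t g))%:E =
    (2^-1 * (- ip2 f g - lam * (ip2 f f - ip2 finf finf)))%:E)%E].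
Proof.
have A_neg0 := fun x x' (a : A' x x') => A_neg _ _ a.
have [finf [c1 c2 c3 c4]] := @semigroup_limit R V _ (@ipVC _ _ _ mu) (@ipVDl _ _ _ mu) (@ipVZl _ _ _ mu) (@ipV_ge0 _ _ _ mu)
  lift_complete P' A' lift_lin lift_bnd lift_0 lift_D lift_cont lift_gen lam lam_gt0
  (fun x x' y y' a b => A_sym _ _ _ _ a b) A_neg0 (fun x x' a => A_gap _ _ a)
  (L2pack Lf) (L2pack Lg) (L2pack Lh) Afg Agh.
exists finf; split.
- exact: L2T_L2.
- move=> e e0; have [K hK] := c1 e e0; exists K => m Km.
  have e1 := lift_semigroupE (L2pack Lf) (ler0n R m.+1).
  by rewrite -[P _ f]e1; exact: hK m Km.
- apply/cvgrPdist_le => e e0; have [K hK] := c2 e e0; exists K => // m /= Km.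
  have := hK m Km; rewrite /ipV !lift_semigroupE// sub0r opprK => b.
  rewrite ler0_norm; first exact: b.
  by apply: A_neg; apply: generator_L2semigroup.
- exact: c3.
- rewrite -c4; apply: eq_integral => t; rewrite inE /= in_itv/= andbT => t0.
  by rewrite /ipV !lift_semigroupE.
Qed.

End L2_semigroup.

(** * The spectral gap and the integral identity *)

Lemma bochner_density_hessian (R : realType) n (beta : R) (D : 'I_n -> ('rV[R]_n -> R) -> 'rV[R]_n -> R)
    (f : 'rV[R]_n -> R) x :
  n%:R / (n%:R - 1) * (HSnorm (omega x *: hessian D f x) ^+ 2 - n%:R^-1 * (omega x * laplacian D f x) ^+ 2)
  + 4 * (beta - 1) * ((n%:R + 1 - beta) / (n%:R - 1)) *
    (sqnorm (gradient D f x) * sqnorm x - dotv (gradient D f x) x ^+ 2) =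
  bochner_density beta (fun i => D i f) (fun i j => D i (D j f)) x.
Proof.
rewrite /bochner_density; congr (_ * (_ - _) + _ * (_ * _ - _ ^+ 2)).
- rewrite /HSnorm sqr_sqrtr; last by apply: sumr_ge0 => i _; apply: sumr_ge0 => j _; exact: sqr_ge0.
  rewrite /hesssq mulr_sumr; apply: eq_bigr => i _; rewrite mulr_sumr; apply: eq_bigr => j _.
  by rewrite !mxE exprMn.
- by rewrite /sqnorm /dotv /gradsq; apply: eq_bigr => i _; rewrite mxE expr2.
- by rewrite /dotv /radial; apply: eq_bigr => i _; rewrite mxE mulrC.
Qed.

Section conclusion.
Context {R : realType} {n : nat} (beta : R).
Hypotheses (n1 : (1 < n)%N) (beta_gt : n%:R / 2 + 1 < beta) (beta_le : beta <= n%:R + 1).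
Local Notation mu := (cauchy_prob n beta).
Local Notation leb := (@lebesgue_rV R n).
Local Notation ip2 := (@ip2 _ _ _ mu).
Local Notation norm2 := (@norm2 _ _ _ mu).
Local Notation cvg2 := (@cvg2 _ _ _ mu).
Local Notation L2 f := ((f : 'rV[R]_n -> R) \in Lfun mu 2%:E).
Local Notation Lop := (cauchy_op beta).
Local Notation lam := (@gap R n beta).
Implicit Types (f g h phi : 'rV[R]_n -> R) (x : 'rV[R]_n).
Let n0 := bochner_n_gt0 n1.
Let b0 := bochner_beta_gt beta_gt.

Lemma variance_ip2 f : L2 f -> ('V_mu[f] = (ip2 f f - ip2 f (fun=> 1%R) ^+ 2)%:E)%E.
Proof.
move=> Lf; rewrite varianceE// unlock EFinB ip2_sqrE//; congr (_ - _)%E.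
rewrite EFin_expe; congr (_ ^+ 2)%E; rewrite ip2E//; last exact: L2_cst.
by apply: eq_integral => x _; rewrite mulr1.
Qed.

Variable P : R -> ('rV[R]_n -> R) -> 'rV[R]_n -> R.
Hypothesis HP : is_semigroup_of mu (@cauchy_generator R n beta) P.

Lemma L2_semigroup t f : 0 <= t -> L2 f -> L2 (P t f).
Proof. exact: (semigroup_Lfun HP). Qed.

(** The energy tends to 0 along the orbit, so by [generator_pairing] the limit has zero weak
    gradient and is a constant c. The mean is conserved by the semigroup, so c is the mean of f. *)
Lemma limit_square finf f g : cauchy_generator beta f g -> L2 finf ->
  cvg2 (fun m => P m.+1%:R f) finf -> - ip2 (P m.+1%:R f) (P m.+1%:R g) @[m --> \oo] --> 0 ->
  ip2 finf finf = ip2 f (fun=> 1) ^+ 2.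
Proof.
move=> Afg Linf cf cE; have [Lf Lg] := generator_L2 Afg.
have AP t : 0 <= t -> cauchy_generator beta (P t f) (P t g).
  by move=> t0; apply: (generator_L2semigroup HP).
have LP m : L2 (P m.+1%:R f) by exact: L2_semigroup.
have L1 := L2_cst mu 1.
have gw i phi : test_function phi -> (\int[leb]_x (finf x * partial i phi x)%:E = 0)%E.
  move=> tphi; have tp := test_pairing beta 0 (test_partial i tphi).
  have := integral_pairing n1 beta_gt 0 Linf (test_partial i tphi).
  under eq_integral do rewrite oppr0 powRr0 mul1r.
  move=> ->; congr EFin.
  set psi := pairing_test beta 0 _; set psi' := pairing_test beta 2^-1 phi.
  have Lpsi : L2 psi by exact: test_L2.
  have c1 : ip2 (P m.+1%:R f) psi @[m --> \oo] --> ip2 finf psi.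
    by apply: cvg2_ip => //; exact: cvg2_cst.
  have c2 : ip2 (P m.+1%:R f) psi ^+ 2 @[m --> \oo] --> ip2 finf psi ^+ 2.
    by rewrite expr2; under eq_fun do rewrite expr2; exact: cvgM.
  have c3 : - ip2 (P m.+1%:R f) (P m.+1%:R g) * ip2 psi' psi' @[m --> \oo] --> 0 * ip2 psi' psi'.
    by apply: cvgM => //; exact: cvg_cst.
  (* A square bounded by 0: the energy bound along the orbit passes to the limit with its right-hand
     side tending to 0. *)
  have : ip2 finf psi ^+ 2 <= 0 * ip2 psi' psi'.
    apply: (ler_cvg_to c2 c3); apply: nearW => m.
    by apply: (generator_pairing n1 beta_gt) => //; exact: AP.
  by rewrite mul0r => h; apply/eqP; rewrite -sqrf_eq0 eq_le h sqr_ge0.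
have linf : locally_integrable_rV finf.
  have := L2_locally_integrable n1 beta_gt 0 Linf.
  by under [X in locally_integrable_rV X]eq_fun do rewrite oppr0 powRr0 mul1r.
have [c /(ae_cauchy n0 b0) hc] := weak_gradient_eq0 linf gw.
have minf := L2_measurable Linf.
have e h : L2 h -> ip2 finf h = c * ip2 (fun=> 1) h.
  move=> Lh; have mh := L2_measurable Lh; rewrite -ip2Zl// (@ae_eq_ip2 _ _ _ mu _ (fun=> c * 1))//.
  by apply: filterS hc => x -> _; rewrite mulr1.
have e1 : ip2 finf (fun=> 1) = c.
  by rewrite e// /ip2 Rintegral_cst//= probability_setT !mulr1.
have -> : ip2 f (fun=> 1) = ip2 finf (fun=> 1).
  have c1 : ip2 (P m.+1%:R f) (fun=> 1) @[m --> \oo] --> ip2 finf (fun=> 1).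
    by apply: cvg2_ip => //; exact: cvg2_cst.
  apply: (cvg_unique (@norm_hausdorff _ _) _ c1).
  rewrite (_ : (fun m => _) = fun=> ip2 f (fun=> 1)); first exact: cvg_cst.
  apply/funext => m; apply: (L2semigroup_ip_const HP Lf Lg L1 Afg) => // t t0.
  by apply: (generator_mean n1 beta_gt (AP t (ltW t0))).
by rewrite e// (@ip2C _ _ _ mu) e1 expr2.
Qed.

Lemma generator_iterate f : test_function f ->
  cauchy_generator beta f (Lop f) /\ cauchy_generator beta (Lop f) (Lop (Lop f)).
Proof. by move=> tf; split; apply: test_generator => //; exact: test_cauchy_op. Qed.

(** L preserves test functions, so f and L f both lie in the domain, as the differentiation of the
    energy requires; the abstract limit is then replaced by the mean. *)
Lemma test_limit f : test_function f ->
  lam * (ip2 f f - ip2 f (fun=> 1) ^+ 2) <= - ip2 f (Lop f) /\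
  (\int[@lebesgue_measure R]_(t in `[0%R, +oo[)
      (ip2 (P t (Lop f)) (P t (Lop f)) + lam * ip2 (P t f) (P t (Lop f)))%:E =
    (2^-1 * (- ip2 f (Lop f) - lam * (ip2 f f - ip2 f (fun=> 1) ^+ 2)))%:E)%E.
Proof.
move=> tf; have tg := test_cauchy_op beta tf; have th := test_cauchy_op beta tg.
have [Afg Agh] := generator_iterate tf.
have [finf [Linf c1 c2 c3 c4]] := L2semigroup_limit HP (gap_gt0 beta_gt) (@generator_sym R n beta n1 beta_gt)
  (generator_le0 n1 beta_gt) (generator_gap n1 beta_gt beta_le) (test_L2 mu tf) (test_L2 mu tg) (test_L2 mu th) Afg Agh.
by rewrite -(limit_square Afg Linf c1 c2).
Qed.

Lemma generator_poincare f g : cauchy_generator beta f g ->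
  lam * (ip2 f f - ip2 f (fun=> 1) ^+ 2) <= - ip2 f g.
Proof.
move=> /generatorP[u uf]; have [tu Lf Lg cu cLu] := uf.
have Lu k : L2 (u k) by exact: test_L2.
have c1 : lam * (ip2 (u k) (u k) - ip2 (u k) (fun=> 1) ^+ 2) @[k --> \oo] -->
    lam * (ip2 f f - ip2 f (fun=> 1) ^+ 2).
  apply: cvgM; first exact: cvg_cst.
  apply: cvgB; first exact: cvg2_ip.
  have c : ip2 (u k) (fun=> 1) @[k --> \oo] --> ip2 f (fun=> 1).
    by apply: cvg2_ip => //; try exact: cvg2_cst; move=> *; exact: L2_cst.
  by rewrite expr2; under eq_fun do rewrite expr2; exact: cvgM.
have c2 : - ip2 (u k) (Lop (u k)) @[k --> \oo] --> - ip2 f g.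
  by apply: cvgN; exact: (core_ip uf).
by apply: (ler_cvg_to c1 c2); apply: nearW => k; have [] := test_limit (tu k).
Qed.

Lemma le_spectral_gap : (lam%:E <= spectral_gap mu (@cauchy_generator R n beta))%E.
Proof.
apply: le_ereal_inf_tmp => _ [f [g [Afg V0 ->]]].
have [Lf Lg] := generator_L2 Afg.
move: V0; rewrite (variance_ip2 Lf); set v := _ - _ => v0.
have v_neq0 : v != 0 by move: v0; rewrite eqe.
have vge0 : 0 <= v by rewrite -lee_fin -(variance_ip2 Lf); exact: variance_ge0.
have vgt0 : 0 < v by rewrite lt_neqAle eq_sym v_neq0.
have -> : (\int[mu]_x (- f x * g x)%:E = (- ip2 f g)%:E)%E.
  rewrite -mulN1r -ip2Zl// ip2E//; last exact: L2Z.
  by apply: eq_integral => x _; rewrite mulN1r.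
by rewrite inver (negbTE v_neq0) -EFinM lee_fin ler_pdivlMr//; exact: generator_poincare.
Qed.

Lemma inner_integral f t : test_function f -> 0 <= t ->
  (\int[mu]_x (bochner_density beta (fun i => weak_partial i (P t f)) (fun i j => weak_partial i (weak_partial j (P t f))) x)%:E
   = (ip2 (P t (Lop f)) (P t (Lop f)) + lam * ip2 (P t f) (P t (Lop f)))%:E)%E.
Proof.
move=> tf t0; apply: (generator_bochner n1 beta_gt beta_le).
have [Afg _] := generator_iterate tf; have [Lf Lg] := generator_L2 Afg.
exact: (generator_L2semigroup HP).
Qed.

End conclusion.

Theorem corollary4p11 (R : realType) (n : nat) (beta : R)
    (P : R -> ('rV[R]_n -> R) -> 'rV[R]_n -> R)
    (n_ge2 : (2 <= n)%N)
    (beta_gt : n%:R / 2 + 1 < beta) (beta_le : beta <= n%:R + 1)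
    (semigroupP : is_semigroup_of (cauchy_prob n beta)
                                  (@cauchy_generator R n beta) P) :
  ((4 * (beta - n%:R / 2 - 1))%:E <=
     spectral_gap (cauchy_prob n beta) (@cauchy_generator R n beta))%E /\
  forall f : 'rV[R]_n -> R, test_function f ->
  ((4 * (beta - n%:R / 2 - 1))%:E * 'V_(cauchy_prob n beta)[f]
   - \int[cauchy_prob n beta]_x
       (sqnorm (gradient partial f x) * (1 + sqnorm x))%:E =
   - 2%:E * \int[@lebesgue_measure R]_(t in `[0%R, +oo[)
       \int[cauchy_prob n beta]_x
         (n%:R / (n%:R - 1) *
            (HSnorm (omega x *: hessian weak_partial (P t f) x) ^+ 2
             - n%:R^-1 * (omega x * laplacian weak_partial (P t f) x) ^+ 2)
          + 4 * (beta - 1) * ((n%:R + 1 - beta) / (n%:R - 1)) *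
            (sqnorm (gradient weak_partial (P t f) x) * sqnorm x
             - dotv (gradient weak_partial (P t f) x) x ^+ 2))%:E)%E.
Proof.
split; first exact: (le_spectral_gap n_ge2 beta_gt beta_le semigroupP).
move=> f tf; have [_ I] := test_limit n_ge2 beta_gt beta_le semigroupP tf.
set J := (X in (_ = _ * X)%E).
have -> : J = (\int[@lebesgue_measure R]_(t in `[0%R, +oo[)
    (@ip2 _ _ _ (cauchy_prob n beta) (P t (cauchy_op beta f)) (P t (cauchy_op beta f)) +
      @gap R n beta * @ip2 _ _ _ (cauchy_prob n beta) (P t f) (P t (cauchy_op beta f)))%:E)%E.
  (* The integrands are compared for t >= 0 only, where P_t maps the domain of the generator to
     itself and [generator_bochner] applies to P_t f. *)
  rewrite /J; apply: eq_integral => t; rewrite inE /= in_itv/= andbT => t0.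
  rewrite -(inner_integral n_ge2 beta_gt beta_le semigroupP tf t0).
  by apply: eq_integral => x _; congr EFin; exact: bochner_density_hessian.
rewrite I (variance_ip2 (test_L2 _ tf)).
have -> : (\int[cauchy_prob n beta]_x (sqnorm (gradient partial f x) * (1 + sqnorm x))%:E)%E =
    (- @ip2 _ _ _ (cauchy_prob n beta) f (cauchy_op beta f))%:E.
  rewrite (ip2_cauchy_op_energy n_ge2 beta_gt tf) opprK (energyE beta tf).
  rewrite /Rintegral fineK.
    apply: eq_integral => x _; congr EFin; rewrite mulrC; congr (_ * _).
    by rewrite /sqnorm /dotv /gradsq; apply: eq_bigr => i _; rewrite mxE expr2.
  apply: integrable_fin_num => //; apply: integrable_test_cauchy.
  by apply: testMl; [exact: smooth_omega|exact: test_gradsq].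
rewrite -/(@gap R n beta) -EFinM -EFinB -EFinN -EFinM; congr EFin.
by field.
Qed.
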